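(* The only maximally supersymmetric solution of type IIA supergravity is, locally, a flat spacetime with constant dilaton and vanishing $(A,H,G)$. That is: let $(N,h,\Phi,H,A,G)$ be a solution of type IIA supergravity which is maximally supersymmetric, i.e. whose space of Killing spinors has dimension $32$. Then $(N,h)$ is flat, the dilaton $\Phi$ is constant, $H=0$, $G=0$, and the RR one-form potential $A$ vanishes up to gauge transformations (equivalently, locally, $dA=0$). Conversely, locally, the data consisting of a flat ten-dimensional lorentzian metric $h$, a constant function $\Phi$, and $A=0$, $H=0$, $G=0$ is a maximally supersymmetric solution of type IIA supergravity.
   Context: **Eleven-dimensional supergravity (bosonic).** The data is $(M,g,F)$ where $(M,g)$ is an eleven-dimensional lorentzian manifold (signature $(1,10)$, one timelike direction, spacelike vectors having positive norm) with a spin structure, and $F\in\Omega^4(M)$ is a closed $4$-form. It is a *(classical) solution* if $$\mathrm{Ric}(g)=T(g,F),\qquad T(X,Y)=\tfrac12\langle \imath_XF,\imath_YF\rangle-\tfrac16\, g(X,Y)\,|F|^2,\qquad d\star F=\tfrac12 F\wedge F,$$ where $\langle-,-\rangle$ is the scalar product on forms induced by $g$ (wedge products of distinct elements of an orthonormal coframe are orthogonal and have norm $\pm1$) and $|F|^2=\langle F,F\rangle$. Let $S$ be the real rank-$32$ bundle of spinors on $M$, a bundle of irreducible modules over the Clifford bundle $\mathrm{C}\ell(T^*M)$, where $\mathrm{C}\ell(1,10)\cong \mathrm{Mat}(32,\mathbb{R})\oplus\mathrm{Mat}(32,\mathbb{R})$ (so vectors satisfy $X\cdot X=+g(X,X)$);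 one of the two inequivalent modules, distinguished by whether the normalised volume element acts as $+1$ or $-1$, is fixed once and for all. Let $c:\Lambda T^*M\to\mathrm{End}(S)$ be the composition of the standard vector bundle isomorphism $\Lambda T^*M\cong\mathrm{C}\ell(T^*M)$ with the Clifford action. The supercovariant connection on $S$ is $$D_X\varepsilon=\nabla_X\varepsilon-\Omega_X(F)\varepsilon,\qquad \Omega_X(F)=\tfrac1{12}c(X^\flat\wedge F)-\tfrac16 c(\imath_XF),$$ with $\nabla$ the spin connection and $X^\flat$ the one-form dual to $X$. A Killing spinor of $(M,g,F)$ is a section $\varepsilon$ of $S$ with $D\varepsilon=0$ (the space of Killing spinors includes $0$). **Type IIA supergravity by Kaluza–Klein reduction.** The data $(N,h,\Phi,H,A,G)$ consists of a connected ten-dimensional lorentzian manifold $(N,h)$, a function $\Phi$ on $N$ (the dilaton), a closed form $H\in\Omega^3(N)$ (NSNS $3$-form), a (locally defined) one-form $A$ on $N$ (RR one-form potential, defined up to gauge transformations $A\mapsto A+d\lambda$, which can be absorbed in a redefinition of $\theta$ below), and $G\in\Omega^4(N)$ (RR $4$-form field-strength). Let $\pi:M\to N$ be the associated principal bundle with group the circle or $\mathbb{R}$, with fibre coordinate $\theta$, generating vector field $\xi=\partial_\theta$ and connection one-form $\omega=d\theta+A$ (the pullback of $A$ to $M$ being understood), and set $$g=\pi^*h+e^{\pi^*\Phi}\,\omega\otimes\omega,\qquad F=\omega\wedge\pi^*H+\pi^*G.$$ Then $\xi$ is a spacelike Killing vector of $g$ leaving $F$ invariant. The data $(N,h,\Phi,H,A,G)$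 is a *solution of type IIA supergravity* if $(M,g,F)$ is a classical solution of eleven-dimensional supergravity (in particular $dF=0$). All considerations are local, so the circle and $\mathbb{R}$ cases are not distinguished. **IIA Killing spinors and maximal supersymmetry.** The spinorial Lie derivative along $\xi$ is $\mathcal{L}_\xi\varepsilon=\nabla_\xi\varepsilon+\tfrac14c(d\xi^\flat)\varepsilon$. The Killing spinors of $(N,h,\Phi,H,A,G)$ correspond (locally) to the Killing spinors $\varepsilon$ of $(M,g,F)$ that are invariant, i.e. to the solutions of $D\varepsilon=0$ and $\mathcal{L}_\xi\varepsilon=0$. The solution $(N,h,\Phi,H,A,G)$ is *maximally supersymmetric* if the space of its Killing spinors has the maximal dimension $32$. *)

(* Defs.v *)
From HB Require Import structures.
From mathcomp Require Import all_boot all_order all_algebra.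
From mathcomp Require Import all_classical all_reals all_analysis.

Set Implicit Arguments.
Unset Strict Implicit.
Unset Printing Implicit Defensive.

Import Order.TTheory GRing.Theory Num.Theory.
Import numFieldNormedType.Exports.

Local Open Scope classical_set_scope.
Local Open Scope ring_scope.

Section Calculus.
Variables (R : realType) (n : nat).
Implicit Types (U : set 'rV[R]_n) (f : 'rV[R]_n -> R).

Definition partial (i : 'I_n) f : 'rV[R]_n -> R := 'D_(delta_mx 0 i) f.

Fixpoint Ck_on (k : nat) U f : Prop :=
  match k with
  | 0 => forall x, U x -> {for x, continuous f}
  | k'.+1 => forall i : 'I_n,
      (forall x, U x -> derivable f x (delta_mx 0 i)) /\
      Ck_on k' U (partial i f)
  end.

Definition smooth_on U f : Prop := forall k, Ck_on k U f.

Definition smooth_mx_on (p q : nat) U (f : 'rV[R]_n -> 'M[R]_(p, q)) : Prop :=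
  forall a b, smooth_on U (fun x => f x a b).

Definition jacobian (p : nat) (f : 'rV[R]_n -> 'rV[R]_p) (x : 'rV[R]_n)
    : 'M[R]_(p, n) :=
  \matrix_(a < p, b < n) partial b (fun y => f y 0 a) x.

End Calculus.

(* An element of the exterior algebra of the dual of R^n is the family of its
   coefficients on e^{i_1} /\ ... /\ e^{i_k}, where {i_1 < ... < i_k} ranges
   over the subsets of 'I_n. *)
Definition form (R : realType) (n : nat) := {ffun {set 'I_n} -> R^o}.

Section Forms.
Variable R : realType.

Definition has_degree (n k : nat) (a : form R n) : Prop :=
  forall S : {set 'I_n}, #|S| != k -> a S = 0.

Definition inversions (n : nat) (A B : {set 'I_n}) : nat :=
  #|[set p : 'I_n * 'I_n | [&& p.1 \in A, p.2 \in B & (p.2 < p.1)%N]]%SET|.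

Definition wedge (n : nat) (a b : form R n) : form R n :=
  [ffun S : {set 'I_n} => \sum_(A : {set 'I_n} | A \subset S)
     (-1) ^+ inversions A (S :\: A) * a A * b (S :\: A)].

Definition form1 (n : nat) : form R n := [ffun S : {set 'I_n} => (#|S| == 0)%:R].

Definition one_form (n : nat) (v : 'rV[R]_n) : form R n :=
  [ffun S : {set 'I_n} => \sum_(i < n | S == [set i]%SET) v 0 i].

Definition row_of_form (n : nat) (a : form R n) : 'rV[R]_n :=
  \row_(i < n) a [set i]%SET.

Definition contract (n : nat) (v : 'rV[R]_n) (a : form R n) : form R n :=
  [ffun S : {set 'I_n} => \sum_(i < n | i \notin S)
     v 0 i * (-1) ^+ #|[set j in S | (j < i)%N]%SET| * a (i |: S)%SET].

(* The algebra morphism e^i |-> \sum_j J i j e^j; it is the pull-back of forms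
   along the linear map of matrix J acting on column vectors. *)
Definition pull (m n : nat) (J : 'M[R]_(m, n)) (a : form R m) : form R n :=
  \sum_(T : {set 'I_m})
     a T *: \big[@wedge n/form1 n]_(i <- enum T) one_form (row i J).

Definition extd (n : nat) (a : 'rV[R]_n -> form R n) (x : 'rV[R]_n) : form R n :=
  [ffun S : {set 'I_n} => \sum_(i in S)
     (-1) ^+ #|[set j in S | (j < i)%N]%SET|
       * partial i (fun y => a y (S :\ i)%SET) x].

Definition smooth_form_on (n : nat) (U : set 'rV[R]_n)
    (a : 'rV[R]_n -> form R n) : Prop :=
  forall S, smooth_on U (fun x => a x S).

(* Local exactness of a 1-form on an open set: the pure gauge condition. *)
Definition pure_gauge_on (n : nat) (U : set 'rV[R]_n)
    (a : 'rV[R]_n -> form R n) : Prop :=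
  forall x, U x -> exists W : set 'rV[R]_n, exists lam : 'rV[R]_n -> R,
    [/\ open W, W x, W `<=` U, smooth_on W lam &
        forall y, W y -> a y = extd (fun z => lam z *: form1 n) y].

End Forms.

Section Lorentz.
Variables (R : realType) (n : nat).

Definition eta (i : 'I_n) : R := if i == 0%N :> nat then -1 else 1.
Definition eta_mx : 'M[R]_n := diag_mx (\row_(i < n) eta i).

Definition lorentzian_form (g : 'M[R]_n) : Prop :=
  exists2 P : 'M[R]_n, P \in unitmx & g = P^T *m eta_mx *m P.

(* A coframe is a matrix E whose rows are the coordinate components of the
   orthonormal 1-forms e^a; [flat_comp E a] has as coefficients the components
   of a in that coframe. *)
Definition flat_comp (E : 'M[R]_n) (a : form R n) : form R n := pull (invmx E) a.

Definition eta_set (S : {set 'I_n}) : R := \prod_(i in S) eta i.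

Definition form_inner (E : 'M[R]_n) (a b : form R n) : R :=
  \sum_(S : {set 'I_n}) eta_set S * flat_comp E a S * flat_comp E b S.

(* a /\ star b = <a, b> e^0 /\ ... /\ e^{n-1}. *)
Definition hodge (E : 'M[R]_n) (a : form R n) : form R n :=
  pull E [ffun S : {set 'I_n} =>
    (-1) ^+ inversions (~: S)%SET S * eta_set (~: S)%SET
      * flat_comp E a (~: S)%SET].

End Lorentz.

Section Curvature.
Variables (R : realType) (n : nat) (g : 'rV[R]_n -> 'M[R]_n).

Definition dg (x : 'rV[R]_n) (i j k : 'I_n) : R :=
  partial i (fun y => g y j k) x.

(* The Christoffel symbol with upper index r and lower indices m, l. *)
Definition christoffel (r m l : 'I_n) (x : 'rV[R]_n) : R :=
  2^-1 * \sum_(s < n) invmx (g x) r s * (dg x m s l + dg x l s m - dg x s m l).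

(* R^r_{s m k}, the dx^r-component of R(d_m, d_k) d_s. *)
Definition riemann (x : 'rV[R]_n) (r s m k : 'I_n) : R :=
  partial m (christoffel r k s) x - partial k (christoffel r m s) x
  + \sum_(l < n) (christoffel r m l x * christoffel l k s x
                  - christoffel r k l x * christoffel l m s x).

Definition ricci (x : 'rV[R]_n) (s k : 'I_n) : R :=
  \sum_(r < n) riemann x r s r k.

End Curvature.

(* The manifold is the open subset [carrier] of X, so that restriction to an
   open subset keeps the same charts; [param i] is the inverse of [chart i]. *)
Record atlas (R : realType) (X : topologicalType) (n : nat) := Atlas {
  idx : Type;
  carrier : set X;
  dom : idx -> set X;
  chart : idx -> X -> 'rV[R]_n;
  param : idx -> 'rV[R]_n -> X
}.

Arguments carrier {R X n}.

Section Manifold.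
Variables (R : realType) (X : topologicalType) (n : nat) (N : atlas R X n).
Implicit Types i j : idx N.

Definition coords i : set 'rV[R]_n := chart i @` dom i.
Definition overlap i j : set 'rV[R]_n := chart i @` (dom i `&` dom j).
Definition trans i j (x : 'rV[R]_n) : 'rV[R]_n := chart j (param i x).

Definition manifold : Prop :=
  [/\ hausdorff_space X, @second_countable X, open (carrier N) &
      forall p, carrier N p <-> exists i, dom i p] /\
  [/\ forall i, open (dom i) /\ open (coords i),
      forall i p, dom i p -> param i (chart i p) = p,
      forall i p, dom i p -> {for p, continuous (chart i)},
      forall i x, coords i x -> {for x, continuous (param i)} &
      forall i j, smooth_mx_on (overlap i j) (trans i j)].

Definition open_submanifold (U : set X) : atlas R X n :=
  @Atlas R X n (idx N) (carrier N `&` U) (fun i => dom i `&` U)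
    (@chart _ _ _ N) (@param _ _ _ N).

Definition smooth_function (f : X -> R) : Prop :=
  forall i, smooth_on (coords i) (fun x => f (param i x)).

Definition form_field (k : nat) (a : idx N -> 'rV[R]_n -> form R n) : Prop :=
  [/\ forall i x, coords i x -> has_degree k (a i x),
      forall i, smooth_form_on (coords i) (a i) &
      forall i j x, overlap i j x ->
        a i x = pull (jacobian (trans i j) x) (a j (trans i j x))].

Definition closed_form (a : idx N -> 'rV[R]_n -> form R n) : Prop :=
  forall i x, coords i x -> extd (a i) x = 0.

(* A 1-form given on each chart, and up to exact forms on the overlaps. *)
Definition gauge_potential (a : idx N -> 'rV[R]_n -> form R n) : Prop :=
  [/\ forall i x, coords i x -> has_degree 1 (a i x),
      forall i, smooth_form_on (coords i) (a i) &
      forall i j, pure_gauge_on (overlap i j) (fun x =>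
        a i x - pull (jacobian (trans i j) x) (a j (trans i j x)))].

Definition lorentzian_metric (g : idx N -> 'rV[R]_n -> 'M[R]_n) : Prop :=
  [/\ forall i x, coords i x -> lorentzian_form (g i x),
      forall i, smooth_mx_on (coords i) (g i) &
      forall i j x, overlap i j x ->
        g i x = (jacobian (trans i j) x)^T *m g j (trans i j x)
                  *m jacobian (trans i j) x].

Definition flat_metric (g : idx N -> 'rV[R]_n -> 'M[R]_n) : Prop :=
  forall i x, coords i x -> forall r s m k, riemann (g i) x r s m k = 0.

End Manifold.

Section Clifford.
Variable R : realType.

Definition clifford_monomial (gam : 'I_11 -> 'M[R]_32) (S : {set 'I_11})
    : 'M[R]_32 :=
  \big[mulmx/1%:M]_(i <- enum S) gam i.

(* [gam a] is the Clifford action of the a-th element of an orthonormal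
   coframe. As Cl(1,10) = Mat_32(R) + Mat_32(R), a module of rank 32 is
   irreducible; the sign of the volume element tells the two modules apart. *)
Definition clifford_module (gam : 'I_11 -> 'M[R]_32) : Prop :=
  (forall a b : 'I_11,
     gam a *m gam b + gam b *m gam a = (2 * (eta_mx R 11) a b)%:M) /\
  (clifford_monomial gam [set: 'I_11]%SET = 1%:M \/
   clifford_monomial gam [set: 'I_11]%SET = - 1%:M).

Variable gam : 'I_11 -> 'M[R]_32.

Definition clifford_vec (v : 'rV[R]_11) : 'M[R]_32 := \sum_(a < 11) v 0 a *: gam a.

Definition spin_group (s : 'M[R]_32) : Prop :=
  exists vs : seq 'rV[R]_11,
    [/\ ~~ odd (size vs),
        forall v, v \in vs ->
          (v *m eta_mx R 11 *m v^T) 0 0 = 1 \/ (v *m eta_mx R 11 *m v^T) 0 0 = -1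
      & s = \big[mulmx/1%:M]_(v <- vs) clifford_vec v].

(* The action c(a) of a form a given in coordinates, in the coframe E. *)
Definition cliff (E : 'M[R]_11) (a : form R 11) : 'M[R]_32 :=
  \sum_(S : {set 'I_11}) flat_comp E a S *: clifford_monomial gam S.

End Clifford.

(* A spin structure given by an orthonormal coframe on each chart and, on the
   overlaps, by lifts to the spin group of the changes of coframe: [strans j k]
   maps the spinor components in the j-th coframe to those in the k-th one. *)
Record spin_data (R : realType) (I : Type) (Y : Type) := SpinData {
  coframe : I -> 'rV[R]_11 -> 'M[R]_11;
  strans : I -> I -> Y -> 'M[R]_32
}.

Section Supergravity.
Variables (R : realType) (gam : 'I_11 -> 'M[R]_32).
Variables (Y : topologicalType) (M : atlas R Y 11).
Variables (g : idx M -> 'rV[R]_11 -> 'M[R]_11).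
Variables (F : idx M -> 'rV[R]_11 -> form R 11).
Variable (sp : spin_data R (idx M) Y).
Implicit Types (j k l : idx M) (y v : 'rV[R]_11).

Local Notation E := (coframe sp).

Definition coframe_change j k (m : Y) : 'M[R]_11 :=
  E k (chart k m) *m jacobian (trans j k) (chart j m)
    *m invmx (E j (chart j m)).

Definition spin_structure : Prop :=
  [/\ forall j, smooth_mx_on (coords j) (E j),
      forall j y, coords j y ->
        E j y \in unitmx /\ g j y = (E j y)^T *m eta_mx R 11 *m E j y &
      forall j k, smooth_mx_on (overlap j k)
        (fun y => strans sp j k (param j y))] /\
  [/\ forall j k m, (dom j `&` dom k) m -> spin_group gam (strans sp j k m),
      forall j k m, (dom j `&` dom k) m -> forall a : 'I_11,
        gam a *m strans sp j k m =
        strans sp j k m *m \sum_(b < 11) coframe_change j k m a b *: gam b &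
      forall j k l m, (dom j `&` dom k `&` dom l) m ->
        strans sp j l m = strans sp k l m *m strans sp j k m].

Definition sugra_background : Prop :=
  [/\ manifold M, lorentzian_metric g, spin_structure, form_field 4 F &
      closed_form F].

Definition stress j y (a b : 'I_11) : R :=
  2^-1 * form_inner (E j y) (contract (delta_mx 0 a) (F j y))
                            (contract (delta_mx 0 b) (F j y))
  - 6^-1 * g j y a b * form_inner (E j y) (F j y) (F j y).

Definition sugra_solution : Prop :=
  [/\ sugra_background,
      forall j y, coords j y -> forall a b, ricci (g j) y a b = stress j y a b &
      forall j y, coords j y ->
        extd (fun z => hodge (E j z) (F j z)) y =
        2^-1 *: wedge (F j y) (F j y)].

(* omega^a_b(d_mu), where nabla e_b = omega^a_b e_a in the frame dual to E. *)
Definition spin_coef j y (a b mu : 'I_11) : R :=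
  \sum_(r < 11) E j y a r *
    (partial mu (fun z => invmx (E j z) r b) y
     + \sum_(s < 11) christoffel (g j) r mu s y * invmx (E j y) s b).

Definition spin_nabla j (eps : 'rV[R]_11 -> 'cV[R]_32) y v : 'cV[R]_32 :=
  (\col_(a < 32) 'D_v (fun z => eps z a 0) y)
  + 4^-1 *: (\sum_(a < 11) \sum_(b < 11) \sum_(mu < 11)
      (v 0 mu * eta R a * spin_coef j y a b mu) *: (gam a *m gam b)) *m eps y.

Definition flat_one_form j y v : form R 11 := one_form (v *m g j y).

Definition Omega j y v : 'M[R]_32 :=
  12^-1 *: cliff gam (E j y) (wedge (flat_one_form j y v) (F j y))
  - 6^-1 *: cliff gam (E j y) (contract v (F j y)).

Definition supercov j (eps : 'rV[R]_11 -> 'cV[R]_32) y v : 'cV[R]_32 :=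
  spin_nabla j eps y v - Omega j y v *m eps y.

(* The spinorial Lie derivative along the vector field xi, given on each chart. *)
Definition spin_lie (xi : idx M -> 'rV[R]_11 -> 'rV[R]_11) j
    (eps : 'rV[R]_11 -> 'cV[R]_32) y : 'cV[R]_32 :=
  spin_nabla j eps y (xi j y)
  + 4^-1 *: cliff gam (E j y) (extd (fun z => flat_one_form j z (xi j z)) y)
      *m eps y.

Definition spinor_section (eps : idx M -> 'rV[R]_11 -> 'cV[R]_32) : Prop :=
  (forall j, smooth_mx_on (coords j) (eps j)) /\
  (forall j k m, (dom j `&` dom k) m ->
     eps k (chart k m) = strans sp j k m *m eps j (chart j m)).

Definition killing_spinor (eps : idx M -> 'rV[R]_11 -> 'cV[R]_32) : Prop :=
  spinor_section eps /\
  (forall j y, coords j y -> forall v, supercov j (eps j) y v = 0).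

Definition invariant_killing_spinor xi
    (eps : idx M -> 'rV[R]_11 -> 'cV[R]_32) : Prop :=
  killing_spinor eps /\
  (forall j y, coords j y -> spin_lie xi j (eps j) y = 0).

(* Families are identified when they agree on the images of the charts. *)
Definition invariant_killing_dim xi (d : nat) : Prop :=
  exists b : 'I_d -> idx M -> 'rV[R]_11 -> 'cV[R]_32,
    (forall a, invariant_killing_spinor xi (b a)) /\
    (forall eps, invariant_killing_spinor xi eps ->
       exists! c : 'rV[R]_d, forall j y, coords j y ->
         eps j y = \sum_(a < d) c 0 a *: b a j y).

End Supergravity.

Record iia_fields (R : realType) (X : Type) (I : Type) := IIAFields {
  h_metric : I -> 'rV[R]_10 -> 'M[R]_10;
  dilaton : X -> R;
  H_form : I -> 'rV[R]_10 -> form R 10;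
  A_form : I -> 'rV[R]_10 -> form R 10;
  G_form : I -> 'rV[R]_10 -> form R 10
}.

(* Total space of the principal bundle. The coordinates of its charts are
   (x, theta), with x the coordinates of the chart [under j] of the base and
   theta the last coordinate. [act] is the action of the group, either R or
   R/(tau Z), seen as an action of R. *)
Record kk_space (R : realType) (X : topologicalType) (N : atlas R X 10) := KKSpace {
  tot_type : topologicalType;
  tot : atlas R tot_type 11;
  proj : tot_type -> X;
  under : idx tot -> idx N;
  act : R -> tot_type -> tot_type;
  spin : spin_data R (idx tot) tot_type
}.

Arguments proj {R X N}.
Arguments under {R X N}.
Arguments act {R X N}.

Section IIA.
Variables (R : realType) (gam : 'I_11 -> 'M[R]_32).
Variables (X : topologicalType) (N : atlas R X 10).

Definition iia_background (D : iia_fields R X (idx N)) : Prop :=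
  [/\ manifold N, connected (carrier N), lorentzian_metric (h_metric D) &
      smooth_function N (dilaton D)] /\
  [/\ form_field 3 (H_form D), closed_form (H_form D),
      gauge_potential (A_form D) & form_field 4 (G_form D)].

Definition base_coord (y : 'rV[R]_11) : 'rV[R]_10 := lsubmx (y : 'rV[R]_(10 + 1)).
Definition fibre_coord (y : 'rV[R]_11) : R := y 0 ord_max.

Definition principal_bundle (K : kk_space N) : Prop :=
  let M := tot K in
  [/\ forall m, carrier M m -> carrier N (proj K m),
      forall p, carrier N p -> exists2 m, carrier M m & proj K m = p &
      forall (j : idx M) m, dom j m -> dom (under K j) (proj K m) /\
        base_coord (chart j m) = chart (under K j) (proj K m)] /\
  [/\ forall s m, carrier M m -> carrier M (act K s m),
      forall z : R * tot_type K, carrier M z.2 ->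
        {for z, continuous (fun z : R * tot_type K => act K z.1 z.2)},
      forall m, carrier M m -> act K 0 m = m &
      forall s t m, carrier M m -> act K (s + t) m = act K s (act K t m)] /\
  [/\ forall m m', carrier M m -> carrier M m' ->
        (proj K m = proj K m' <-> exists s, act K s m = m'),
      exists tau : R, forall m s, carrier M m ->
        (act K s m = m <-> exists k : int, s = tau *~ k) &
      forall (j : idx M) m s, dom j m ->
        (forall t, 0 <= t <= 1 -> dom j (act K (t * s) m)) ->
        fibre_coord (chart j (act K s m)) = fibre_coord (chart j m) + s].

Definition pi_mx : 'M[R]_(10, 11) := row_mx (1%:M : 'M[R]_10) (0 : 'M[R]_(10, 1)).

Definition xi_field (J : Type) (j : J) (y : 'rV[R]_11) : 'rV[R]_11 :=
  delta_mx 0 ord_max.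

Section Reduction.
Variables (D : iia_fields R X (idx N)) (K : kk_space N).

(* The connection form d theta + A. *)
Definition kk_omega (j : idx (tot K)) (y : 'rV[R]_11) : form R 11 :=
  one_form (delta_mx 0 ord_max) + pull pi_mx (A_form D (under K j) (base_coord y)).

Definition kk_metric (j : idx (tot K)) (y : 'rV[R]_11) : 'M[R]_11 :=
  let x := base_coord y in
  let w := row_of_form (kk_omega j y) in
  pi_mx^T *m h_metric D (under K j) x *m pi_mx
  + expR (dilaton D (param (under K j) x)) *: (w^T *m w).

Definition kk_flux (j : idx (tot K)) (y : 'rV[R]_11) : form R 11 :=
  let x := base_coord y in
  wedge (kk_omega j y) (pull pi_mx (H_form D (under K j) x))
  + pull pi_mx (G_form D (under K j) x).

Definition iia_solution : Prop :=
  [/\ iia_background D, principal_bundle K &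
      sugra_solution gam kk_metric kk_flux (spin K)].

Definition iia_killing_dim (d : nat) : Prop :=
  invariant_killing_dim gam kk_metric kk_flux (spin K) (@xi_field (idx (tot K))) d.

Definition maximally_supersymmetric_solution : Prop :=
  iia_solution /\ iia_killing_dim 32.

End Reduction.

Definition constant_dilaton (D : iia_fields R X (idx N)) : Prop :=
  exists c : R, forall p, carrier N p -> dilaton D p = c.

Definition vanishing (a : idx N -> 'rV[R]_10 -> form R 10) : Prop :=
  forall i x, coords i x -> a i x = 0.

Definition pure_gauge (a : idx N -> 'rV[R]_10 -> form R 10) : Prop :=
  forall i, pure_gauge_on (coords i) (a i).

End IIA.

(* Main.v *)
(** A Killing spinor solves a linear first order system, so one that vanishes
    at a point vanishes in a neighbourhood. Its zero set is thus open and
    closed in the total space; the fibres are orbits of R, the projection is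
    open and the base is connected, so a nonzero invariant Killing spinor
    vanishes nowhere. When there are 32 independent ones, their values form at
    each point an invertible matrix psi.

    Subtracting [D_xi eps = 0] from [L_xi eps = 0] gives
    [(1/12 c(xi^b /\ F) - 1/6 c(i_xi F) + 1/4 c(d xi^b)) psi = 0]. The three
    forms have degrees 5, 3, 2, where c is injective on their sum; hence
    [i_xi F = 0] and [xi^b /\ F = 0], so [F = 0] as xi is not null, and
    [d xi^b = 0]. With [xi^b = e^Phi (d theta + A)] this says that H and G
    vanish, that Phi is constant and that A is closed. The vector fields with
    components the entries of [psi^-1 gamma_a psi] are then parallel and span
    the tangent space, so g is flat; as A is closed and Phi is constant, the
    Christoffel symbols of h are those of g, and h is flat.

    Conversely, by the Frobenius and Poincare lemmas a flat h has near each
    point an orthonormal coframe of closed forms. Together with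
    [e^(Phi/2) d theta] it trivialises the spin connection on the product with
    R, and the constant spinors are the Killing spinors. *)

From HB Require Import structures.
From mathcomp Require Import all_boot all_order all_algebra.
From mathcomp Require Import all_classical all_reals all_analysis.
From mathcomp Require Import ring lra.
Require Import Defs.

Set Implicit Arguments.
Unset Strict Implicit.
Unset Printing Implicit Defensive.

Import Order.TTheory GRing.Theory Num.Theory.
Import numFieldNormedType.Exports.

Local Open Scope classical_set_scope.
Local Open Scope ring_scope.

(** * Calculus on open subsets of R^n *)

(** The bound 5 on degrees is what makes the Clifford step work: the volume element acts as a sign
    on the rank 32 module, so the monomials of a set of indices and of its complement are
    proportional, and 5 is the largest degree below half of 11. The equation used there is algebraic
    in the spinor, so the curvature of D is never computed; flatness comes from differentiating the
    vector fields made of spinors. The charts raise a second difficulty. The supergravity equations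
    give information only on the base charts [under j], and only below the chart [j] of the total
    space, while the conclusion speaks of all charts of N. Flatness is moved between charts without
    the tensor law of the Riemann tensor: a flat metric has a closed orthonormal coframe, closedness
    survives pull-back, and a closed coframe makes its metric flat. The Frobenius lemma thus serves
    both directions of the theorem. As smoothness is defined by partial derivatives along the axes,
    the basic estimates move one coordinate at a time in a box. The Frobenius lemma is a Picard
    iteration on a ball so small that the iteration contracts by 1/8. *)

Lemma cvg_sumR (R : realType) (I T : Type) (r : seq I) (P : pred I)
    (F : set_system T) (FF : Filter F) (f : I -> T -> R) (l : I -> R) :
  (forall i, P i -> f i x @[x --> F] --> l i) ->
  \sum_(i <- r | P i) f i x @[x --> F] --> \sum_(i <- r | P i) l i.
Proof.
move=> fl; elim: r => [|i r IH].
  by rewrite big_nil; under eq_fun do rewrite big_nil; exact: cvg_cst.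
rewrite big_cons; under eq_fun do rewrite big_cons.
case: ifP => // Pi.
exact: cvgD (fl i Pi) IH.
Qed.

Lemma nbhs_and (T : topologicalType) (x : T) (A B : set T) :
  nbhs x A -> nbhs x B -> nbhs x (A `&` B).
Proof. by move=> xA xB; exact: (@filterI _ _ (nbhs_filter x)). Qed.

#[global] Hint Extern 0 (open (ball _ _)) => exact: ball_open : core.

(** * Mean value estimates on boxes *)

Section Lines.
Variables (R : realType) (n : nat).
Implicit Types (f : 'rV[R]_n -> R) (x y z : 'rV[R]_n) (i : 'I_n).

Lemma ball_rVP x y (r : R) : 0 < r ->
  ball x r y <-> forall i, `|x 0 i - y 0 i| < r.
Proof.
move=> r0; split=> [[_ xy] i|xy]; first exact: xy.
by split=> // i j; rewrite (ord1 i); exact: xy.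
Qed.

Lemma convex_norm_lt (a b r t : R) : 0 <= t -> t <= 1 ->
  `|a| < r -> `|b| < r -> `|t * a + (1 - t) * b| < r.
Proof.
move=> t0 t1 ar br; pose m := Num.max `|a| `|b|.
have mr : m < r by rewrite gt_max ar.
have am : `|a| <= m by rewrite le_max lexx.
have bm : `|b| <= m by rewrite le_max lexx orbT.
apply: le_lt_trans mr; apply: le_trans (ler_normD _ _) _.
rewrite !normrM (ger0_norm t0) (@ger0_norm _ (1 - t)) ?subr_ge0 //.
have s0 : 0 <= 1 - t by rewrite subr_ge0.
apply: (@le_trans _ _ (t * m + (1 - t) * m)); first by rewrite lerD // ler_wpM2l.
by rewrite -mulrDl addrC subrK mul1r.
Qed.

Lemma is_derive_line f x (v : 'rV[R]_n) (s : R) :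
  derivable f (s *: v + x) v ->
  is_derive s 1 (fun t : R => f (t *: v + x)) ('D_v f (s *: v + x)).
Proof.
move=> df.
have E : (fun h : R => h^-1 *: (((fun t : R => f (t *: v + x)) \o shift s)
              (h *: 1) - f (s *: v + x))) =
         (fun h : R => h^-1 *: ((f \o shift (s *: v + x)) (h *: v) -
              f (s *: v + x))).
  by apply/funext => h /=; rewrite addrA -scalerDl [h *: 1]mulr1.
apply: DeriveDef; first by rewrite /derivable E.
by rewrite /derive E.
Qed.

Lemma line_MVT f x i (h : R) :
  (forall t : R, 0 <= t <= 1 ->
     derivable f ((t * h) *: delta_mx 0 i + x) (delta_mx 0 i)) ->
  exists2 t : R, 0 <= t <= 1 &
    f (h *: delta_mx 0 i + x) - f x =
      partial i f ((t * h) *: delta_mx 0 i + x) * h.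
Proof.
move=> df; pose g (t : R) := f ((t * h) *: delta_mx 0 i + x).
have dg (t : R) : 0 <= t <= 1 ->
    is_derive t 1 g (partial i f ((t * h) *: delta_mx 0 i + x) * h).
  move=> t01.
  have D := is_derive_line (df _ t01).
  have D2 : is_derive t (1 : R) (( *%R^~ h) : R -> R) h.
    have := is_deriveM (is_derive_id t (1 : R)) (is_derive_cst h t 1).
    by rewrite scaler0 add0r [_ *: _]mulr1.
  have D3 := @is_derive1_comp R (fun t : R => f (t *: delta_mx 0 i + x)) ( *%R^~ h) t _ _ D D2.
  exact: D3.
have gc : {within `[0, 1], continuous g}.
  apply: derivable_within_continuous => s; rewrite in_itv /= => s01.
  by have [] := dg _ s01.
have dg' (t : R) : t \in `]0, 1[%R -> is_derive t 1 g (partial i f ((t * h) *: delta_mx 0 i + x) * h).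
  by rewrite in_itv /= => /andP[/ltW t0 /ltW t1]; apply: dg; rewrite t0.
have [t] := MVT_segment ler01 dg' gc.
rewrite in_itv /= subr0 mulr1 /g mul1r mul0r scale0r add0r => t01 ->.
by exists t.
Qed.

(** The corners of a staircase from [q'] to [q] that changes one coordinate at a time, so that only
    partial derivatives intervene. *)
Let zig (q q' : 'rV[R]_n) (k : nat) : 'rV[R]_n :=
  \row_l (if (l < k)%N then q 0 l else q' 0 l).

Let zigS q q' (k : 'I_n) :
  zig q q' k.+1 = (q 0 k - q' 0 k) *: delta_mx 0 k + zig q q' k.
Proof.
apply/rowP => l; rewrite !mxE /= ltnS leq_eqVlt.
have [->|lk] := eqVneq l k; first by rewrite eqxx ltnn /= mulr1 subrK.
by rewrite mulr0 add0r; case: eqP => [/val_inj/eqP|//]; rewrite (negPf lk).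
Qed.

(** Telescoping along the staircase, with the one-variable mean value theorem on each step. With
    [c = 0] it is a Lipschitz bound; with [c] the gradient at a point it is the first order Taylor
    estimate. *)
Lemma increment f (p : 'rV[R]_n) (r eps : R) (c : 'I_n -> R) : 0 < r ->
  (forall z, ball p r z -> forall l,
     derivable f z (delta_mx 0 l) /\ `|partial l f z - c l| <= eps) ->
  forall q q', ball p r q -> ball p r q' ->
  `|f q - f q' - \sum_(l < n) c l * (q 0 l - q' 0 l)| <=
    eps * \sum_(l < n) `|q 0 l - q' 0 l|.
Proof.
move=> r0 df q q' pq pq'.
suff step k : (k <= n)%N ->
    `|f (zig q q' k) - f q' - \sum_(l < n | (l < k)%N) c l * (q 0 l - q' 0 l)| <=
    eps * \sum_(l < n | (l < k)%N) `|q 0 l - q' 0 l|.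
  have := step n (leqnn _); rewrite (_ : zig q q' n = q); last first.
    by apply/rowP => l; rewrite !mxE ltn_ord.
  have E (F : 'I_n -> R) : \sum_(l < n | (l < n)%N) F l = \sum_(l < n) F l.
    by apply: eq_bigl => l; rewrite ltn_ord.
  by rewrite !E.
elim: k => [_|k IH kn].
  rewrite !big1 // mulr0 subr0 (_ : zig q q' 0 = q') ?subrr ?normr0 //.
  by apply/rowP => l; rewrite !mxE.
pose K := Ordinal kn.
have split_sum (F : 'I_n -> R) : \sum_(l < n | (l < k.+1)%N) F l =
    F K + \sum_(l < n | (l < k)%N) F l.
  rewrite (bigD1 K) //=; congr (_ + _); apply: eq_bigl => l.
  by rewrite ltnS ltn_neqAle andbC.
rewrite !split_sum -[k.+1]/(K.+1) zigS.
(* A sup-norm ball is a box, and the moving coordinate is a convex combination of those of [q] and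
   [q']. *)
have inball (t : R) : 0 <= t <= 1 ->
    ball p r ((t * (q 0 K - q' 0 K)) *: delta_mx 0 K + zig q q' K).
  move=> /andP[t0 t1]; apply/ball_rVP => // l; rewrite !mxE /=.
  have [->|lk] := eqVneq l K; last first.
    rewrite mulr0 add0r.
    by case: ifP => _; [have /(ball_rVP _ _ r0) := pq|have /(ball_rVP _ _ r0) := pq']; apply.
  rewrite ltnn mulr1.
  have /(ball_rVP _ _ r0)/(_ K) A := pq; have /(ball_rVP _ _ r0)/(_ K) B := pq'.
  have -> : p 0 K - (t * (q 0 K - q' 0 K) + q' 0 K) =
     t * (p 0 K - q 0 K) + (1 - t) * (p 0 K - q' 0 K) by ring.
  exact: convex_norm_lt.
have [t t01|t /inball/df/(_ K)[_ ct] E] := @line_MVT f (zig q q' K) K (q 0 K - q' 0 K).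
  by have [] := df _ (inball _ t01) K.
rewrite /= in E.
rewrite -[f _ - _](subrKA (f (zig q q' K))) E.
set P := partial _ _ _ in ct *; set D := q 0 K - q' 0 K.
have -> : P * D + (f (zig q q' K) - f q') -
  (c K * D + \sum_(l < n | (l < k)%N) c l * (q 0 l - q' 0 l)) =
  (P - c K) * D + (f (zig q q' K) - f q' -
    \sum_(l < n | (l < k)%N) c l * (q 0 l - q' 0 l)) by ring.
rewrite [leRHS]mulrDr; apply: le_trans (ler_normD _ _) _; apply: lerD; last exact/IH/ltnW.
by rewrite normrM ler_wpM2r.
Qed.

Lemma partial0_cst f p (r : R) : 0 < r ->
  (forall z, ball p r z -> forall l,
     derivable f z (delta_mx 0 l) /\ partial l f z = 0) ->
  forall q, ball p r q -> f q = f p.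
Proof.
move=> r0 df q pq.
have := @increment f p r 0 (fun=> 0) r0 _ q p pq (ballxx _ r0).
rewrite mul0r big1 ?subr0; last by move=> l _; rewrite mul0r.
move=> H; apply/eqP; rewrite -subr_eq0 -normr_le0; apply: H => z /df dz l.
by have [? ->] := dz l; rewrite subr0 normr0.
Qed.

(** A bound K on all components gives the bound C k K on the derivatives, hence C k K r n on the
    components, since they vanish at the centre; this is at most K/2. Iterating leaves only zero. *)
Lemma local_uniqueness (k : nat) (u : 'I_k -> 'rV[R]_n -> R) p (r C M : R) :
  0 < r -> 0 <= C -> 0 <= M -> C * k%:R * r * n%:R <= 2^-1 ->
  (forall z, ball p r z -> forall b, `|u b z| <= M /\ forall l,
     derivable (u b) z (delta_mx 0 l) /\
     `|partial l (u b) z| <= C * \sum_(c < k) `|u c z|) ->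
  (forall b, u b p = 0) ->
  forall b q, ball p r q -> u b q = 0.
Proof.
move=> r0 C0 M0 small du up b q pq.
have bnd m : forall z, ball p r z -> forall b, `|u b z| <= M * 2^-1 ^+ m.
  elim: m => [z pz c|m IH z pz c]; first by rewrite mulr1; exact: (du z pz c).1.
  set K := M * 2^-1 ^+ m in IH.
  have K0 : 0 <= K by rewrite mulr_ge0 // exprn_ge0.
  have := @increment (u c) p r (C * (k%:R * K)) (fun=> 0) r0 _ z p pz (ballxx _ r0).
  rewrite big1 => [|l _]; last by rewrite mul0r.
  rewrite up !subr0 => H; apply: (le_trans (H _)) => [y py l|].
    have [_ /(_ l)[dl le]] := du y py c; split=> //; rewrite subr0.
    apply: (le_trans le); apply: ler_wpM2l => //.
    apply: (@le_trans _ _ (\sum_(c < k) K)); first by apply: ler_sum => a _; exact: IH.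
    by rewrite sumr_const card_ord mulr_natl.
  apply: (@le_trans _ _ (C * (k%:R * K) * \sum_(l < n) r)).
    apply: ler_wpM2l; first by rewrite !mulr_ge0.
    apply: ler_sum => l _; rewrite distrC ltW //.
    by have /(ball_rVP _ _ r0) := pz; apply.
  rewrite sumr_const card_ord -mulr_natr exprSr [leRHS]mulrA -/K.
  rewrite [leLHS](_ : _ = K * (C * k%:R * r * n%:R)); last by ring.
  exact: ler_wpM2l.
apply/eqP; rewrite -normr_le0 leNgt; apply/negP => u0.
have cv : (fun m => M * 2^-1 ^+ m) @ \oo --> M * 0.
  apply: cvgMr; apply: cvg_expr; rewrite ger0_norm //; lra.
rewrite mulr0 in cv.
have /cvgrPdist_lt /(_ _ u0) [m _ /(_ m (leqnn _))] := cv.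
rewrite /= sub0r normrN ger0_norm ?mulr_ge0 ?exprn_ge0 // => lt.
by have := le_lt_trans (bnd m q pq b) lt; rewrite ltxx.
Qed.

End Lines.

(** * Differentiability of C^1 functions and the chain rule *)

Section Differentiable.
Variables (R : realType) (n : nat).
Implicit Types (f : 'rV[R]_n -> R) (x y z : 'rV[R]_n) (i : 'I_n).

(** [Ck_on] speaks of partial derivatives only; their continuity makes them nearly constant on a
    small ball, and [increment] turns this into the Frechet estimate. *)
Lemma is_diff_C1 f (U : set 'rV[R]_n) x : open U -> U x -> Ck_on 1 U f ->
  is_diff x f (fun v => \sum_(l < n) v 0 l * partial l f x).
Proof.
move=> oU Ux Cf.
pose d (v : 'rV[R]_n) : R := \sum_(l < n) v 0 l * partial l f x.
have lin_d : linear d.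
  move=> a u v; rewrite /d scaler_sumr -big_split /=; apply: eq_bigr => l _.
  by rewrite !mxE mulrDl -mulrA.
pose dM := GRing.isLinear.Build _ _ _ _ _ lin_d.
pose dL : {linear 'rV[R]_n -> R} := HB.pack d dM.
have dc : continuous dL.
  rewrite /= /d => v; apply: (@cvg_sumR _ _ _ _ _ (nbhs v) _) => l _.
  by apply: cvgM; [exact: coord_continuous|exact: cvg_cst].
have ex : f \o shift x = cst (f x) + dL +o_ (0 : 'rV[R]_n) id.
  apply/eqaddoP => _/posnumP[eps].
  (* Summing over the n coordinates costs a factor n; the divisor n + 1 also covers n = 0. *)
  have [r /= r0 xr] : exists2 r : R, 0 < r & forall z, ball x r z -> U z /\
     forall l, `|partial l f z - partial l f x| <= eps%:num / n.+1%:R.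
    have cl l : \forall z \near x, `|partial l f z - partial l f x| <= eps%:num / n.+1%:R.
      have [_ /(_ x Ux)/cvgrPdist_le cf] := Cf l.
      have /cf : 0 < eps%:num / n.+1%:R by rewrite divr_gt0.
      by apply: filterS => z; rewrite distrC.
    have /nbhs_ballP[r r0 rP] : \forall z \near x, U z /\ forall l, `|partial l f z - partial l f x| <= eps%:num / n.+1%:R.
      near=> z; split; first by near: z; exact: open_nbhs_nbhs.
      by near: z; apply: filter_forall => l; exact: cl.
    by exists r.
  apply/nbhs_ballP; exists r => //= h /(ball_rVP _ _ r0) hr.
  rewrite /=.
  have hx : ball x r (h + x).
    apply/ball_rVP => // i; have := hr i.
    by rewrite !mxE [h 0 i + _]addrC opprD addrA subrr.
  have := @increment _ _ f x r (eps%:num / n.+1%:R) (fun l => partial l f x) r0 _ _ _ hx (ballxx _ r0).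
  have -> : (f \o shift x - (cst (f x) + d)) h = f (h + x) - f x - \sum_(l < n) partial l f x * ((h + x) 0 l - x 0 l).
    rewrite /= !fctE /= opprD addrA; congr (_ - _); rewrite /d; apply: eq_bigr => l _.
    by rewrite !mxE addrK mulrC.
  move=> H; apply: (le_trans (H _)) => [z /xr[Uz zl] l|].
    by split; [exact: (Cf l).1|exact: zl].
  apply: (@le_trans _ _ (eps%:num / n.+1%:R * \sum_(l < n) `|h|)).
    apply: ler_wpM2l => //; apply: ler_sum => l _; rewrite !mxE addrK.
    rewrite [leRHS]/Num.Def.normr/= mx_normrE.
    exact: (le_bigmax _ (fun ij : 'I_1 * 'I_n => `|h ij.1 ij.2|) (0, l)).
  rewrite sumr_const card_ord -[_ *+ n]mulr_natr.
  have -> : eps%:num / n.+1%:R * (`|h| * n%:R) = eps%:num * `|h| * (n%:R / n.+1%:R).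
    by rewrite mulrACA [n.+1%:R^-1 * _]mulrC.
  by apply: ler_piMr => //; rewrite ler_pdivrMr // mul1r ler_nat leqnSn.
apply: DiffDef; last exact: diff_unique ex.
by apply/diff_locallyP; rewrite (diff_unique dc ex).
Unshelve. all: by end_near. Qed.

End Differentiable.

Section ChainRule.
Variables (R : realType) (n p : nat).

Lemma continuous_rowP (T : 'rV[R]_n -> 'rV[R]_p) (x : 'rV[R]_n) :
  (forall a, {for x, continuous (fun z => T z 0 a)}) -> {for x, continuous T}.
Proof.
move=> cT; apply/(@cvgrPdist_lt _ _ _ (nbhs x)) => e e0.
have : \forall z \near x, forall a, `|T x 0 a - T z 0 a| < e.
  apply: (@filter_forall _ _ _ (nbhs x)) => a.
  by have /(@cvgrPdist_lt _ _ _ (nbhs x))/(_ e e0) := cT a.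
apply: filterS => z Tz.
have /(ball_rVP _ _ e0) : forall a, `|T x 0 a - T z 0 a| < e by [].
by rewrite -ball_normE.
Qed.

Lemma derive_line (V W : normedModType R) (f : V -> W) x v :
  'D_v f x = 'D_1 (fun h : R => f (h *: v + x)) 0.
Proof.
rewrite /derive; set F := fun h => _; set G := fun h => _.
suff -> : F = G by [].
by apply/funext => h; rewrite /F /G /= addr0 scale0r add0r [_ *: 1]mulr1.
Qed.

(** Only the outer function is differentiable in the full sense; the inner one is restricted to a
    line, which reduces the claim to a composite with a function of one variable. *)
Lemma is_derive_comp (f : 'rV[R]_p -> R) df (T : 'rV[R]_n -> 'rV[R]_p) x v :
  is_diff (T x) f df -> derivable T x v ->
  is_derive x v (f \o T) (df ('D_v T x)).
Proof.
move=> [dff dfE] /derivable1P/derivable1_diffP dT.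
have T0 : T (0 *: v + x) = T x by rewrite scale0r add0r.
have dff' : differentiable f ((fun h : R => T (h *: v + x)) 0) by rewrite T0.
have d := differentiable_comp dT dff'.
apply: DeriveDef; first by apply/derivable1P/derivable1_diffP.
rewrite [LHS]derive_line -[fun h => _]/(f \o (fun h : R => T (h *: v + x))).
by rewrite deriveE // diff_comp //= T0 dfE [in RHS]derive_line [in RHS]deriveE.
Qed.

Lemma partial_comp (f : 'rV[R]_p -> R) (V : set 'rV[R]_p)
    (T : 'rV[R]_n -> 'rV[R]_p) x i :
  open V -> V (T x) -> Ck_on 1 V f ->
  (forall a, derivable (fun z => T z 0 a) x (delta_mx 0 i)) ->
  derivable (f \o T) x (delta_mx 0 i) /\
  partial i (f \o T) x =
    \sum_(a < p) partial a f (T x) * partial i (fun z => T z 0 a) x.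
Proof.
move=> oV VT Cf dT.
have dT' : derivable T x (delta_mx 0 i).
  by apply/derivable_mxP => a b; rewrite (ord1 a); exact: dT.
have [? dE] := is_derive_comp (is_diff_C1 oV VT Cf) dT'; split=> //.
rewrite {1}/partial dE; apply: eq_bigr => a _.
by rewrite derive_mx // mxE mulrC.
Qed.

End ChainRule.

(** * Symmetry of second partial derivatives *)

Section Schwarz.
Variables (R : realType) (n : nat).

Lemma derivable_shift (f : 'rV[R]_n -> R) c x v :
  derivable (fun z => f (z + c)) x v <-> derivable f (x + c) v.
Proof.
rewrite /derivable; set F := fun h => _; set G := fun h => _.
suff -> : F = G by [].
by apply/funext => h; rewrite /F /G /= addrA.
Qed.

Lemma partial_shift (f : 'rV[R]_n -> R) c x i :
  partial i (fun z => f (z + c)) x = partial i f (x + c).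
Proof.
rewrite /partial /derive; set F := fun h => _; set G := fun h => _.
suff -> : F = G by [].
by apply/funext => h; rewrite /F /G /= addrA.
Qed.

(** The second difference over a square of side r is symmetric in the two directions and equals r^2
    times either mixed derivative at some point nearby; continuity of both at [x] excludes a gap [e]
    between them. *)
Lemma partial_swap (U : set 'rV[R]_n) f x i j : open U -> U x ->
  smooth_on U f -> partial i (partial j f) x = partial j (partial i f) x.
Proof.
move=> oU Ux sf.
pose d2 (i j : 'I_n) := partial i (partial j f).
(* When [k = l] the square degenerates to a segment of length 2r, which the radius 3r contains
   strictly. *)
have mean (k l : 'I_n) (r : R) : 0 < r -> ball x (r *+ 3) `<=` U ->
    exists2 z, ball x (r *+ 3) z & d2 l k z * r * r =
      f (x + r *: delta_mx 0 k + r *: delta_mx 0 l) -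
      f (x + r *: delta_mx 0 k) - f (x + r *: delta_mx 0 l) + f x.
  move=> r0 rU.
  have r3 : 0 < r *+ 3 by rewrite mulrn_wgt0.
  have inball (s t : R) : 0 <= s <= 1 -> 0 <= t <= 1 ->
      ball x (r *+ 3) ((t * r) *: delta_mx 0 l + ((s * r) *: delta_mx 0 k + x)).
    move=> /andP[s0 s1] /andP[t0 t1]; apply/ball_rVP => // a.
    rewrite !mxE /= addrA opprD addrCA subrr addr0 normrN.
    have bd (u : R) (b : bool) : 0 <= u -> u <= 1 -> 0 <= u * r * b%:R <= r.
      move=> u0 u1; have := ltW r0; case: b; rewrite ?mulr0 ?mulr1 ?lexx => r0' //.
      by rewrite mulr_ge0 //= ler_piMl.
    have /andP[A1 A2] := bd t (a == l) t0 t1; have /andP[B1 B2] := bd s (a == k) s0 s1.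
    rewrite ger0_norm ?addr_ge0 // (le_lt_trans (lerD A2 B2)) //.
    by rewrite -mulr2n ltr_pMn2l.
  have i0 : 0 <= (0 : R) <= 1 by rewrite lexx ler01.
  have i1 : 0 <= (1 : R) <= 1 by rewrite lexx ler01.
  have df m z : U z -> derivable f z (delta_mx 0 m) by exact: (sf 1%N m).1.
  have ddf m m' z : U z -> derivable (partial m f) z (delta_mx 0 m') by exact: ((sf 2%N m).2 m').1.
  pose G (z : 'rV[R]_n) := f (z + r *: delta_mx 0 l) - f z.
  have U1 (t : R) : 0 <= t <= 1 -> U ((t * r) *: delta_mx 0 k + x).
    by move=> t01; apply: rU; have := inball _ _ t01 i0; rewrite mul0r scale0r add0r.
  have U2 (t : R) : 0 <= t <= 1 -> U ((t * r) *: delta_mx 0 k + x + r *: delta_mx 0 l).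
    by move=> t01; apply: rU; have := inball _ _ t01 i1; rewrite mul1r addrC.
  have [t t01 /=|t t01 E] := @line_MVT _ _ G x k r.
    by apply: derivableB; [apply/derivable_shift; apply: df; exact: U2|apply: df; exact: U1].
  have [t' t01'|t' t01' E'] := @line_MVT _ _ (partial k f) ((t * r) *: delta_mx 0 k + x) l r.
    by apply: ddf; apply: rU; exact: inball.
  exists ((t' * r) *: delta_mx 0 l + ((t * r) *: delta_mx 0 k + x)); first exact: inball.
  rewrite /d2 -E'.
  have PG : partial k G ((t * r) *: delta_mx 0 k + x) =
     partial k f (r *: delta_mx 0 l + ((t * r) *: delta_mx 0 k + x)) -
     partial k f ((t * r) *: delta_mx 0 k + x).
    rewrite /G [LHS]deriveB; last by apply: df; exact: U1.
      by congr (_ - _); rewrite -[LHS]/(partial k _ _) partial_shift addrC.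
    by apply/derivable_shift; apply: df; exact: U2.
  rewrite -PG -E /G [r *: delta_mx 0 k + x]addrC opprB.
  by rewrite [f x - _]addrC addrA.
have cij (k l : 'I_n) : {for x, continuous (d2 k l)} by exact: (((sf 2%N l).2 k).2).
apply/eqP; rewrite -subr_eq0 -normr_le0 leNgt; apply/negP.
rewrite -/(d2 i j x) -/(d2 j i x); set e := `|_ - _| => e0.
have e20 : 0 < e / 2 by rewrite divr_gt0.
have Nd k l : nbhs x [set z | `|d2 k l x - d2 k l z| < e / 2].
  by have /(@cvgrPdist_lt _ _ _ (nbhs x))/(_ _ e20) := cij k l.
have := nbhs_and (open_nbhs_nbhs (conj oU Ux)) (nbhs_and (Nd i j) (Nd j i)).
move=> /nbhs_ballP[q /= q0 qP]; pose r := q / 3.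
have r0 : 0 < r by rewrite divr_gt0.
have rq : r *+ 3 = q by rewrite -mulr_natr divfK.
have rU : ball x (r *+ 3) `<=` U by rewrite rq => z /qP[].
have [z] := mean i j r r0 rU; rewrite rq => /qP[_ [_ zji]] Ez.
have [z'] := mean j i r r0 rU; rewrite rq => /qP[_ [zij _]] Ez'.
have E : d2 j i z = d2 i j z'.
  apply: (mulIf (lt0r_neq0 r0)); apply: (mulIf (lt0r_neq0 r0)).
  have C : x + r *: delta_mx 0 j + r *: delta_mx 0 i =
           x + r *: delta_mx 0 i + r *: delta_mx 0 j by exact: addrAC.
  rewrite C in Ez'.
  have sw (a b c d : R) : a - b - c + d = a - c - b + d by congr (_ + d); exact: addrAC.
  exact: etrans Ez (etrans (sw _ _ _ _) (esym Ez')).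
have zij' : `|d2 i j x - d2 i j z'| < e / 2 by exact: zij.
have zji' : `|d2 j i z - d2 j i x| < e / 2 by rewrite distrC; exact: zji.
rewrite E in zji'; have := le_lt_trans (ler_distD _ _ _) (ltrD zij' zji').
by rewrite -splitr ltxx.
Qed.

End Schwarz.

(** * Closure properties of C^k and smooth functions *)

Section Smooth.
Variables (R : realType) (n : nat).
Implicit Types (U : set 'rV[R]_n) (f g : 'rV[R]_n -> R) (k : nat).

(** [Ck_on k.+1] does not state continuity of the function itself. Collecting all lower orders gives
    an induction hypothesis strong enough for products, inverses and composites, whose derivatives
    contain the original functions. *)
Definition Cle k U f := forall k', (k' <= k)%N -> Ck_on k' U f.

Lemma CleW k k' U f : (k' <= k)%N -> Cle k U f -> Cle k' U f.
Proof. by move=> kk' Cf l lk'; apply: Cf; apply: leq_trans kk'. Qed.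

Lemma smooth_Cle U f : smooth_on U f <-> forall k, Cle k U f.
Proof. by split=> [sf k l _|Cf k]; [exact: sf|exact: (Cf k)]. Qed.

Lemma Cle0 U f : Cle 0 U f <-> forall x, U x -> {for x, continuous f}.
Proof. by split=> [/(_ 0%N)|cf [|//] _]; [exact|exact: cf]. Qed.

Lemma CleS k U f : Cle k.+1 U f <->
  (forall x, U x -> {for x, continuous f}) /\
  forall i, (forall x, U x -> derivable f x (delta_mx 0 i)) /\
            Cle k U (partial i f).
Proof.
split=> [Cf|[cf df] [_|k' kk']].
- split; first exact: (Cf 0%N).
  by move=> i; split; [exact: (Cf 1%N isT i).1|move=> l lk; exact: (Cf l.+1 lk i).2].
- exact: cf.
- by move=> i; split; [exact: (df i).1|apply: (df i).2].
Qed.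

Lemma near_open U x (P : set 'rV[R]_n) : open U -> U x ->
  (forall z, U z -> P z) -> \forall z \near x, P z.
Proof.
by move=> oU Ux UP; apply: filterS UP _; exact: open_nbhs_nbhs.
Qed.

Lemma partial_eq_on U f g i x : open U -> U x -> (forall z, U z -> f z = g z) ->
  partial i f x = partial i g x.
Proof. by move=> oU Ux fg; apply: near_eq_derive; exact: near_open fg. Qed.

Lemma derivable_eq_on U f g v x : open U -> U x -> (forall z, U z -> f z = g z) ->
  derivable f x v -> derivable g x v.
Proof. by move=> oU Ux fg; apply: near_eq_derivable; exact: near_open fg. Qed.

Lemma continuous_eq_on U f g x : open U -> U x -> (forall z, U z -> f z = g z) ->
  {for x, continuous f} -> {for x, continuous g}.
Proof.
move=> oU Ux fg; rewrite /prop_for /continuous_at -fg // => cf.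
have fgn : \forall z \near x, f z = g z by exact: near_open fg.
by apply: cvg_trans cf; exact: (@near_eq_cvg _ _ (nbhs x) _ _ _ fgn).
Qed.

Lemma Cle_eq k U f g : open U -> (forall z, U z -> f z = g z) ->
  Cle k U f -> Cle k U g.
Proof.
move=> oU; elim: k f g => [|k IH] f g fg.
  by move=> /Cle0 cf; apply/Cle0 => x Ux; exact: continuous_eq_on oU Ux fg (cf x Ux).
move=> /CleS[cf df]; apply/CleS; split=> [x Ux|i].
  exact: continuous_eq_on oU Ux fg (cf x Ux).
split=> [x Ux|]; first exact: derivable_eq_on oU Ux fg ((df i).1 x Ux).
by apply: IH (df i).2 => z Uz; exact: partial_eq_on Uz fg.
Qed.

Lemma Cle_sub k U V f : V `<=` U -> Cle k U f -> Cle k V f.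
Proof.
move=> VU; elim: k f => [|k IH] f.
  by move=> /Cle0 cf; apply/Cle0 => x /VU; exact: cf.
move=> /CleS[cf df]; apply/CleS; split=> [x /VU|i]; first exact: cf.
by split=> [x /VU|]; [exact: (df i).1|exact: IH (df i).2].
Qed.

Lemma partial_cst i (c : R) : partial i (fun _ : 'rV[R]_n => c) = fun=> 0.
Proof. by apply/funext => x; rewrite /partial derive_cst. Qed.

Lemma Cle_cst k U (c : R) : Cle k U (fun=> c).
Proof.
elim: k c => [|k IH] c; first by apply/Cle0 => x _; exact: cst_continuous.
apply/CleS; split=> [x _|i]; first exact: cst_continuous.
by split=> [x _|]; [exact: derivable_cst|rewrite partial_cst].
Qed.

Lemma partialD i f g x : derivable f x (delta_mx 0 i) ->
  derivable g x (delta_mx 0 i) ->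
  partial i (fun z => f z + g z) x = partial i f x + partial i g x.
Proof. by move=> df dg; exact: deriveD. Qed.

Lemma partialM i f g x : derivable f x (delta_mx 0 i) ->
  derivable g x (delta_mx 0 i) ->
  partial i (fun z => f z * g z) x = f x * partial i g x + g x * partial i f x.
Proof. by move=> df dg; have E := deriveM df dg; exact: E. Qed.

Lemma partialV i f x : derivable f x (delta_mx 0 i) -> f x != 0 ->
  partial i (fun z => (f z)^-1) x = (-1) * ((f x)^-1 * (f x)^-1) * partial i f x.
Proof.
move=> df f0; rewrite /partial deriveV //.
by rewrite mulN1r -invfM -expr2.
Qed.

Lemma CleD k U f g : open U -> Cle k U f -> Cle k U g ->
  Cle k U (fun z => f z + g z).
Proof.
move=> oU; elim: k f g => [|k IH] f g.
  move=> /Cle0 cf /Cle0 cg; apply/Cle0 => x Ux.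
  exact: cvgD (cf x Ux) (cg x Ux).
move=> /CleS[cf df] /CleS[cg dg]; apply/CleS; split=> [x Ux|i].
  exact: cvgD (cf x Ux) (cg x Ux).
split=> [x Ux|].
  exact: derivableD ((df i).1 x Ux) ((dg i).1 x Ux).
apply: Cle_eq (IH _ _ (df i).2 (dg i).2) => // z Uz.
by rewrite partialD //; [exact: (df i).1|exact: (dg i).1].
Qed.

Lemma CleM k U f g : open U -> Cle k U f -> Cle k U g ->
  Cle k U (fun z => f z * g z).
Proof.
move=> oU; elim: k f g => [|k IH] f g Cf Cg.
  apply/Cle0 => x Ux; move: Cf Cg => /Cle0 cf /Cle0 cg.
  exact: cvgM (cf x Ux) (cg x Ux).
have Cf' := CleW (leqnSn k) Cf; have Cg' := CleW (leqnSn k) Cg.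
move: Cf Cg => /CleS[cf df] /CleS[cg dg]; apply/CleS; split=> [x Ux|i].
  exact: cvgM (cf x Ux) (cg x Ux).
split=> [x Ux|].
  exact: derivableM ((df i).1 x Ux) ((dg i).1 x Ux).
apply: Cle_eq (CleD oU (IH _ _ Cf' (dg i).2) (IH _ _ Cg' (df i).2)) => // z Uz.
by rewrite partialM //; [exact: (df i).1|exact: (dg i).1].
Qed.

Lemma CleV k U f : open U -> (forall z, U z -> f z != 0) -> Cle k U f ->
  Cle k U (fun z => (f z)^-1).
Proof.
move=> oU f0; elim: k => [|k IH] Cf.
  apply/Cle0 => x Ux; move: Cf => /Cle0 cf.
  exact: (@cvgV _ _ (nbhs x) _ _ _ (f0 x Ux) (cf x Ux)).
have Cf' := CleW (leqnSn k) Cf.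
move: Cf => /CleS[cf df]; apply/CleS; split=> [x Ux|i].
  exact: (@cvgV _ _ (nbhs x) _ _ _ (f0 x Ux) (cf x Ux)).
split=> [x Ux|].
  by apply: derivableV; [exact: f0|exact: (df i).1].
apply: Cle_eq (CleM oU (CleM oU (@Cle_cst k U (-1))
  (CleM oU (IH Cf') (IH Cf'))) (df i).2) => // z Uz.
by rewrite partialV //; [exact: (df i).1|exact: f0].
Qed.

Lemma Cle_sum k U (I : Type) (r : seq I) (P : pred I) (F : I -> 'rV[R]_n -> R) :
  open U -> (forall i, P i -> Cle k U (F i)) ->
  Cle k U (fun z => \sum_(i <- r | P i) F i z).
Proof.
move=> oU CF; elim: r => [|i r IH].
  by apply: Cle_eq (@Cle_cst k U 0) => // z _; rewrite big_nil.
case: (boolP (P i)) => Pi; last first.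
  by apply: Cle_eq IH => // z _; rewrite big_cons (negPf Pi).
by apply: Cle_eq (CleD oU (CF i Pi) IH) => // z _; rewrite big_cons Pi.
Qed.

Lemma Cle_prod k U (I : Type) (r : seq I) (P : pred I) (F : I -> 'rV[R]_n -> R) :
  open U -> (forall i, P i -> Cle k U (F i)) ->
  Cle k U (fun z => \prod_(i <- r | P i) F i z).
Proof.
move=> oU CF; elim: r => [|i r IH].
  by apply: Cle_eq (@Cle_cst k U 1) => // z _; rewrite big_nil.
case: (boolP (P i)) => Pi; last first.
  by apply: Cle_eq IH => // z _; rewrite big_cons (negPf Pi).
by apply: Cle_eq (CleM oU (CF i Pi) IH) => // z _; rewrite big_cons Pi.
Qed.

End Smooth.

Lemma Cle_comp (R : realType) (n p k : nat) (U : set 'rV[R]_n)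
    (V : set 'rV[R]_p) (f : 'rV[R]_p -> R) (T : 'rV[R]_n -> 'rV[R]_p) :
  open U -> open V -> (forall x, U x -> V (T x)) -> Cle k V f ->
  (forall a, Cle k U (fun z => T z 0 a)) -> Cle k U (f \o T).
Proof.
move=> oU oV UV; elim: k f => [|k IH] f Cf CT.
  apply/Cle0 => x Ux; apply: continuous_comp.
    by apply: continuous_rowP => a; move: (CT a) => /Cle0; apply.
  by move/Cle0 : Cf; apply; exact: UV.
have CT' a := CleW (leqnSn k) (CT a).
have cT x : U x -> {for x, continuous T}.
  by move=> Ux; apply: continuous_rowP => a; move: (CT a) => /CleS[+ _]; apply.
have Cf1 : Ck_on 1 V f by exact: Cf.
have dT i a : (forall x, U x -> derivable (fun z => T z 0 a) x (delta_mx 0 i)) /\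
    Cle k U (partial i (fun z => T z 0 a)).
  by move: (CT a) => /CleS[_ ].
move/CleS : Cf => [cf df]; apply/CleS; split=> [x Ux|i].
  by apply: continuous_comp; [exact: cT|apply: cf; exact: UV].
have pc x (Ux : U x) := partial_comp oV (UV _ Ux) Cf1 (fun a => (dT i a).1 x Ux).
split=> [x Ux|]; first exact: (pc x Ux).1.
apply: (@Cle_eq _ _ _ _ (fun x => \sum_(a < p) (partial a f \o T) x * partial i (fun z => T z 0 a) x)) => //.
  by move=> x Ux; rewrite (pc x Ux).2.
apply: Cle_sum => // a _; apply: CleM => //; last exact: (dT i a).2.
by apply: IH => //; exact: (df a).2.
Qed.

Section Ck1.
Variables (R : realType) (n : nat).
Implicit Types (U : set 'rV[R]_n) (f g : 'rV[R]_n -> R).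

Lemma Ck_on_eq k U f g : open U -> (forall z, U z -> f z = g z) ->
  Ck_on k U f -> Ck_on k U g.
Proof.
move=> oU; elim: k f g => [|k IH] f g fg cf.
  by move=> x Ux; exact: continuous_eq_on oU Ux fg (cf x Ux).
move=> i; split=> [x Ux|].
  exact: derivable_eq_on oU Ux fg ((cf i).1 x Ux).
by apply: IH (cf i).2 => z Uz; exact: partial_eq_on Uz fg.
Qed.

(** Locally bounded partial derivatives give a local Lipschitz bound. It yields continuity of
    integrals with a parameter, whose derivatives are bounded before they are known to be
    continuous. *)
Lemma Ck1_continuous U f x : open U -> U x ->
  (forall j, (forall z, U z -> derivable f z (delta_mx 0 j)) /\
     exists M : R, \forall z \near x, `|partial j f z| <= M) ->
  {for x, continuous f}.
Proof.
move=> oU Ux df.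
have dM j : {M : R | 0 <= M & nbhs x [set z | `|partial j f z| <= M]}.
  have /cid[M HM] := (df j).2; exists `|M| => //.
  by apply: filterS HM => z /= /le_trans; apply; exact: ler_norm.
pose M := \sum_(j < n) s2val (dM j).
have M0 : 0 <= M by apply: sumr_ge0 => j _; exact: s2valP (dM j).
have : nbhs x [set z | forall j, `|partial j f z| <= M].
  apply: (@filter_forall _ _ _ _ (nbhs_filter x)) => j.
  apply: filterS (s2valP' (dM j)) => z /= /le_trans; apply.
  rewrite /M (bigD1 j) //= lerDl; apply: sumr_ge0 => k _; exact: s2valP (dM k).
move=> /(nbhs_and (open_nbhs_nbhs (conj oU Ux))) /nbhs_ballP[r /= r0 rP].
apply/(@cvgrPdist_lt _ _ _ (nbhs x)) => e e0.
(* The summand 1 keeps the denominator positive when the bound or the dimension is zero. *)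
pose d := Num.min r (e / (M * n%:R + 1)).
have den0 : 0 < M * n%:R + 1 by rewrite ltr_wpDl // mulr_ge0.
have d0 : 0 < d by rewrite lt_min r0 divr_gt0.
apply/nbhs_ballP; exists d => //= z zd.
have zr : ball x r z by apply: le_ball zd; rewrite ge_min lexx.
have := @increment _ _ f x r M (fun=> 0) r0 _ x z (ballxx _ r0) zr.
rewrite big1 ?subr0 => [H|l _]; last by rewrite mul0r.
apply: (le_lt_trans (H _)) => [y /rP[/= Uy yM] l|].
  by rewrite subr0; split; [exact: (df l).1|exact: yM].
apply: (@le_lt_trans _ _ (M * \sum_(l < n) d)).
  apply: ler_wpM2l => //; apply: ler_sum => l _; rewrite ltW //.
  by have /(ball_rVP _ _ d0) := zd; apply.
rewrite sumr_const card_ord -[_ *+ n]mulr_natr mulrCA.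
apply: (@le_lt_trans _ _ (e / (M * n%:R + 1) * (M * n%:R))).
  by apply: ler_wpM2r; [rewrite mulr_ge0|rewrite ge_min lexx orbT].
by rewrite mulrAC ltr_pdivrMr // ltr_pM2l // ltrDl.
Qed.

End Ck1.

Section SmoothClosure.
Variables (R : realType) (n : nat).
Implicit Types (U : set 'rV[R]_n) (f g : 'rV[R]_n -> R).

Lemma smooth_eq U f g : open U -> (forall z, U z -> f z = g z) ->
  smooth_on U f -> smooth_on U g.
Proof. by move=> oU fg /smooth_Cle sf; apply/smooth_Cle => k; exact: Cle_eq oU fg (sf k). Qed.

Lemma smooth_sub U V f : V `<=` U -> smooth_on U f -> smooth_on V f.
Proof. by move=> VU /smooth_Cle sf; apply/smooth_Cle => k; exact: Cle_sub VU (sf k). Qed.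

Lemma smooth_cst U (c : R) : smooth_on U (fun=> c).
Proof. by apply/smooth_Cle => k; exact: Cle_cst. Qed.

Lemma smooth_cont U f x : smooth_on U f -> U x -> {for x, continuous f}.
Proof. by move=> /(_ 0%N); apply. Qed.

Lemma smooth_derivable U f x i : smooth_on U f -> U x ->
  derivable f x (delta_mx 0 i).
Proof. by move=> /(_ 1%N) /(_ i) [+ _] Ux; apply. Qed.

Lemma smooth_partial U f i : smooth_on U f -> smooth_on U (partial i f).
Proof. by move=> sf k; exact: (sf k.+1 i).2. Qed.

Lemma smoothD U f g : open U -> smooth_on U f -> smooth_on U g ->
  smooth_on U (fun z => f z + g z).
Proof.
by move=> oU /smooth_Cle sf /smooth_Cle sg; apply/smooth_Cle => k; exact: CleD.
Qed.

Lemma smoothM U f g : open U -> smooth_on U f -> smooth_on U g ->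
  smooth_on U (fun z => f z * g z).
Proof.
by move=> oU /smooth_Cle sf /smooth_Cle sg; apply/smooth_Cle => k; exact: CleM.
Qed.

Lemma smoothN U f : open U -> smooth_on U f -> smooth_on U (fun z => - f z).
Proof.
move=> oU sf; apply: smooth_eq (smoothM oU (@smooth_cst U (-1)) sf) => // z _.
by rewrite mulN1r.
Qed.

Lemma smoothB U f g : open U -> smooth_on U f -> smooth_on U g ->
  smooth_on U (fun z => f z - g z).
Proof. by move=> oU sf sg; apply: smoothD => //; exact: smoothN. Qed.

Lemma smoothV U f : open U -> (forall z, U z -> f z != 0) -> smooth_on U f ->
  smooth_on U (fun z => (f z)^-1).
Proof.
by move=> oU f0 /smooth_Cle sf; apply/smooth_Cle => k; exact: CleV.
Qed.

Lemma smooth_sum U (I : Type) (r : seq I) (P : pred I) (F : I -> 'rV[R]_n -> R) :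
  open U -> (forall i, P i -> smooth_on U (F i)) ->
  smooth_on U (fun z => \sum_(i <- r | P i) F i z).
Proof.
move=> oU sF; apply/smooth_Cle => k; apply: Cle_sum => // i /sF /smooth_Cle; exact.
Qed.

Lemma smooth_prod U (I : Type) (r : seq I) (P : pred I) (F : I -> 'rV[R]_n -> R) :
  open U -> (forall i, P i -> smooth_on U (F i)) ->
  smooth_on U (fun z => \prod_(i <- r | P i) F i z).
Proof.
move=> oU sF; apply/smooth_Cle => k; apply: Cle_prod => // i /sF /smooth_Cle; exact.
Qed.

Lemma smooth_comp p U (V : set 'rV[R]_p) (f : 'rV[R]_p -> R)
    (T : 'rV[R]_n -> 'rV[R]_p) :
  open U -> open V -> (forall x, U x -> V (T x)) -> smooth_on V f ->
  (forall a, smooth_on U (fun z => T z 0 a)) -> smooth_on U (fun z => f (T z)).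
Proof.
move=> oU oV UV /smooth_Cle sf sT; apply/smooth_Cle => k.
by apply: (@Cle_comp _ _ _ _ U V f T) => // a; move/smooth_Cle : (sT a); exact.
Qed.

Lemma partial_coord j m x :
  derivable (fun z : 'rV[R]_n => z 0 m) x (delta_mx 0 j) /\
  partial j (fun z : 'rV[R]_n => z 0 m) x = (m == j)%:R.
Proof.
have D : is_derive (0 : R) (1 : R) (fun h : R => h * (m == j)%:R + x 0 m) (m == j)%:R.
  have D1 := is_deriveM (is_derive_id (0 : R) (1 : R)) (is_derive_cst ((m == j)%:R : R) (0 : R) (1 : R)).
  have := is_deriveD D1 (is_derive_cst (x 0 m) (0 : R) (1 : R)).
  by rewrite scale0r add0r addr0 [_ *: _]mulr1.
have E : (fun h : R => (h *: delta_mx 0 j + x) 0 m) = (fun h : R => h * (m == j)%:R + x 0 m).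
  by apply/funext => h; rewrite !mxE /=.
split; first by apply/derivable1P; rewrite E; case: D.
by rewrite /partial derive_line E; case: D.
Qed.

Lemma smooth_proj U m : open U -> smooth_on U (fun z => z 0 m).
Proof.
move=> oU [|k] /=; first by move=> x _; exact: coord_continuous.
move=> j; split=> [x _|]; first exact: (partial_coord j m x).1.
apply: (@Ck_on_eq _ _ _ _ (fun=> (m == j)%:R)) => //; last exact: smooth_cst.
by move=> z _; rewrite (partial_coord j m z).2.
Qed.

Lemma partialN i f x : derivable f x (delta_mx 0 i) ->
  partial i (fun z => - f z) x = - partial i f x.
Proof. by move=> df; exact: deriveN. Qed.

Lemma partial_sum i (I : Type) (r : seq I) (P : pred I) (F : I -> 'rV[R]_n -> R) x :
  (forall k, P k -> derivable (F k) x (delta_mx 0 i)) ->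
  derivable (fun z => \sum_(k <- r | P k) F k z) x (delta_mx 0 i) /\
  partial i (fun z => \sum_(k <- r | P k) F k z) x =
    \sum_(k <- r | P k) partial i (F k) x.
Proof.
move=> dF; elim: r => [|k r [dr pr]].
  have -> : (fun z => \sum_(k <- [::] | P k) F k z) = fun=> 0.
    by apply/funext => z; rewrite big_nil.
  by rewrite big_nil partial_cst; split=> //; exact: derivable_cst.
case: (boolP (P k)) => Pk; last first.
  have -> : (fun z => \sum_(k <- k :: r | P k) F k z) =
            (fun z => \sum_(k <- r | P k) F k z).
    by apply/funext => z; rewrite big_cons (negPf Pk).
  by rewrite big_cons (negPf Pk).
have -> : (fun z => \sum_(k <- k :: r | P k) F k z) =
          (fun z => F k z + \sum_(k <- r | P k) F k z).
  by apply/funext => z; rewrite big_cons Pk.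
rewrite big_cons Pk; split; first exact: derivableD (dF k Pk) dr.
by apply: etrans (partialD (dF k Pk) dr) _; rewrite pr.
Qed.

End SmoothClosure.

(** * Matrix-valued functions and their partial derivatives *)

Section SmoothMatrix.
Variables (R : realType) (n : nat).
Implicit Types (U : set 'rV[R]_n).

Definition pmx_def p q (i : 'I_n) (A : 'rV[R]_n -> 'M[R]_(p, q)) x : 'M[R]_(p, q) :=
  \matrix_(a, b) partial i (fun z => A z a b) x.

(* Locking keeps conversion from unfolding directional derivatives. *)
Definition pmx := locked pmx_def.

Lemma pmxE p q (i : 'I_n) (A : 'rV[R]_n -> 'M[R]_(p, q)) x a b :
  pmx i A x a b = partial i (fun z => A z a b) x.
Proof. by rewrite /pmx -lock mxE. Qed.

Lemma pmx_eq_on p q U (A B : 'rV[R]_n -> 'M[R]_(p, q)) i x : open U -> U x ->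
  (forall z, U z -> A z = B z) -> pmx i A x = pmx i B x.
Proof.
move=> oU Ux AB; apply/matrixP => a b; rewrite !pmxE.
by apply: partial_eq_on Ux _ => // z Uz; rewrite AB.
Qed.

Lemma pmx_cst p q (C : 'M[R]_(p, q)) i x : pmx i (fun=> C) x = 0.
Proof. by apply/matrixP => a b; rewrite pmxE partial_cst mxE. Qed.

Lemma pmxM p q r U (A : 'rV[R]_n -> 'M[R]_(p, q)) (B : 'rV[R]_n -> 'M[R]_(q, r)) i x :
  U x -> smooth_mx_on U A -> smooth_mx_on U B ->
  pmx i (fun z => A z *m B z) x = pmx i A x *m B x + A x *m pmx i B x.
Proof.
move=> Ux sA sB; apply/matrixP => a b; rewrite pmxE mxE [X in X + _]mxE [X in _ + X]mxE.
have E : (fun z => (A z *m B z) a b) = (fun z => \sum_k A z a k * B z k b).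
  by apply/funext => z; rewrite mxE.
have dA k : derivable (fun z => A z a k) x (delta_mx 0 i).
  exact: smooth_derivable (sA a k) Ux.
have dB k : derivable (fun z => B z k b) x (delta_mx 0 i).
  exact: smooth_derivable (sB k b) Ux.
rewrite E (partial_sum (F := fun k z => A z a k * B z k b) _ _).2; last first.
  by move=> k _; exact: derivableM (dA k) (dB k).
rewrite -big_split; apply: eq_bigr => k _.
by rewrite partialM // addrC !pmxE; congr (_ + _); rewrite mulrC.
Qed.

Lemma smooth_mxM p q r U (A : 'rV[R]_n -> 'M[R]_(p, q)) (B : 'rV[R]_n -> 'M[R]_(q, r)) :
  open U -> smooth_mx_on U A -> smooth_mx_on U B ->
  smooth_mx_on U (fun z => A z *m B z).
Proof.
move=> oU sA sB a b.
apply: (@smooth_eq _ _ U (fun z => \sum_k A z a k * B z k b)) => //.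
  by move=> z _; rewrite mxE.
by apply: smooth_sum => // k _; apply: smoothM; [|exact: sA|exact: sB].
Qed.

Lemma smooth_mx_eq p q U (A B : 'rV[R]_n -> 'M[R]_(p, q)) : open U ->
  (forall z, U z -> A z = B z) -> smooth_mx_on U A -> smooth_mx_on U B.
Proof. by move=> oU AB sA a b; apply: smooth_eq (sA a b) => // z Uz; rewrite AB. Qed.

Lemma smooth_mx_sub p q U V (A : 'rV[R]_n -> 'M[R]_(p, q)) : V `<=` U ->
  smooth_mx_on U A -> smooth_mx_on V A.
Proof. by move=> VU sA a b; exact: smooth_sub VU (sA a b). Qed.

Lemma smooth_mx_cst p q U (C : 'M[R]_(p, q)) : smooth_mx_on U (fun=> C).
Proof. by move=> a b; exact: smooth_cst. Qed.

Lemma smooth_tr p q U (A : 'rV[R]_n -> 'M[R]_(p, q)) : open U ->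
  smooth_mx_on U A -> smooth_mx_on U (fun z => (A z)^T).
Proof. by move=> oU sA a b; apply: smooth_eq (sA b a) => // z _; rewrite mxE. Qed.

Lemma pmx_tr p q i (A : 'rV[R]_n -> 'M[R]_(p, q)) x :
  pmx i (fun z => (A z)^T) x = (pmx i A x)^T.
Proof.
apply/matrixP => a b; rewrite [RHS]mxE !pmxE; congr (partial _ _ _).
by apply/funext => z; rewrite mxE.
Qed.

Lemma smooth_det p U (A : 'rV[R]_n -> 'M[R]_p) : open U ->
  smooth_mx_on U A -> smooth_on U (fun z => \det (A z)).
Proof.
move=> oU sA; apply: smooth_sum => // s _.
apply: smoothM => //; first exact: smooth_cst.
by apply: smooth_prod => // a _; exact: sA.
Qed.

(** By Cramer's rule the entries of the inverse are cofactors divided by the determinant. *)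
Lemma smooth_invmx p U (A : 'rV[R]_n -> 'M[R]_p) : open U ->
  (forall z, U z -> A z \in unitmx) -> smooth_mx_on U A ->
  smooth_mx_on U (fun z => invmx (A z)).
Proof.
move=> oU uA sA a b.
apply: (@smooth_eq _ _ U (fun z => (\det (A z))^-1 *
   ((-1) ^+ (b + a) * \det (row' b (col' a (A z)))))) => //.
  by move=> z Uz; rewrite /invmx uA // !mxE.
apply: smoothM => //.
  apply: smoothV => //; last exact: smooth_det.
  by move=> z /uA; rewrite unitmxE unitfE.
apply: smoothM => //; first exact: smooth_cst.
apply: smooth_det => // c d.
by apply: smooth_eq (sA (lift b c) (lift a d)) => // z _; rewrite !mxE.
Qed.

Lemma pmx_invmx p U (A : 'rV[R]_n -> 'M[R]_p) i x : open U -> U x ->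
  (forall z, U z -> A z \in unitmx) -> smooth_mx_on U A ->
  pmx i (fun z => invmx (A z)) x = - (invmx (A x) *m pmx i A x *m invmx (A x)).
Proof.
move=> oU Ux uA sA; have sV := smooth_invmx oU uA sA.
have : pmx i (fun z => A z *m invmx (A z)) x = 0.
  rewrite (@pmx_eq_on _ _ U _ (fun=> 1%:M)) ?pmx_cst // => z Uz.
  by rewrite mulmxV // uA.
rewrite (pmxM _ Ux sA sV) => /eqP; rewrite addrC addr_eq0 => /eqP E.
have := congr1 (mulmx (invmx (A x))) E.
by rewrite mulmxA mulVmx ?uA // mul1mx mulmxN mulmxA.
Qed.

End SmoothMatrix.

Lemma pmx0_cst (R : realType) (n p q : nat) (A : 'rV[R]_n -> 'M[R]_(p, q)) x (r : R) :
  0 < r -> smooth_mx_on (ball x r) A ->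
  (forall z i, ball x r z -> pmx i A z = 0) -> forall z, ball x r z -> A z = A x.
Proof.
move=> r0 sA A0 z xz; apply/matrixP => a b.
apply: (@partial0_cst _ _ (fun z => A z a b) x r) => // y xy l; split.
  exact: smooth_derivable (sA a b) xy.
by have /matrixP/(_ a b) := A0 y l xy; rewrite pmxE mxE.
Qed.

(** * Integration along rays, the Frobenius and Poincare lemmas *)

Section UnitInterval.
Variable R : realType.
Local Notation mu := (@lebesgue_measure R).
Implicit Types f g : R -> R.

Definition cont01 f := forall t : R, 0 <= t <= 1 -> {for t, continuous f}.
Definition int01 f : R := \int[mu]_(t in `[0, 1]) f t.

Lemma cont01_within f : cont01 f -> {within `[0, 1], continuous f}.
Proof.
by move=> cf; apply: continuous_in_subspaceT => t; rewrite inE /= in_itv /=; exact: cf.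
Qed.

Lemma cont01_integrable f : cont01 f -> mu.-integrable `[0, 1] (EFin \o f).
Proof.
move=> cf; apply: continuous_compact_integrable; first exact: segment_compact.
exact: cont01_within.
Qed.

Lemma int01_eq f g : (forall t, 0 <= t <= 1 -> f t = g t) -> int01 f = int01 g.
Proof.
by move=> fg; apply: eq_Rintegral => t; rewrite inE /= in_itv /=; exact: fg.
Qed.

Lemma int01D f g : cont01 f -> cont01 g ->
  int01 (fun t => f t + g t) = int01 f + int01 g.
Proof.
by move=> cf cg; apply: RintegralD => //; exact: cont01_integrable.
Qed.

Lemma int01B f g : cont01 f -> cont01 g ->
  int01 (fun t => f t - g t) = int01 f - int01 g.
Proof.
by move=> cf cg; apply: RintegralB => //; exact: cont01_integrable.
Qed.

Lemma int01Z f (c : R) : cont01 f -> int01 (fun t => c * f t) = c * int01 f.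
Proof.
by move=> cf; apply: RintegralZl => //; exact: cont01_integrable.
Qed.

Lemma int01_cst (c : R) : int01 (fun=> c) = c.
Proof.
have E : mu `[0, 1]%classic = 1%E.
  by rewrite lebesgue_measure_itv /= lte_fin ltr01 sube0.
by rewrite /int01 Rintegral_cst //= E mulr1.
Qed.

Lemma cont01_cst (c : R) : cont01 (fun=> c).
Proof. by move=> t _; exact: cst_continuous. Qed.

Lemma cont01_sum (I : Type) (r : seq I) (P : pred I) (F : I -> R -> R) :
  (forall i, P i -> cont01 (F i)) -> cont01 (fun t => \sum_(i <- r | P i) F i t).
Proof. by move=> cF t t01; apply: cvg_sumR => i Pi; exact: cF. Qed.

Lemma int01_sum (I : Type) (r : seq I) (P : pred I) (F : I -> R -> R) :
  (forall i, P i -> cont01 (F i)) ->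
  int01 (fun t => \sum_(i <- r | P i) F i t) = \sum_(i <- r | P i) int01 (F i).
Proof.
move=> cF; elim: r => [|i r IH].
  by rewrite big_nil -[RHS](int01_cst 0); apply: int01_eq => t _; rewrite big_nil.
rewrite big_cons; case: (boolP (P i)) => Pi; last first.
  by rewrite -IH; apply: int01_eq => t _; rewrite big_cons (negPf Pi).
rewrite -IH -int01D; [|exact: cF|exact: cont01_sum].
by apply: int01_eq => t _; rewrite big_cons Pi.
Qed.

Lemma int01_le f (M : R) : cont01 f -> (forall t, 0 <= t <= 1 -> `|f t| <= M) ->
  `|int01 f| <= M.
Proof.
move=> cf fM; apply: (le_trans (le_normr_Rintegral _ (cont01_integrable cf))) => //.
rewrite -[leRHS](int01_cst M); apply: le_Rintegral => //.
- apply: (@cont01_integrable (fun t => `|f t|)) => t t01.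
  exact: cvg_norm (cf t t01).
- by apply: cont01_integrable; exact: cont01_cst.
Qed.

Lemma int01_FTC (f F : R -> R) : cont01 f ->
  (forall t : R, 0 <= t <= 1 -> is_derive t 1 F (f t)) -> int01 f = F 1 - F 0.
Proof.
move=> cf dF; rewrite /int01 /Rintegral.
have cF (t : R) : 0 <= t <= 1 -> {for t, continuous F}.
  by move=> /dF[+ _] => /derivable1_diffP; exact: differentiable_continuous.
rewrite (@continuous_FTC2 _ f F 0 1) //.
- exact: cont01_within.
- split.
  + by move=> t; rewrite in_itv /= => /andP[/ltW t0 /ltW t1]; have [|] := dF t _; rewrite ?t0.
  + by apply: cvg_at_right_filter; apply: cF; rewrite lexx ler01.
  + by apply: cvg_at_left_filter; apply: cF; rewrite lexx ler01.
- move=> t; rewrite in_itv /= => /andP[/ltW t0 /ltW t1]; rewrite derive1E.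
  by have [|_ ->] := dF t _; rewrite ?t0.
Qed.

End UnitInterval.

(** * Weighted integrals along rays *)

Section Radial.
Variables (R : realType) (n : nat) (a : 'rV[R]_n).
Implicit Types (f g : 'rV[R]_n -> R) (x : 'rV[R]_n) (r : R) (k : nat).

Definition seg x (t : R) : 'rV[R]_n := t *: (x - a) + a.

(** The weight [t ^+ k] closes the family under differentiation: moving the end point [x] moves the
    point at parameter t by a factor t, so each derivative raises k by one. *)
Definition radial k f x : R := int01 (fun t => t ^+ k * f (seg x t)).

Lemma seg_ball x r t : 0 < r -> ball a r x -> 0 <= t <= 1 -> ball a r (seg x t).
Proof.
move=> r0 /(ball_rVP _ _ r0) xr /andP[t0 t1]; apply/ball_rVP => // i.
rewrite /seg !mxE.
have -> : a 0 i - (t * (x 0 i - a 0 i) + a 0 i) = t * (a 0 i - x 0 i) + (1 - t) * 0.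
  by ring.
by apply: (convex_norm_lt t0 t1 (xr i)); rewrite normr0.
Qed.

Lemma continuous_seg x : continuous (seg x).
Proof.
move=> t; apply: cvgD; last exact: cvg_cst.
by apply: cvgZ; [exact: cvg_id|exact: cvg_cst].
Qed.

Lemma continuous_along f x r : 0 < r -> (forall z, ball a r z -> {for z, continuous f}) ->
  ball a r x -> cont01 (fun t => f (seg x t)).
Proof.
move=> r0 cf xr t t01; apply: continuous_comp; first exact: continuous_seg.
by apply: cf; exact: seg_ball.
Qed.

Lemma cont01X k : cont01 (fun t : R => t ^+ k).
Proof. by move=> t _; exact: exprn_continuous. Qed.

Lemma cont01M (f g : R -> R) : cont01 f -> cont01 g -> cont01 (fun t => f t * g t).
Proof. by move=> cf cg t t01; apply: cvgM; [exact: cf|exact: cg]. Qed.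

Lemma cont01_radial k f x r : 0 < r ->
  (forall z, ball a r z -> {for z, continuous f}) -> ball a r x ->
  cont01 (fun t => t ^+ k * f (seg x t)).
Proof.
move=> r0 cf xr; apply: cont01M; first exact: cont01X.
exact: continuous_along cf xr.
Qed.

Lemma radial_eq k f g x r : 0 < r -> ball a r x ->
  (forall z, ball a r z -> f z = g z) -> radial k f x = radial k g x.
Proof.
by move=> r0 xr fg; apply: int01_eq => t t01; rewrite fg //; exact: seg_ball.
Qed.

Lemma radial_le k f x r M : 0 < r ->
  (forall z, ball a r z -> {for z, continuous f}) -> ball a r x ->
  (forall z, ball a r z -> `|f z| <= M) -> `|radial k f x| <= M.
Proof.
move=> r0 cf xr fM; apply: int01_le; first exact: cont01_radial cf xr.
move=> t /[dup] t01 /andP[t0 t1]; rewrite normrM.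
apply: (@le_trans _ _ (1 * `|f (seg x t)|)).
  by apply: ler_wpM2r => //; rewrite ger0_norm ?exprn_ge0 // exprn_ile1.
by rewrite mul1r; apply: fM; exact: seg_ball.
Qed.

Lemma radialB k f g x r : 0 < r -> ball a r x ->
  (forall z, ball a r z -> {for z, continuous f}) ->
  (forall z, ball a r z -> {for z, continuous g}) ->
  radial k (fun z => f z - g z) x = radial k f x - radial k g x.
Proof.
move=> r0 xr cf cg; rewrite /radial -int01B.
- by apply: int01_eq => t _; rewrite mulrBr.
- exact: cont01_radial cf xr.
- exact: cont01_radial cg xr.
Qed.

Lemma inner_ball x r : 0 < r -> ball a r x ->
  exists2 r' : R, 0 < r' /\ r' < r & ball a r' x.
Proof.
move=> r0; rewrite -ball_normE /= => axr.
exists ((`|a - x| + r) / 2).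
  split; first by rewrite divr_gt0 // ltr_wpDl.
  by rewrite ltr_pdivrMr // mulr2n mulrDr mulr1 ltrD2r.
by rewrite /= ltr_pdivlMr // mulr2n mulrDr mulr1 ltrD2l.
Qed.

Lemma compact_bound f r' r : 0 < r' -> r' < r ->
  (forall z, ball a r z -> {for z, continuous f}) ->
  exists2 M : R, 0 <= M & forall z, ball a r' z -> `|f z| <= M.
Proof.
move=> r0 rr cf.
have sub z : closed_ball a r' z -> ball a r z by exact: closed_ball_subset.
have K : compact (closed_ball a r').
  apply: bounded_closed_compact; last exact: closed_ball_closed.
  exists (`|a| + r'); split; first by rewrite num_real.
  move=> M aM z /=; rewrite closed_ballE // => zr.
  have zr' : `|a - z| <= r' by exact: zr.
  apply: le_trans (ltW aM).
  by rewrite -[z](subKr a) (le_trans (ler_normB _ _)) // lerD2l.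
have cw : {within closed_ball a r', continuous f}.
  by apply: continuous_in_subspaceT => z; rewrite inE => /sub; exact: cf.
have /compact_bounded[M [_ HM]] := continuous_compact cw K.
exists (`|M| + 1) => [|z zr]; first by rewrite addr_ge0.
apply: (HM (`|M| + 1)); first by rewrite (le_lt_trans (ler_norm M)) // ltrDl.
by exists z => //; exact: subset_closed_ball zr.
Qed.

(** Differentiation under the integral sign, dominated by a constant: the bound of the partial
    derivative on a smaller ball, whose closure is compact in the domain. *)
Lemma radial_partial k f x r j : 0 < r -> smooth_on (ball a r) f -> ball a r x ->
  derivable (radial k f) x (delta_mx 0 j) /\
  partial j (radial k f) x = radial k.+1 (partial j f) x.
Proof.
move=> r0 sf xr.
have [r' [r'0 r'r] xr'] := inner_ball r0 xr.
have sub z : ball a r' z -> ball a r z by apply: le_ball; exact: ltW.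
have cf z : ball a r z -> {for z, continuous f} by exact: smooth_cont sf.
have cdf z : ball a r z -> {for z, continuous (partial j f)}.
  exact: (smooth_cont (smooth_partial j sf)).
have [M M0 HM] := compact_bound r'0 r'r cdf.
(* For displacements below [e] the end point stays in the smaller ball, and so does its whole
   ray. *)
have [e e0 eb] : exists2 e : R, 0 < e &
    forall s : R, -e < s < e -> ball a r' (s *: delta_mx 0 j + x).
  have ob : open (ball a r') by exact: ball_open.
  have /nbhs_ballP[e /= e0 eP] := open_nbhs_nbhs (conj ob xr').
  exists e => // s se; apply: eP; apply/ball_rVP => // i.
  rewrite !mxE opprD addrCA subrr addr0 normrN normrM.
  apply: (@le_lt_trans _ _ `|s|); last by rewrite ltr_norml.
  by case: (i == j); rewrite ?andbF /= ?normr1 ?normr0 ?mulr1 ?mulr0.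
pose G (s t : R) := t ^+ k * f (seg (s *: delta_mx 0 j + x) t).
have segE (s t : R) : seg (s *: delta_mx 0 j + x) t = (s * t) *: delta_mx 0 j + seg x t.
  by rewrite /seg -addrA scalerDr scalerA [t * s]mulrC addrA.
(* The chain rule contributes the factor t that turns the weight k into k + 1. *)
have dG (s t : R) : -e < s < e -> 0 <= t <= 1 ->
    is_derive s (1 : R) (G ^~ t) (t ^+ k.+1 * partial j f (seg (s *: delta_mx 0 j + x) t)).
  move=> se t01.
  have inb : ball a r ((s * t) *: delta_mx 0 j + seg x t).
    by rewrite -segE; apply: seg_ball => //; apply: sub; exact: eb.
  have D1 := is_derive_line (@smooth_derivable _ _ _ _ _ j sf inb).
  have D2 : is_derive s (1 : R) (( *%R^~ t) : R -> R) t.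
    have := is_deriveM (is_derive_id s (1 : R)) (is_derive_cst t s 1).
    by rewrite scaler0 add0r [_ *: _]mulr1.
  have D3 := @is_derive1_comp R (fun u : R => f (u *: delta_mx 0 j + seg x t)) ( *%R^~ t) s _ _ D1 D2.
  have D4 := is_deriveZ (t ^+ k) D3.
  have E : (t ^+ k \*: ((fun u : R => f (u *: delta_mx 0 j + seg x t)) \o *%R^~ t)) = G ^~ t.
    by apply/funext => u; rewrite /G /= segE.
  rewrite E in D4; apply: is_derive_eq D4 _.
  have sw (p q u : R) : p * (q * u) = u * p * q by ring.
  by rewrite segE exprS; exact: sw.
have mB : measurable (`[0, 1]%classic : set (measurableTypeR R)) by [].
have I0 : (`]-e, e[%classic : set R) 0 by rewrite /= in_itv /= oppr_lt0 e0.
have intG s : (`]-e, e[%classic : set R) s ->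
    (@lebesgue_measure R).-integrable `[0, 1] (EFin \o G s).
  rewrite /= in_itv /= => se; apply: cont01_integrable.
  by apply: (@cont01_radial k _ _ _ r0 cf); apply: sub; exact: eb.
have dG' s t : (`]-e, e[%classic : set R) s -> (`[0, 1]%classic : set R) t -> derivable (G ^~ t) s 1.
  by rewrite /= !in_itv /= => se t01; have [] := dG s t se t01.
have intM : (@lebesgue_measure R).-integrable `[0, 1] (EFin \o (fun=> M)).
  by apply: cont01_integrable; exact: cont01_cst.
have Gub s t : (`]-e, e[%classic : set R) s -> (`[0, 1]%classic : set R) t ->
   `|partial1of2 G s t| <= M.
  rewrite /= !in_itv /= => se t01; rewrite partial1of2E.
  have [_ ->] := dG s t se t01; rewrite normrM; have /andP[t0 t1] := t01.
  apply: (@le_trans _ _ (1 * `|partial j f (seg (s *: delta_mx 0 j + x) t)|)).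
    by apply: ler_wpM2r => //; rewrite ger0_norm ?exprn_ge0 // exprn_ile1.
  by rewrite mul1r; apply: HM; apply: seg_ball => //; exact: eb.
have H1 := @derivable_under_integral R _ _ (@lebesgue_measure R) G _ mB 0 (-e) e I0 intG dG' (fun=> M) (fun=> M0) intM Gub.
have H2 := @differentiation_under_integral R _ _ (@lebesgue_measure R) G _ mB 0 (-e) e I0 intG dG' (fun=> M) (fun=> M0) intM Gub.
split.
  by apply/derivable1P; exact: H1.
rewrite /partial derive_line -derive1E; apply: etrans H2 _.
apply: int01_eq => t t01; rewrite partial1of2E.
have [|_ ->] := dG 0 t _ t01; first by rewrite oppr_lt0 e0.
by rewrite scale0r add0r.
Qed.

(** The induction on the order runs over all weights and all functions at once, since a derivative
    changes both. *)
Lemma radial_smooth k f r : 0 < r -> smooth_on (ball a r) f ->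
  smooth_on (ball a r) (radial k f).
Proof.
move=> r0 sf m; elim: m k f sf => [|m IH] k f sf /=.
  move=> x xr; apply: (@Ck1_continuous _ _ (ball a r)) => // j.
  have rp z : ball a r z -> _ := fun zr => @radial_partial k f z r j r0 sf zr.
  split=> [z zr|]; first exact: (rp z zr).1.
  have [r' [r'0 r'r] xr'] : exists2 r' : R, 0 < r' /\ r' < r & ball a r' x by exact: inner_ball xr.
  have cdf z : ball a r z -> {for z, continuous (partial j f)}.
    exact: (smooth_cont (smooth_partial j sf)).
  have [M M0 HM] := compact_bound r'0 r'r cdf.
  exists M; have := open_nbhs_nbhs (conj (ball_open a r') xr').
  apply: (@filterS _ _ (nbhs_filter x)) => z zr'.
  have zr : ball a r z by apply: le_ball zr'; exact: ltW.
  rewrite (rp z zr).2; apply: (radial_le _ r'0 _ zr' HM) => y yr'; apply: cdf.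
  by apply: le_ball yr'; exact: ltW.
move=> i; split=> [x xr|]; first exact: (radial_partial k i r0 sf xr).1.
apply: (@Ck_on_eq _ _ _ _ (radial k.+1 (partial i f))); first exact: ball_open.
  by move=> z zr; rewrite (radial_partial k i r0 sf zr).2.
by apply: IH; exact: smooth_partial.
Qed.

(** The fundamental theorem of calculus for the function t f(a + t (x - a)) on [0, 1]. This is the
    homotopy formula behind both the Frobenius and the Poincare lemma. *)
Lemma radial_euler f x r : 0 < r -> smooth_on (ball a r) f -> ball a r x ->
  f x = radial 0 f x + \sum_(m < n) (x 0 m - a 0 m) * radial 1 (partial m f) x.
Proof.
move=> r0 sf xr.
have cf z : ball a r z -> {for z, continuous f} by exact: smooth_cont sf.
have cdf m z : ball a r z -> {for z, continuous (partial m f)}.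
  exact: (smooth_cont (smooth_partial m sf)).
pose g (t : R) := f (seg x t) + t * \sum_(m < n) (x 0 m - a 0 m) * partial m f (seg x t).
have c1 m : cont01 (fun t : R => (x 0 m - a 0 m) * (t ^+ 1 * partial m f (seg x t))).
  by apply: cont01M; [exact: cont01_cst|exact: cont01_radial r0 (cdf m) xr].
have gE : g = fun t => t ^+ 0 * f (seg x t) +
    \sum_(m < n) (x 0 m - a 0 m) * (t ^+ 1 * partial m f (seg x t)).
  apply/funext => t; rewrite /g expr0 mul1r mulr_sumr; congr (_ + _).
  by apply: eq_bigr => m _; rewrite expr1 mulrCA.
have c0 := @cont01_radial 0 _ _ _ r0 cf xr.
have c2 := @cont01_sum _ _ (index_enum 'I_n) xpredT _ (fun m _ => c1 m).
have cg : cont01 g by rewrite gE => t t01; apply: cvgD; [exact: c0|exact: c2].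
have dg (t : R) : 0 <= t <= 1 -> is_derive t (1 : R) (fun t : R => t * f (seg x t)) (g t).
  move=> t01; have inb := seg_ball r0 xr t01.
  have [df dfE] := is_diff_C1 (ball_open a r) inb (sf 1%N).
  have D1 : is_derive t (1 : R) (fun t => f (seg x t)) ('D_(x - a) f (seg x t)).
    by apply: is_derive_line; exact: diff_derivable.
  have := is_deriveM (is_derive_id t (1 : R)) D1.
  move=> D; apply: (is_derive_eq D); rewrite /g /= addrC; congr (_ + _).
    by rewrite /GRing.scale /= mulr1.
  rewrite deriveE // dfE /GRing.scale /=; congr (_ * _).
  by apply: eq_bigr => m _; rewrite !mxE.
have := int01_FTC cg dg.
rewrite mul0r subr0 mul1r {1}/seg scale1r subrK => <-.
rewrite gE int01D //; congr (_ + _).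
rewrite int01_sum; last by move=> m _; exact: c1.
by apply: eq_bigr => m _; rewrite int01Z //; exact: cont01_radial r0 (cdf m) xr.
Qed.
End Radial.

(** The mean value theorem compares the difference quotient of [F p] with [g] uniformly in p, so the
    limit in p can be taken at a fixed increment. *)
Lemma uniform_limit_derive (R : realType) (n : nat) (F : nat -> 'rV[R]_n -> R)
    (f g : 'rV[R]_n -> R) x (r : R) j : 0 < r ->
  (forall p z, ball x r z -> derivable (F p) z (delta_mx 0 j)) ->
  (forall z, ball x r z -> F p z @[p --> \oo] --> f z) ->
  (forall e : R, 0 < e -> \forall p \near \oo,
     forall z, ball x r z -> `|partial j (F p) z - g z| <= e) ->
  {for x, continuous g} ->
  derivable f x (delta_mx 0 j) /\ partial j f x = g x.
Proof.
move=> r0 dF Ff dFg cg.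
suff H : h^-1 *: ((f \o shift x) (h *: delta_mx 0 j) - f x) @[h --> (0 : R)^'] --> g x.
  by split; [apply/cvg_ex; exists (g x)|exact: cvg_lim H].
apply/cvgrPdist_le => e e0.
have e20 : 0 < e / 2 by rewrite divr_gt0.
have /(@cvgrPdist_le _ _ _ (nbhs x))/(_ _ e20)/nbhs_ballP[d /= d0 dP] := cg.
pose m := Num.min r d.
have m0 : 0 < m by rewrite lt_min r0 d0.
near=> h.
have h0 : h != 0 by near: h; exact: nbhs_dnbhs_neq.
have hm : `|h| < m by near: h; exact: dnbhs0_lt.
have inb t : 0 <= t <= 1 -> ball x m ((t * h) *: delta_mx 0 j + x).
  move=> /andP[t0 t1]; apply/(ball_rVP _ _ m0) => i.
  rewrite !mxE opprD addrCA subrr addr0 normrN !normrM.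
  apply: le_lt_trans hm.
  have A : `|t| <= 1 by rewrite ger0_norm.
  have A' : `|((0 == 0 :> 'I_1) && (i == j))%:R : R| <= 1.
    by case: (_ && _); rewrite ?normr1 ?normr0.
  by rewrite -[leRHS]mulr1 -[X in _ <= X * _]mul1r !ler_pM // mulr_ge0.
have mr z : ball x m z -> ball x r z by apply: le_ball; rewrite ge_min lexx.
have md z : ball x m z -> ball x d z by apply: le_ball; rewrite ge_min lexx orbT.
have hx : ball x r (h *: delta_mx 0 j + x).
  by apply: mr; have := inb 1; rewrite mul1r; apply; rewrite ler01 lexx.
(* The inequality is closed, so it passes from [F p] to the limit; half of [e] pays for the uniform
   convergence of the derivatives, half for the continuity of [g]. *)
have key : `|f (h *: delta_mx 0 j + x) - f x - g x * h| <= e * `|h|.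
  have c1 : `|F p (h *: delta_mx 0 j + x) - F p x - g x * h| @[p --> \oo] -->
      `|f (h *: delta_mx 0 j + x) - f x - g x * h|.
    apply: cvg_norm; apply: cvgB; last exact: cvg_cst.
    by apply: cvgB; apply: Ff => //; exact: ballxx.
  apply: (@closed_cvg _ _ \oo _ _ (fun u => u <= e * `|h|) _ _ _ c1).
    exact: closed_le.
  have := dFg _ e20; apply: filterS => p Hp.
  have [t t01|t t01 /= ->] := @line_MVT _ _ (F p) x j h.
    by apply: dF; apply: mr; exact: inb.
  rewrite -mulrBl normrM; apply: ler_wpM2r => //.
  rewrite (splitr e) -(subrKA (g ((t * h) *: delta_mx 0 j + x))).
  apply: (le_trans (ler_normD _ _)); apply: lerD.
    by apply: Hp; apply: mr; exact: inb.
  by rewrite distrC; apply: dP; apply: md; exact: inb.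
rewrite distrC /=.
have -> : h^-1 *: (f (h *: delta_mx 0 j + x) - f x) - g x =
   h^-1 * (f (h *: delta_mx 0 j + x) - f x - g x * h).
  by rewrite mulrBr [h^-1 * (g x * h)]mulrC mulfK.
by rewrite normrM normfV mulrC ler_pdivrMr // normr_gt0.
Unshelve. all: by end_near. Qed.

(** The arithmetic of one step of [w_le]: [K] is k C, [D] bounds the first Picard step, [S] is the
    size of the initial value, [q] is n r, and [P8], [P2] are the powers of 1/8 and 1/2. The source
    term and the contracted defect each take half of the right-hand side. *)
Lemma picard_bound (R : realType) (K D S q P2 P8 : R) :
  0 <= K -> 0 <= D -> 0 <= S -> 0 <= q -> q * K <= 8^-1 -> 0 <= P8 -> P8 <= P2 ->
  K * (D * P8) + q * (2 * (K * (4 * (K * (D + S)) * P2))) <=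
    4 * (K * (D + S)) * (P2 / 2).
Proof.
move=> K0 D0 S0 q0 qK P80 P82.
have P20 : 0 <= P2 by exact: le_trans P82.
have X0 : 0 <= K * (D + S) * P2 by rewrite !mulr_ge0 // addr_ge0.
have h1 : K * (D * P8) <= K * (D + S) * P2.
  rewrite mulrA ler_pM ?mulr_ge0 //; first by rewrite ler_wpM2l // lerDl.
have -> : q * (2 * (K * (4 * (K * (D + S)) * P2))) = 8 * (q * K) * (K * (D + S) * P2) by ring.
have -> : 4 * (K * (D + S)) * (P2 / 2) = K * (D + S) * P2 + K * (D + S) * P2 by field.
apply: lerD => //; rewrite -[leRHS]mul1r; apply: ler_wpM2r => //.
by rewrite -[leRHS](@mulfV _ (8 : R)) ?pnatr_eq0 // ler_wpM2l.
Qed.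

(* [picard] integrates [d u = B u] along rays from [a]; the defect
   [w_ p j = partial j u_p - B_j u_p] contracts because [B] is integrable. *)
Section Frobenius.
Variables (R : realType) (n k : nat) (a : 'rV[R]_n) (r : R) (r0 : 0 < r).
Variables (B : 'I_n -> 'I_k -> 'I_k -> 'rV[R]_n -> R) (v0 : 'I_k -> R) (C : R).
Hypothesis sB : forall m c d, smooth_on (ball a r) (B m c d).
Hypothesis C0 : 0 <= C.
Hypothesis BC : forall m c d z, ball a r z -> `|B m c d z| <= C.
Hypothesis small : n%:R * r * (k%:R * C) <= 8^-1.
Hypothesis flat : forall i j c d z, ball a r z ->
  partial i (B j c d) z - partial j (B i c d) z =
    \sum_e (B i c e z * B j e d z - B j c e z * B i e d z).

Let Bu m c (u : 'I_k -> 'rV[R]_n -> R) (z : 'rV[R]_n) := \sum_d B m c d z * u d z.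

Let picard (u : 'I_k -> 'rV[R]_n -> R) c (z : 'rV[R]_n) : R :=
  v0 c + \sum_m (z 0 m - a 0 m) * radial a 0 (Bu m c u) z.

Let u_ p := iter p picard (fun c _ => v0 c).
Let w_ p j c (z : 'rV[R]_n) := partial j (u_ p c) z - Bu j c (u_ p) z.

Let oB : open (ball a r). Proof. exact: ball_open. Qed.

Let smooth_coord m : smooth_on (ball a r) (fun z => z 0 m - a 0 m).
Proof.
apply: smoothB => //; last exact: smooth_cst.
exact: smooth_proj.
Qed.

Let smooth_Bu m c u : (forall d, smooth_on (ball a r) (u d)) ->
  smooth_on (ball a r) (Bu m c u).
Proof. by move=> su; apply: smooth_sum => // d _; exact: smoothM. Qed.

Let smooth_u p c : smooth_on (ball a r) (u_ p c).
Proof.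
elim: p c => [|p IH] c; first exact: smooth_cst.
apply: smoothD => //; first exact: smooth_cst.
apply: smooth_sum => // m _; apply: smoothM => //; apply: radial_smooth => //.
exact: smooth_Bu.
Qed.

Let coord_lt z m : ball a r z -> `|z 0 m - a 0 m| <= r.
Proof. by move=> /(ball_rVP _ _ r0)/(_ m)/ltW; rewrite distrC. Qed.

Let Bu_le m c u (M : R) z : ball a r z -> (forall d, `|u d z| <= M) ->
  `|Bu m c u z| <= k%:R * C * M.
Proof.
move=> az uM; rewrite /Bu; apply: (le_trans (ler_norm_sum _ _ _)).
apply: (@le_trans _ _ (\sum_(d < k) C * M)).
  by apply: ler_sum => d _; rewrite normrM ler_pM // BC.
by rewrite sumr_const card_ord -[_ *+ k]mulr_natl mulrA.
Qed.

Let BuB m c u v z : Bu m c u z - Bu m c v z = Bu m c (fun d z => u d z - v d z) z.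
Proof. by rewrite /Bu -sumrB; apply: eq_bigr => d _; rewrite mulrBr. Qed.

Let sum_radial_le q (g : 'I_n -> 'rV[R]_n -> R) (M : R) z : ball a r z ->
  (forall m, smooth_on (ball a r) (g m)) ->
  (forall m z, ball a r z -> `|g m z| <= M) ->
  `|\sum_m (z 0 m - a 0 m) * radial a q (g m) z| <= n%:R * r * M.
Proof.
move=> az sg gM; apply: (le_trans (ler_norm_sum _ _ _)).
apply: (@le_trans _ _ (\sum_(m < n) r * M)).
  apply: ler_sum => m _; rewrite normrM ler_pM //; first exact: coord_lt.
  by apply: (radial_le q r0 _ az (gM m)) => y; exact: smooth_cont.
by rewrite sumr_const card_ord -[_ *+ n]mulr_natl mulrA.
Qed.

Let D := (n%:R * r) * (k%:R * C * \sum_c `|v0 c|).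

Let v0_le d : `|v0 d| <= \sum_c `|v0 c|.
Proof. by rewrite (bigD1 d) //= lerDl sumr_ge0. Qed.

(** One Picard step multiplies differences by at most n r k C, which is at most 1/8; [D] is the size
    of the first step. *)
Let u_diff p c z : ball a r z -> `|u_ p.+1 c z - u_ p c z| <= D * 8^-1 ^+ p.
Proof.
elim: p c z => [|p IH] c z az.
  rewrite mulr1 /= /picard addrC addKr.
  apply: sum_radial_le => // [m|m y ay]; first by apply: smooth_Bu => d; exact: smooth_cst.
  by apply: Bu_le.
rewrite [u_ p.+2]/(picard (u_ p.+1)) [u_ p.+1]/(picard (u_ p)) /picard.
rewrite opprD addrACA subrr add0r -sumrB -/(picard (u_ p)) -/(u_ p.+1).
under eq_bigr => m _.
  rewrite -mulrBr -(radialB 0 r0 az); first over.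
    by move=> y; apply: smooth_cont; apply: smooth_Bu; exact: (smooth_u p.+1).
  by move=> y; apply: smooth_cont; apply: smooth_Bu; exact: (smooth_u p).
set K := D * 8^-1 ^+ p in IH.
have K0 : 0 <= K.
  by rewrite mulr_ge0 ?exprn_ge0 // mulr_ge0 ?mulr_ge0 ?sumr_ge0 // ltW.
apply: (@le_trans _ _ (n%:R * r * (k%:R * C * K))).
  apply: sum_radial_le => // [m|m y ay].
    by apply: smoothB => //; apply: smooth_Bu => d; [exact: (smooth_u p.+1)|exact: (smooth_u p)].
  by rewrite BuB; apply: Bu_le => // d; exact: IH.
by rewrite [leLHS]mulrA exprSr [leRHS]mulrA -/K [leRHS]mulrC; apply: ler_wpM2r.
Qed.

(** Larger than the initial defect k C |v0|, so as to absorb also the terms that the differences of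
    successive iterates contribute later. *)
Let W := 4 * (k%:R * C * (D + \sum_c `|v0 c|)).

(** Differentiating the Picard integral and subtracting [radial_euler] for B_j u_p leaves the ray
    integrals of the curl of the forms B_m u_p. By [flat] this curl is a linear expression in the
    defects, called [h]; hence the new defect is B_j (u_p - u_{p+1}) plus a small multiple of the
    old one. *)
Let w_le p j c z : ball a r z -> `|w_ p j c z| <= W * 2^-1 ^+ p.
Proof.
have S0 : 0 <= \sum_c `|v0 c| by rewrite sumr_ge0.
have D0 : 0 <= D by rewrite mulr_ge0 ?mulr_ge0 // ltW.
have X0 : 0 <= k%:R * C by rewrite mulr_ge0.
have q0 : 0 <= n%:R * r by rewrite mulr_ge0 // ltW.
have e80 (q : nat) : 0 <= 8^-1 ^+ q :> R by rewrite exprn_ge0.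
have e82 (q : nat) : 8^-1 ^+ q <= 2^-1 ^+ q :> R.
  by apply: lerXn2r; rewrite ?nnegrE //; lra.
elim: p j c z => [|p IH] j c z az.
  rewrite mulr1 /w_ /= [partial _ _ _](_ : _ = 0); last by rewrite partial_cst.
  rewrite sub0r normrN; apply: (@le_trans _ _ (k%:R * C * \sum_c `|v0 c|)).
    exact: Bu_le.
  rewrite /W; nra.
have sg m d : smooth_on (ball a r) (Bu m d (u_ p)) by exact: smooth_Bu.
have su d : smooth_on (ball a r) (u_ p d) by exact: smooth_u.
have pu : partial j (u_ p.+1 c) z =
    radial a 0 (Bu j c (u_ p)) z + \sum_m (z 0 m - a 0 m) * radial a 1 (partial j (Bu m c (u_ p))) z.
  have dm m : derivable (fun y : 'rV[R]_n => y 0 m - a 0 m) z (delta_mx 0 j) /\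
      partial j (fun y : 'rV[R]_n => y 0 m - a 0 m) z = (m == j)%:R.
    have [d1 d2] := partial_coord j m z.
    split; first exact: derivableB d1 (derivable_cst (a 0 m) z (delta_mx 0 j)).
    have d3 := deriveB d1 (derivable_cst (a 0 m) z (delta_mx 0 j)).
    by apply: etrans d3 _; rewrite derive_cst subr0.
  have dr m := radial_partial 0 j r0 (sg m c) az.
  have dmr m := derivableM (dm m).1 (dr m).1.
  have [ds ps] := @partial_sum _ _ j _ (index_enum 'I_n) xpredT
    (fun m (y : 'rV[R]_n) => (y 0 m - a 0 m) * radial a 0 (Bu m c (u_ p)) y) z (fun m _ => dmr m).
  have -> : partial j (u_ p.+1 c) z = 0 +
      partial j (fun y => \sum_m (y 0 m - a 0 m) * radial a 0 (Bu m c (u_ p)) y) z.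
    have := partialD (derivable_cst (v0 c) z (delta_mx 0 j)) ds.
    by rewrite partial_cst; apply: etrans.
  rewrite add0r ps; under eq_bigr => m _ do rewrite (partialM (dm m).1 (dr m).1) (dm m).2 (dr m).2.
  rewrite big_split addrC /=; congr (_ + _).
  rewrite (bigD1 j) //= eqxx mulr1 big1 ?addr0 // => m /negPf ->.
  by rewrite mulr0.
have := radial_euler r0 (sg j c) az => Eu.
pose h m y := \sum_e (B m c e y * w_ p j e y - B j c e y * w_ p m e y).
have sw m e : smooth_on (ball a r) (w_ p m e).
  by apply: smoothB => //; apply: smooth_partial.
have sh m : smooth_on (ball a r) (h m).
  by apply: smooth_sum => // e _; apply: smoothB => //; exact: smoothM.
have dBu m i y : ball a r y -> partial i (Bu m c (u_ p)) y =
    \sum_e (B m c e y * partial i (u_ p e) y + u_ p e y * partial i (B m c e) y).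
  move=> ay; have dB e := smooth_derivable (i := i) (sB m c e) ay.
  have du e := smooth_derivable (i := i) (su e) ay.
  have [_ ->] := @partial_sum _ _ i _ (index_enum 'I_k) xpredT
    (fun e (y : 'rV[R]_n) => B m c e y * u_ p e y) y (fun e _ => derivableM (dB e) (du e)).
  by apply: eq_bigr => e _; rewrite partialM.
(* The terms with products of two B cancel against the derivatives of B by integrability; only
   defects remain. *)
have hE m y : ball a r y -> partial j (Bu m c (u_ p)) y - partial m (Bu j c (u_ p)) y = h m y.
  move=> ay; rewrite !dBu // /h.
  have F e : B m c e y * w_ p j e y - B j c e y * w_ p m e y =
     (B m c e y * partial j (u_ p e) y - B j c e y * partial m (u_ p e) y) +
     \sum_d (B j c e y * B m e d y - B m c e y * B j e d y) * u_ p d y.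
    rewrite /w_ /Bu !mulrBr !mulr_sumr.
    under [X in _ = _ + X]eq_bigr do rewrite mulrBl -!mulrA.
    rewrite sumrB; have alg (p1 p2 s1 s2 : R) : p1 - s1 - (p2 - s2) = p1 - p2 + (s2 - s1) by ring.
    exact: alg.
  under [RHS]eq_bigr do rewrite F.
  rewrite [RHS]big_split /= exchange_big /= -sumrB -big_split /=.
  apply: eq_bigr => e _.
  rewrite -mulr_suml -flat // -[u_ p e y * _]mulrC -[u_ p e y * _]mulrC.
  set s1 := partial _ _ _; set s2 := partial _ _ _; set s3 := partial _ _ _; set s4 := partial _ _ _.
  ring.
have E : w_ p.+1 j c z = (Bu j c (u_ p) z - Bu j c (u_ p.+1) z) +
   \sum_m (z 0 m - a 0 m) * radial a 1 (h m) z.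
  have S3 : \sum_m (z 0 m - a 0 m) * radial a 1 (h m) z =
      \sum_m (z 0 m - a 0 m) * radial a 1 (partial j (Bu m c (u_ p))) z -
      \sum_m (z 0 m - a 0 m) * radial a 1 (partial m (Bu j c (u_ p))) z.
    rewrite -sumrB; apply: eq_bigr => m _; rewrite -mulrBr; congr (_ * _).
    rewrite -(radialB 1 r0 az).
    - by apply: (radial_eq 1 r0 az) => y ay; rewrite hE.
    - by move=> y; apply: smooth_cont; apply: smooth_partial.
    - by move=> y; apply: smooth_cont; apply: smooth_partial.
  have alg (r1 s1 s2 b1 b2 s3 P : R) : P = r1 + s1 -> b1 = r1 + s2 -> s3 = s1 - s2 ->
      P - b2 = b1 - b2 + s3 by move=> -> -> ->; ring.
  exact: alg pu Eu S3.
have Wp0 : 0 <= W * 2^-1 ^+ p by rewrite mulr_ge0 ?exprn_ge0 // !mulr_ge0 // addr_ge0.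
have h_le m y : ball a r y -> `|h m y| <= 2 * (k%:R * C * (W * 2^-1 ^+ p)).
  move=> ay; apply: (le_trans (ler_norm_sum _ _ _)).
  apply: (@le_trans _ _ (\sum_(e < k) 2 * (C * (W * 2^-1 ^+ p)))).
    apply: ler_sum => e _; apply: (le_trans (ler_normB _ _)).
    have -> (q : R) : 2 * q = q + q by ring.
    by apply: lerD; rewrite normrM ler_pM // ?BC // IH.
  by rewrite sumr_const card_ord -[_ *+ k]mulr_natl mulrCA -[X in _ <= 2 * X]mulrA.
rewrite E; apply: (le_trans (ler_normD _ _)).
have t1 : `|Bu j c (u_ p) z - Bu j c (u_ p.+1) z| <= k%:R * C * (D * 8^-1 ^+ p).
  by rewrite BuB; apply: Bu_le => // d; rewrite distrC; exact: u_diff.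
have t2 := sum_radial_le 1 az sh h_le.
apply: (le_trans (lerD t1 t2)).
by rewrite exprSr; exact: (picard_bound X0 D0 S0 q0 small (e80 p) (e82 p)).
Qed.

Let u_lim c z : ball a r z -> exists2 l : R, u_ p c z @[p --> \oo] --> l &
  forall p, `|l - u_ p c z| <= 2 * D * 8^-1 ^+ p.
Proof.
move=> az.
have D0 : 0 <= D by rewrite mulr_ge0 ?mulr_ge0 ?sumr_ge0 // ltW.
have q_lt : `|8^-1 : R| < 1 by rewrite ger0_norm ?invr_ge0 //; lra.
(* The geometric sum is D times 8/7 of the difference of powers; the factor 2 is a convenient upper
   bound. *)
have step p q : `|u_ (p + q) c z - u_ p c z| <= 2 * D * (8^-1 ^+ p - 8^-1 ^+ (p + q)).
  elim: q => [|q IH]; first by rewrite addn0 !subrr normr0 mulr0.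
  rewrite addnS -[u_ _ c z - _](subrKA (u_ (p + q) c z)).
  apply: (le_trans (ler_normD _ _)); apply: (le_trans (lerD (u_diff _ _ az) IH)).
  have -> : 8^-1 ^+ (p + q).+1 = 8^-1 ^+ (p + q) * 8^-1 :> R by rewrite exprSr.
  have : 0 <= D * 8^-1 ^+ (p + q) by rewrite mulr_ge0 // exprn_ge0.
  move: (8^-1 ^+ (p + q)) (8^-1 ^+ p) => A P; nra.
have c0 : (fun p => 2 * D * 8^-1 ^+ p) @ \oo --> (0 : R).
  rewrite -[0](mulr0 (2 * D)); apply: cvgM; first exact: cvg_cst.
  exact: cvg_expr.
have cv : cvg (u_ p c z @[p --> \oo]).
  apply/cauchy_cvgP/cauchy_exP => e e0.
  have /cvgrPdist_lt/(_ _ e0)[p _ pe] := c0.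
  have {pe} := pe p (leqnn _); rewrite /= sub0r normrN ger0_norm; last first.
    by rewrite mulr_ge0 ?exprn_ge0 // mulr_ge0.
  move=> pe; exists (u_ p c z); exists p => // q /= pq.
  rewrite /ball /= distrC -(subnKC pq); apply: le_lt_trans (step _ _) _.
  apply: le_lt_trans pe; apply: ler_wpM2l; first by rewrite mulr_ge0.
  by rewrite lerBlDr lerDl exprn_ge0.
exists (lim (u_ p c z @[p --> \oo])) => // p.
have c1 : `|u_ q c z - u_ p c z| @[q --> \oo] --> `|lim (u_ p c z @[p --> \oo]) - u_ p c z|.
  by apply: cvg_norm; apply: cvgB => //; exact: cvg_cst.
apply: (@closed_cvg _ _ \oo _ _ (fun t : R => t <= 2 * D * 8^-1 ^+ p) _ _ _ c1).
  exact: closed_le.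
exists p => // q /= pq; rewrite -(subnKC pq); apply: le_trans (step _ _) _.
apply: ler_wpM2l; first by rewrite mulr_ge0.
by rewrite lerBlDr lerDl exprn_ge0.
Qed.

(** The iterates converge uniformly, and so do their derivatives, because the defects tend to zero
    uniformly; the limit therefore solves the system. *)
Lemma frobenius : exists u : 'I_k -> 'rV[R]_n -> R,
  [/\ forall c, smooth_on (ball a r) (u c), forall c, u c a = v0 c &
      forall j c z, ball a r z ->
        partial j (u c) z = \sum_d B j c d z * u d z].
Proof.
pose u c z : R := lim (u_ p c z @[p --> \oo]).
have uP c z : ball a r z -> u_ p c z @[p --> \oo] --> u c z /\
    forall p, `|u c z - u_ p c z| <= 2 * D * 8^-1 ^+ p.
  move=> az; have [l cl Hl] := u_lim c az.
  by rewrite /u (cvg_lim _ cl).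
have D0 : 0 <= D by rewrite mulr_ge0 ?mulr_ge0 ?sumr_ge0 // ltW.
have c8 : 2 * D * 8^-1 ^+ p @[p --> \oo] --> (0 : R).
  rewrite -[0](mulr0 (2 * D)); apply: cvgM; first exact: cvg_cst.
  by apply: cvg_expr; rewrite ger0_norm //; lra.
have c2 : W * 2^-1 ^+ p @[p --> \oo] --> (0 : R).
  rewrite -[0](mulr0 W); apply: cvgM; first exact: cvg_cst.
  by apply: cvg_expr; rewrite ger0_norm //; lra.
have cu c z : ball a r z -> {for z, continuous (u c)}.
  move=> az; apply/(@cvgrPdist_le _ _ _ (nbhs z)) => e e0.
  have e3 : 0 < e / 3 by rewrite divr_gt0.
  have /cvgrPdist_lt/(_ _ e3)[p _ /(_ p (leqnn _))] := c8.
  rewrite /= sub0r normrN ger0_norm; last by rewrite mulr_ge0 ?exprn_ge0 // mulr_ge0.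
  move=> pe.
  have /(@cvgrPdist_lt _ _ _ (nbhs z))/(_ _ e3) := smooth_cont (smooth_u p c) az.
  move=> /(nbhs_and (open_nbhs_nbhs (conj oB az))).
  apply: (@filterS _ _ (nbhs_filter z)) => y [ay /= uy].
  have H1 := le_lt_trans ((uP c z az).2 p) pe.
  have H2 := le_lt_trans ((uP c y ay).2 p) pe; rewrite distrC in H2.
  have := ltrD (ltrD H1 uy) H2.
  have -> : e / 3 + e / 3 + e / 3 = e by lra.
  move/ltW; apply: le_trans; apply: le_trans (lerD (ler_distD _ _ _) (lexx _)).
  exact: ler_distD.
have cg j c z : ball a r z -> {for z, continuous (Bu j c u)}.
  move=> az; apply: (@cvg_sumR _ _ _ _ _ (nbhs z) _) => d _.
  by apply: cvgM; [exact: smooth_cont (sB j c d) az|exact: cu].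
have du j c z : ball a r z -> derivable (u c) z (delta_mx 0 j) /\
    partial j (u c) z = Bu j c u z.
  move=> az.
  have [s /= s0 sP] := (nbhs_ballP _ _).1 (open_nbhs_nbhs (conj oB az)).
  apply: (@uniform_limit_derive _ _ (fun p => u_ p c) _ _ _ s) => //.
  - by move=> p y /sP ay; exact: smooth_derivable (smooth_u p c) ay.
  - by move=> y /sP ay; have [] := uP c y ay.
  - move=> e e0.
    have e20 : 0 < e / 2 by rewrite divr_gt0.
    have c3 : k%:R * C * (2 * D * 8^-1 ^+ p) @[p --> \oo] --> (0 : R).
      by rewrite -[0](mulr0 (k%:R * C)); apply: cvgM => //; exact: cvg_cst.
    have /cvgrPdist_lt/(_ _ e20)[p1 _ H1] := c2.
    have /cvgrPdist_lt/(_ _ e20)[p2 _ H2] := c3.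
    exists (maxn p1 p2) => // p /=; rewrite geq_max => /andP[/H1 h1 /H2 h2] y /sP ay.
    rewrite -(subrKA (Bu j c (u_ p) y)); apply: (le_trans (ler_normD _ _)).
    rewrite (splitr e); apply: lerD.
      apply: le_trans (w_le p j c ay) _.
      by move: h1; rewrite /= sub0r normrN => /ltW; apply: le_trans; exact: ler_norm.
    rewrite BuB; apply: le_trans (@Bu_le j c _ (2 * D * 8^-1 ^+ p) y ay _) _.
      by move=> d; rewrite distrC; exact: (uP d y ay).2.
    by move: h2; rewrite /= sub0r normrN => /ltW; apply: le_trans; exact: ler_norm.
  - exact: cg.
exists u; split.
(* Bootstrap: the derivatives of u are B u, so each order of regularity of u gives the next one. *)
- move=> c; apply/smooth_Cle => m; elim: m c => [|m IH] c.
    by apply/Cle0 => z az; exact: cu.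
  apply/CleS; split=> [z az|j]; first exact: cu.
  split=> [z az|]; first exact: (du j c z az).1.
  apply: (@Cle_eq _ _ _ _ (Bu j c u)) => // [z az|]; first by rewrite (du j c z az).2.
  by apply: Cle_sum => // d _; apply: CleM => //; move/smooth_Cle : (sB j c d).
- move=> c; have [+ _] := uP c a (ballxx _ r0) => H.
  apply: (cvg_unique _ H) => //=.
  have -> : (fun p => u_ p c a) = fun=> v0 c; last exact: cvg_cst.
  apply/funext => -[//|p]; rewrite /u_ /= /picard big1 ?addr0 // => m _.
  by rewrite subrr mul0r.
- by move=> j c z az; rewrite (du j c z az).2.
Qed.

End Frobenius.

(** * The Poincare lemma for one-forms *)

Section Primitive.
Variables (R : realType) (n : nat) (a : 'rV[R]_n) (r : R) (r0 : 0 < r).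

(** The primitive is the integral of the form along the ray from [a]. Closedness exchanges the
    indices in its derivative, and [radial_euler] then recognises the value of the form. *)
Lemma poincare (A : 'I_n -> 'rV[R]_n -> R) :
  (forall m, smooth_on (ball a r) (A m)) ->
  (forall i j z, ball a r z -> partial i (A j) z = partial j (A i) z) ->
  exists2 f, smooth_on (ball a r) f &
    forall j z, ball a r z -> partial j f z = A j z.
Proof.
move=> sA dA; pose f (z : 'rV[R]_n) : R := \sum_m (z 0 m - a 0 m) * radial a 0 (A m) z.
have sc m : smooth_on (ball a r) (fun z : 'rV[R]_n => z 0 m - a 0 m).
  by apply: smoothB => //; [exact: smooth_proj|exact: smooth_cst].
exists f => [|j z az].
  by apply: smooth_sum => // m _; apply: smoothM => //; exact: radial_smooth.
have dm m : partial j (fun y : 'rV[R]_n => y 0 m - a 0 m) z = (m == j)%:R.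
  have [d1 d2] := partial_coord j m z.
  have d3 := deriveB d1 (derivable_cst (a 0 m) z (delta_mx 0 j)).
  by apply: etrans d3 _; rewrite derive_cst subr0.
have dc m := smooth_derivable (i := j) (sc m) az.
have dr m := radial_partial 0 j r0 (sA m) az.
rewrite (@partial_sum _ _ j _ (index_enum 'I_n) xpredT
    (fun m (y : 'rV[R]_n) => (y 0 m - a 0 m) * radial a 0 (A m) y) z
    (fun m _ => derivableM (dc m) (dr m).1)).2.
under eq_bigr => m _ do rewrite (partialM (dc m) (dr m).1) dm (dr m).2.
rewrite big_split /= addrC (bigD1 j) //= eqxx mulr1 big1 ?addr0; last first.
  by move=> m /negPf ->; rewrite mulr0.
have E : \sum_(m < n) (z 0 m - a 0 m) * radial a 1 (partial j (A m)) z =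
    \sum_(m < n) (z 0 m - a 0 m) * radial a 1 (partial m (A j)) z.
  apply: eq_bigr => m _; apply: (congr1 ( *%R _)).
  by apply: (radial_eq 1 r0 az) => y ay; rewrite dA.
rewrite E; exact: esym (radial_euler r0 (sA j) az).
Qed.

End Primitive.

#[global] Opaque partial pmx radial.

(** * Levi-Civita connection and flat metrics *)

Section Eta.
Variables (R : realType) (n : nat).

Lemma eta_sq (i : 'I_n) : eta R i * eta R i = 1.
Proof. by rewrite /eta; case: ifP; rewrite ?mulrNN mulr1. Qed.

Lemma tr_eta_mx : (eta_mx R n)^T = eta_mx R n.
Proof. by rewrite /eta_mx tr_diag_mx. Qed.

Lemma eta_mxK : eta_mx R n *m eta_mx R n = 1%:M.
Proof.
apply/matrixP => i j; rewrite /eta_mx mul_diag_mx !mxE.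
by case: eqP => [->|_]; rewrite ?mulr0 //= eta_sq.
Qed.

Lemma unitmx_eta : eta_mx R n \in unitmx.
Proof. by have [] := mulmx1_unit eta_mxK. Qed.

Lemma lorentzian_unit (g : 'M[R]_n) : lorentzian_form g -> g \in unitmx.
Proof. by case=> P uP ->; rewrite !unitmx_mul unitmx_tr uP unitmx_eta. Qed.

Lemma lorentzian_sym (g : 'M[R]_n) : lorentzian_form g -> g^T = g.
Proof. by case=> P _ ->; rewrite !trmx_mul trmxK tr_eta_mx mulmxA. Qed.

Lemma coframe_unit (g E : 'M[R]_n) : g \in unitmx ->
  g = E^T *m eta_mx R n *m E -> E \in unitmx.
Proof. by move=> + gE; rewrite gE !unitmx_mul => /andP[_ ->]. Qed.

End Eta.

Section LeviCivita.
Variables (R : realType) (n : nat) (U : set 'rV[R]_n) (g : 'rV[R]_n -> 'M[R]_n).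
Hypothesis oU : open U.
Hypothesis sg : smooth_mx_on U g.
Hypothesis ug : forall x, U x -> g x \in unitmx.
Hypothesis gT : forall x, U x -> (g x)^T = g x.

(** The connection matrix in the direction m: the covariant derivative of a column V is the partial
    derivative plus [gamma m] times V. Compatibility and curvature become matrix identities. *)
Definition gamma (m : 'I_n) (x : 'rV[R]_n) : 'M[R]_n :=
  \matrix_(r, s) christoffel g r m s x.

Definition riemann_mx (x : 'rV[R]_n) (m k : 'I_n) : 'M[R]_n :=
  \matrix_(r, s) riemann g x r s m k.

Lemma smooth_christoffel r m l : smooth_on U (christoffel g r m l).
Proof.
apply: smoothM => //; first exact: smooth_cst.
apply: smooth_sum => // s _; apply: smoothM => //; first exact: smooth_invmx.
have sd i j k : smooth_on U (fun x => dg g x i j k) by apply: smooth_partial.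
by apply: smoothB => //; exact: smoothD.
Qed.

Lemma smooth_gamma m : smooth_mx_on U (gamma m).
Proof.
move=> r s; apply: smooth_eq (smooth_christoffel r m s) => // x _.
by rewrite mxE.
Qed.

Lemma dg_sym x i j k : U x -> dg g x i j k = dg g x i k j.
Proof.
move=> Ux; apply: partial_eq_on Ux _ => // z Uz.
by rewrite -[in LHS](gT Uz) mxE.
Qed.

Lemma christoffel_sym r m l x : U x -> christoffel g r m l x = christoffel g r l m x.
Proof.
move=> Ux; rewrite /christoffel; congr (_ * _); apply: eq_bigr => s _.
by rewrite [dg g x s l m]dg_sym // [dg g x m s l + _]addrC.
Qed.

(** The Christoffel symbols of the first kind. *)
Definition lower_christoffel x s m l : R :=
  2^-1 * (dg g x m s l + dg g x l s m - dg g x s m l).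

(** As g is invertible, it is enough to test a candidate after lowering its index; the inverse
    metric then never has to be computed. *)
Lemma christoffel_unique x m l (X : 'I_n -> R) : U x ->
  (forall s, \sum_r g x s r * X r = lower_christoffel x s m l) ->
  forall r, christoffel g r m l x = X r.
Proof.
move=> Ux gX r.
pose Xc := \col_r X r.
have -> : X r = (invmx (g x) *m (g x *m Xc)) r 0.
  by rewrite mulmxA mulVmx ?ug // mul1mx mxE.
rewrite mxE /christoffel mulr_sumr; apply: eq_bigr => s _.
rewrite mulrCA; congr (_ * _); rewrite mxE -[LHS]gX.
by apply: eq_bigr => r' _; rewrite mxE.
Qed.

Lemma christoffel_lower x s m l : U x ->
  \sum_r g x s r * christoffel g r m l x = lower_christoffel x s m l.
Proof.
move=> Ux; pose L := \col_s lower_christoffel x s m l.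
have E r : christoffel g r m l x = (invmx (g x) *m L) r 0.
  rewrite mxE /christoffel mulr_sumr; apply: eq_bigr => s' _.
  by rewrite mulrCA mxE.
transitivity ((g x *m (invmx (g x) *m L)) s 0).
  by rewrite mxE; apply: eq_bigr => r _; rewrite E.
by rewrite mulmxA mulmxV ?ug // mul1mx mxE.
Qed.

Lemma metric_compat x m : U x ->
  pmx m g x = (gamma m x)^T *m g x + g x *m gamma m x.
Proof.
move=> Ux; apply/matrixP => k l.
have E s t : (g x *m gamma m x) s t = lower_christoffel x s m t.
  by rewrite mxE -christoffel_lower //; apply: eq_bigr => r _; rewrite mxE.
have -> : (gamma m x)^T *m g x = (g x *m gamma m x)^T by rewrite trmx_mul gT.
rewrite [RHS]mxE [X in X + _]mxE !E /lower_christoffel pmxE -/(dg g x m k l).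
rewrite [dg g x m l k]dg_sym // [dg g x l m k]dg_sym // [dg g x k m l]dg_sym //.
set p := dg g x m k l; set q := dg g x k l m; set t := dg g x l k m.
by field.
Qed.

Lemma riemann_mxE x m k : riemann_mx x m k =
  pmx m (gamma k) x - pmx k (gamma m) x
  + (gamma m x *m gamma k x - gamma k x *m gamma m x).
Proof.
apply/matrixP => r s; rewrite !mxE !pmxE /riemann -sumrB.
apply: (f_equal2 +%R); last by apply: eq_bigr => l _; rewrite !mxE.
have E j : (fun z => gamma j z r s) = christoffel g r j s.
  by apply/funext => z; rewrite mxE.
by rewrite !E.
Qed.

(** Differentiating the parallel equation twice and exchanging the derivatives shows that the
    curvature kills every column of every [Qs t]. The last hypothesis says that these columns
    together span, in the dual form of having no common annihilator. *)
Lemma flat_of_parallel (I : Type) p (Qs : I -> 'rV[R]_n -> 'M[R]_(n, p)) x :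
  (forall t, smooth_mx_on U (Qs t)) ->
  (forall t m z, U z -> pmx m (Qs t) z = - (gamma m z *m Qs t z)) ->
  U x -> (forall w : 'rV[R]_n, (forall t, w *m Qs t x = 0) -> w = 0) ->
  forall r s m k, riemann g x r s m k = 0.
Proof.
move=> sQs dQs Ux span r s m k.
have /matrixP/(_ 0 s) : row r (riemann_mx x m k) = 0; last by rewrite !mxE.
apply: span => t; rewrite -row_mul; move: (Qs t) (sQs t) (dQs t) => Q sQ dQ.
have ddQ i j : pmx i (pmx j Q) x =
    - (pmx i (gamma j) x *m Q x) + gamma j x *m gamma i x *m Q x.
  rewrite (@pmx_eq_on _ _ _ _ U _ (fun z => gamma j z *m (- Q z))) //; last first.
    by move=> z Uz; rewrite dQ // mulmxN.
  have sN : smooth_mx_on U (fun z => - Q z).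
    by move=> a b; apply: smooth_eq (smoothN oU (sQ a b)) => // z _; rewrite mxE.
  rewrite (pmxM i Ux (smooth_gamma j) sN) mulmxN; congr (_ + _).
  have -> : pmx i (fun z => - Q z) x = gamma i x *m Q x.
    have E : (fun z => - Q z) = (fun z => (- 1%:M) *m Q z).
      by apply/funext => z; rewrite mulNmx mul1mx.
    rewrite E (pmxM i Ux _ sQ); last by move=> a b; exact: smooth_cst.
    by rewrite pmx_cst mul0mx add0r mulNmx mul1mx dQ // opprK.
  by rewrite mulmxA.
suff -> : riemann_mx x m k *m Q x = 0 by rewrite row0.
have sw : pmx m (pmx k Q) x = pmx k (pmx m Q) x.
  apply/matrixP => a b; rewrite !pmxE.
  have E i : (fun z => pmx i Q z a b) = partial i (fun z => Q z a b).
    by apply/funext => z; rewrite pmxE.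
  by rewrite !E; apply: (partial_swap m k oU Ux (sQ a b)).
move/eqP: sw; rewrite !ddQ -subr_eq0 => /eqP sw.
have alg (V : zmodType) (a1 a2 g1 g2 : V) :
    - a1 + g2 - (- a2 + g1) = 0 -> a1 - a2 + (g1 - g2) = 0.
  move/eqP; rewrite subr_eq0 => /eqP H.
  have -> : a1 - a2 + (g1 - g2) = - a2 + g1 - (- a1 + g2).
    by rewrite opprD opprK [RHS]addrACA [- a2 + a1]addrC.
  by rewrite H subrr.
by rewrite riemann_mxE mulmxDl !mulmxBl; exact: alg sw.
Qed.

(** The last clause says that the one-forms given by the rows of [E] are closed; together with
    orthonormality this is a local form of flatness that is stable under pull-back. *)
Definition closed_coframe (E : 'rV[R]_n -> 'M[R]_n) : Prop :=
  [/\ smooth_mx_on U E,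
      forall x, U x -> E x \in unitmx,
      forall x, U x -> g x = (E x)^T *m eta_mx R n *m E x &
      forall x, U x -> forall m k a,
        partial m (fun z => E z a k) x = partial k (fun z => E z a m) x].

(** The connection for which the dual frame is parallel has the matrix E^-1 dE. It preserves g
    because eta is constant and it is symmetric because the coframe is closed, so the Koszul formula
    identifies it with the Levi-Civita connection. *)
Lemma closed_coframe_gamma E : closed_coframe E -> forall x m, U x ->
  gamma m x = invmx (E x) *m pmx m E x.
Proof.
move=> [sE uE gE cE] x m Ux; apply/matrixP => r l; rewrite [LHS]mxE.
pose X r := (invmx (E x) *m pmx m E x) r l.
apply: (@christoffel_unique x m l X) => // s.
pose T m s l := ((E x)^T *m eta_mx R n *m pmx m E x) s l.
(* Closedness of the coframe is exactly this symmetry between the derivative index and the form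
   index. *)
have TC i j k : T i j k = T k j i.
  rewrite /T !mxE; apply: eq_bigr => a _; congr (_ * _).
  by rewrite !pmxE cE.
have sEt := smooth_tr oU sE.
have dgE i j k : dg g x i j k = T i j k + T i k j.
  have -> : dg g x i j k = pmx i g x j k by rewrite pmxE.
  rewrite (@pmx_eq_on _ _ _ _ U _ (fun z => (E z)^T *m eta_mx R n *m E z)) //.
  have sEe : smooth_mx_on U (fun z => (E z)^T *m eta_mx R n).
    by apply: smooth_mxM => //; exact: smooth_mx_cst.
  rewrite (pmxM i Ux sEe sE) (pmxM i Ux sEt (@smooth_mx_cst _ _ _ _ U (eta_mx R n))).
  rewrite pmx_cst mulmx0 addr0 pmx_tr mxE addrC; congr (_ + _).
  rewrite /T -[in RHS](trmxK (_ *m pmx i E x)) [in RHS]mxE.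
  by rewrite !trmx_mul trmxK tr_eta_mx mulmxA.
transitivity ((g x *m (invmx (E x) *m pmx m E x)) s l); first by rewrite [in RHS]mxE.
rewrite gE // -!mulmxA [E x *m _]mulmxA mulmxV ?uE // mul1mx mulmxA -/(T m s l).
rewrite /lower_christoffel !dgE [T m l s]TC [T l m s]TC [T l s m]TC.
set p := T m s l; set q := T s l m; set t := T s m l.
by field.
Qed.

Lemma closed_coframe_parallel E : closed_coframe E -> forall x m, U x ->
  pmx m (fun z => invmx (E z)) x = - (gamma m x *m invmx (E x)).
Proof.
move=> cE x m Ux; have [sE uE _ _] := cE.
by rewrite (closed_coframe_gamma cE) // (pmx_invmx _ oU Ux uE sE).
Qed.

Lemma closed_coframe_flat E : closed_coframe E -> forall x, U x ->
  forall r s m k, riemann g x r s m k = 0.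
Proof.
move=> cE x Ux; have [sE uE _ _] := cE.
apply: (@flat_of_parallel unit n (fun _ z => invmx (E z)) x) => //.
- by move=> _; exact: smooth_invmx.
- by move=> _ m z; exact: closed_coframe_parallel.
- by move=> w /(_ tt)/(congr1 (mulmx^~ (E x))); rewrite -mulmxA mulVmx ?uE // mulmx1 mul0mx.
Qed.

End LeviCivita.

(** Handles the part of the derivative of a pulled-back form in which its coefficients are
    differentiated; their derivatives [d] are symmetric when the form is closed. *)
Lemma sym_contract (R : comPzRingType) (n : nat) (d J : 'I_n -> 'I_n -> R) m k :
  (forall s l, d s l = d l s) ->
  \sum_l (\sum_s d s l * J s m) * J l k = \sum_l (\sum_s d s l * J s k) * J l m.
Proof.
move=> dT; under eq_bigr do rewrite mulr_suml.
under [RHS]eq_bigr do rewrite mulr_suml.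
rewrite exchange_big; apply: eq_bigr => s _; apply: eq_bigr => l _.
by rewrite dT mulrAC.
Qed.

(** The exterior derivative commutes with pull-back: the derivatives of the coefficients are
    symmetric by closedness, the second derivatives of [T] by Schwarz. *)
Lemma closed_coframe_pull (R : realType) (n : nat) (U V : set 'rV[R]_n)
    (g g' : 'rV[R]_n -> 'M[R]_n) (T : 'rV[R]_n -> 'rV[R]_n)
    (E : 'rV[R]_n -> 'M[R]_n) : open U -> open V ->
  (forall x, U x -> V (T x)) -> smooth_mx_on U T ->
  (forall x, U x -> g x \in unitmx) ->
  (forall x, U x -> g x = (jacobian T x)^T *m g' (T x) *m jacobian T x) ->
  closed_coframe V g' E ->
  closed_coframe U g (fun x => E (T x) *m jacobian T x).
Proof.
move=> oU oV UV sT ug gT [sE uE gE cE].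
have sET a b : smooth_on U (fun x => E (T x) a b).
  by apply: (smooth_comp oU oV UV (sE a b)) => l; exact: sT.
have sJ : smooth_mx_on U (jacobian T).
  move=> a b; apply: smooth_eq (smooth_partial b (sT 0 a)) => // z _.
  by rewrite mxE.
have gE' x : U x -> g x = (E (T x) *m jacobian T x)^T *m eta_mx R n *m (E (T x) *m jacobian T x).
  move=> Ux; rewrite gT // gE; last exact: UV.
  by rewrite trmx_mul !mulmxA.
split=> //.
- exact: (smooth_mxM oU (A := fun x => E (T x))).
- by move=> x Ux; apply: coframe_unit (gE' x Ux); exact: ug.
move=> x Ux m k a.
pose J l k := partial k (fun y => T y 0 l) x.
pose dE s l := partial s (fun z => E z a l) (T x).
have main i j : partial i (fun z => (E (T z) *m jacobian T z) a j) x =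
   \sum_l (\sum_s dE s l * J s i) * J l j +
   \sum_l E (T x) a l * partial i (partial j (fun y => T y 0 l)) x.
  have -> : (fun z => (E (T z) *m jacobian T z) a j) =
     (fun z => \sum_l E (T z) a l * partial j (fun y => T y 0 l) z).
    by apply/funext => z; rewrite mxE; apply: eq_bigr => l _; rewrite mxE.
  have d1 l : derivable (fun z => E (T z) a l) x (delta_mx 0 i).
    exact: smooth_derivable (sET a l) Ux.
  have d2 l : derivable (partial j (fun y => T y 0 l)) x (delta_mx 0 i).
    exact: smooth_derivable (smooth_partial j (sT 0 l)) Ux.
  rewrite (@partial_sum _ _ i _ (index_enum 'I_n) xpredT
    (fun l z => E (T z) a l * partial j (fun y => T y 0 l) z) x
    (fun l _ => derivableM (d1 l) (d2 l))).2.
  rewrite -big_split; apply: eq_bigr => l _.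
  rewrite (partialM (d1 l) (d2 l)) addrC; congr (_ + _).
  rewrite mulrC; congr (_ * _).
  have dT c : derivable (fun y => T y 0 c) x (delta_mx 0 i).
    exact: smooth_derivable (sT 0 c) Ux.
  exact: (partial_comp oV (UV _ Ux) (sE a l 1%N) dT).2.
apply: etrans (main m k) (etrans _ (esym (main k m))).
apply: (f_equal2 +%R).
  by apply: sym_contract => s l; exact: cE (UV _ Ux) s l a.
apply: eq_bigr => l _; apply: (congr1 ( *%R _)).
exact: (partial_swap m k oU Ux (sT 0 l)).
Qed.

(** Vanishing curvature is the integrability condition of parallel transport, so Frobenius yields a
    parallel frame [Q] equal to the identity at [a]. Metric compatibility makes the products of its
    vectors constant, and the symmetry of the Christoffel symbols makes the dual coframe closed. *)
Lemma flat_closed_coframe (R : realType) (n : nat) (U : set 'rV[R]_n)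
    (g : 'rV[R]_n -> 'M[R]_n) a : open U -> U a -> smooth_mx_on U g ->
  (forall x, U x -> lorentzian_form (g x)) ->
  (forall x, U x -> forall r s m k, riemann g x r s m k = 0) ->
  exists2 r : R, 0 < r & ball a r `<=` U /\ exists E, closed_coframe (ball a r) g E.
Proof.
move=> oU Ua sg lg flat.
have ug x : U x -> g x \in unitmx by move=> /lg/lorentzian_unit.
have gT x : U x -> (g x)^T = g x by move=> /lg/lorentzian_sym.
have [r1 /= r10 r1U] := (nbhs_ballP _ _).1 (open_nbhs_nbhs (conj oU Ua)).
have r20 : 0 < r1 / 2 by rewrite divr_gt0.
have r21 : r1 / 2 < r1 by rewrite ltr_pdivrMr // ltr_pMr // ltr1n.
have cG c m d z : ball a r1 z -> {for z, continuous (christoffel g c m d)}.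
  by move=> /r1U Uz; exact: smooth_cont (smooth_christoffel oU sg ug c m d) Uz.
have bG (t : 'I_n * 'I_n * 'I_n) := compact_bound r20 r21 (cG t.1.1 t.1.2 t.2).
pose Mt t := s2val (cid2 (bG t)).
pose C := \sum_t Mt t.
have Mt0 t : 0 <= Mt t by rewrite /Mt; case: cid2.
have MtP t z : ball a (r1 / 2) z -> `|christoffel g t.1.1 t.1.2 t.2 z| <= Mt t.
  by rewrite /Mt; case: cid2 => M /= _; apply.
have C0 : 0 <= C by apply: sumr_ge0.
(* Chosen so that n r n C is at most 1/8, the smallness condition of [frobenius] with n unknowns. *)
pose r := Num.min (r1 / 2) (8^-1 / (n%:R * n%:R * C + 1)).
have den0 : 0 < n%:R * n%:R * C + 1 by rewrite ltr_wpDl // !mulr_ge0.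
have r0 : 0 < r by rewrite lt_min r20 !divr_gt0.
have small : n%:R * r * (n%:R * C) <= 8^-1.
  have alg (p q c : R) : p * q * (p * c) = q * (p * p * c) by ring.
  rewrite alg.
  apply: (@le_trans _ _ (8^-1 / (n%:R * n%:R * C + 1) * (n%:R * n%:R * C + 1))).
    by apply: ler_pM; rewrite ?mulr_ge0 ?(ltW r0) // ?ge_min ?lexx ?orbT // lerDl.
  by rewrite divfK // lt0r_neq0.
have sub z : ball a r z -> ball a (r1 / 2) z by apply: le_ball; rewrite ge_min lexx.
have rU z : ball a r z -> U z.
  by move=> /sub zr; apply: r1U; apply: le_ball zr; exact: ltW.
pose B (m c d : 'I_n) z : R := - christoffel g c m d z.
have sB m c d : smooth_on (ball a r) (B m c d).
  apply: smoothN => //; apply: smooth_sub (smooth_christoffel oU sg ug c m d).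
  exact: rU.
have BC m c d z : ball a r z -> `|B m c d z| <= C.
  move=> /sub zr; rewrite normrN; apply: le_trans (MtP (c, m, d) z zr) _.
  by rewrite /C (bigD1 (c, m, d)) //= lerDl sumr_ge0.
have fB i j c d z : ball a r z -> partial i (B j c d) z - partial j (B i c d) z =
    \sum_e (B i c e z * B j e d z - B j c e z * B i e d z).
  move=> zr; have Uz := rU z zr.
  have := flat z Uz c d i j; rewrite /riemann => /eqP; rewrite addr_eq0 => /eqP E.
  have dN k e : partial k (B e c d) z = - partial k (christoffel g c e d) z.
    apply: partialN; exact: smooth_derivable (smooth_christoffel oU sg ug c e d) Uz.
  rewrite !dN -opprD E opprK; apply: eq_bigr => e _.
  by rewrite /B !mulrNN.
(* One solution for each basis vector as initial value; they become the columns of [Q]. *)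
pose v0 (e c : 'I_n) : R := (c == e)%:R.
have Fr e := frobenius r0 (v0 e) sB C0 BC small fB.
pose u e := projT1 (cid (Fr e)).
have uP e : [/\ forall c, smooth_on (ball a r) (u e c), forall c, u e c a = v0 e c &
      forall j c z, ball a r z ->
        partial j (u e c) z = \sum_d B j c d z * u e d z].
  by rewrite /u; case: cid.
pose Q z : 'M[R]_n := \matrix_(c, e) u e c z.
have sQ : smooth_mx_on (ball a r) Q.
  move=> c e; have [su _ _] := uP e; apply: smooth_eq (su c) => // z _.
  by rewrite mxE.
have Qa : Q a = 1%:M.
  by apply/matrixP => c e; rewrite !mxE; have [_ -> _] := uP e.
have dQ m z : ball a r z -> pmx m Q z = - (gamma g m z *m Q z).
  move=> zr; apply/matrixP => c e; rewrite pmxE !mxE.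
  have [_ _ /(_ m c z zr) du] := uP e.
  have -> : (fun z => Q z c e) = u e c by apply/funext => y; rewrite mxE.
  by rewrite du -sumrN; apply: eq_bigr => d _; rewrite !mxE mulNr.
have [s [s0 sr] uQ] : exists2 s : R, 0 < s /\ s <= r & forall z, ball a s z -> Q z \in unitmx.
  have cd : {for a, continuous (fun z => \det (Q z))}.
    by apply: smooth_cont (ballxx _ r0); exact: smooth_det.
  have /(@cvgrPdist_lt _ _ _ (nbhs a))/(_ _ ltr01)/nbhs_ballP[s /= s0 sP] := cd.
  exists (Num.min s r); first by rewrite lt_min s0 r0 ge_min lexx orbT.
  move=> z zs; have /sP : ball a s z by apply: le_ball zs; rewrite ge_min lexx.
  rewrite /= Qa det1 unitmxE unitfE; case: eqP => // ->.
  by rewrite subr0 normr1 ltxx.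
have sR z : ball a s z -> ball a r z by exact: le_ball.
have sU z : ball a s z -> U z by move=> /sR/rU.
have sQ' : smooth_mx_on (ball a s) Q by apply: smooth_mx_sub sQ; exact: sR.
have sg' : smooth_mx_on (ball a s) g by apply: smooth_mx_sub sg; exact: sU.
have sQt := smooth_tr (ball_open a s) sQ'.
(* The derivative of Q^T g Q is zero: the two terms from [metric_compat] cancel those from the
   transport of [Q]. *)
have K z : ball a s z -> (Q z)^T *m g z *m Q z = g a.
  move=> zs.
  have -> : g a = (Q a)^T *m g a *m Q a by rewrite Qa trmx1 mul1mx mulmx1.
  have sQg := smooth_mxM (ball_open a s) sQt sg'.
  apply: (@pmx0_cst _ _ _ _ (fun z => (Q z)^T *m g z *m Q z) a s) => //.
    exact: smooth_mxM.
  move=> y i ys; rewrite (pmxM i ys sQg sQ') (pmxM i ys sQt sg') pmx_tr.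
  rewrite (dQ i y (sR _ ys)) (metric_compat oU ug gT i (sU _ ys)).
  rewrite linearN /= trmx_mul mulNmx !mulmxDl !mulmxDr mulmxN.
  rewrite !mulmxDl !mulNmx !mulmxA addrA addNr add0r.
  by rewrite subrr.
have [P0 uP0 gP0] := lg a Ua.
(* [P0] brings the constant matrix g(a) to the form eta, so that [P0] times the inverse of [Q] is
   orthonormal. *)
exists s => //; split=> //; exists (fun z => P0 *m invmx (Q z)).
have sP : smooth_mx_on (ball a s) (fun=> P0) := @smooth_mx_cst _ _ _ _ _ P0.
have sV := smooth_invmx (ball_open a s) uQ sQ'.
split.
- exact: smooth_mxM.
- by move=> z zs; rewrite unitmx_mul uP0 unitmx_inv uQ.
- move=> z zs; rewrite trmx_mul -!mulmxA [eta_mx R n *m _]mulmxA [P0^T *m _]mulmxA.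
  rewrite [P0^T *m (eta_mx R n *m P0)]mulmxA -gP0 -(K z zs) trmx_inv.
  by rewrite !mulmxA mulVmx ?unitmx_tr ?uQ // mul1mx -mulmxA mulmxV ?uQ // mulmx1.
- move=> z zs m k b.
  have E i j : partial i (fun y => (P0 *m invmx (Q y)) b j) z =
      (P0 *m invmx (Q z) *m gamma g i z) b j.
    transitivity (pmx i (fun y => P0 *m invmx (Q y)) z b j); first by rewrite pmxE.
    rewrite (pmxM i zs sP sV) pmx_cst mul0mx add0r.
    rewrite (pmx_invmx i (ball_open a s) zs uQ sQ') dQ; last exact: sR.
    by rewrite !mulmxN mulNmx mulmxN opprK !mulmxA -[_ *m Q z *m _]mulmxA mulmxV ?uQ // mulmx1.
  rewrite !E !mxE; apply: eq_bigr => l _; congr (_ * _).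
  by rewrite !mxE (christoffel_sym oU gT _ _ _ (sU _ zs)).
Qed.

(** * Exterior algebra *)

Section Exterior.
Import mathcomp.boot.finset.
Variables (R : realType) (n : nat).
Implicit Types (a b : form R n) (u v : 'rV[R]_n) (S T : {set 'I_n}) (i j : 'I_n).

(** The number of transpositions that bring e^i from the front to its place among the factors of
    S. *)
Definition below S i : nat := #|[set j in S | (j < i)%N]|.

Definition ext v a : form R n := wedge (one_form v) a.

Definition ebasis T : form R n := [ffun S => (S == T)%:R].

Lemma extE v a S :
  ext v a S = \sum_(i in S) v 0 i * ((-1) ^+ below S i * a (S :\ i)).
Proof.
rewrite ffunE.
under eq_bigr => A AS do rewrite ffunE mulr_sumr mulr_suml.
rewrite (exchange_big_dep xpredT) //=.
rewrite [RHS]big_mkcond; apply: eq_bigr => i _.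
case: (boolP (i \in S)) => iS; last first.
  by rewrite big1 // => A /andP[AS /eqP A1]; move: AS; rewrite A1 sub1set (negPf iS).
rewrite (bigD1 [set i]%SET) ?sub1set ?iS ?eqxx //= big1 ?addr0; last first.
  by move=> A /andP[/andP[_ ->]].
rewrite mulrAC mulrC; congr (_ * (_ ^+ _ * _)).
rewrite /inversions /below -(card_imset (mem [set j in S | (j < i)%N]) (f := fun j => (i, j))).
  apply: eq_card => -[p q]; rewrite !inE /=; apply/idP/imsetP.
    move=> /and3P[/eqP -> /andP[_ qS] qi]; exists q => //.
    by rewrite !inE qS.
  by move=> [q']; rewrite !inE => /andP[qS qi] [-> ->]; rewrite eqxx qS qi /= andbT -val_eqE /= ltn_eqF.
by move=> x y [].
Qed.

Lemma extDl u v a : ext (u + v) a = ext u a + ext v a.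
Proof.
apply/ffunP => S; rewrite [RHS]ffunE !extE -big_split; apply: eq_bigr => i _.
by rewrite mxE mulrDl.
Qed.

Lemma extZl c v a : ext (c *: v) a = c *: ext v a.
Proof.
apply/ffunP => S; rewrite [RHS]ffunE !extE scaler_sumr; apply: eq_bigr => i _.
by rewrite mxE -mulrA.
Qed.

Lemma extD v a b : ext v (a + b) = ext v a + ext v b.
Proof.
apply/ffunP => S; rewrite [RHS]ffunE !extE -big_split; apply: eq_bigr => i _.
by rewrite ffunE /= !mulrDr.
Qed.

Lemma extZ c v a : ext v (c *: a) = c *: ext v a.
Proof.
apply/ffunP => S; rewrite [RHS]ffunE !extE scaler_sumr; apply: eq_bigr => i _.
by rewrite ffunE /GRing.scale /= [RHS]mulrCA; congr (_ * _); rewrite mulrCA.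
Qed.

Lemma ext0l a : ext 0 a = 0.
Proof. by rewrite -[0](scale0r 0) extZl scale0r. Qed.

Lemma ext0 v : ext v 0 = 0.
Proof. by rewrite -[0 in LHS](scale0r (0 : form R n)) extZ scale0r. Qed.

Lemma ext_sum (I : Type) (r : seq I) v (F : I -> form R n) :
  ext v (\sum_(i <- r) F i) = \sum_(i <- r) ext v (F i).
Proof.
elim: r => [|i r IH]; first by rewrite !big_nil ext0.
by rewrite !big_cons extD IH.
Qed.

Lemma ext_suml (I : Type) (r : seq I) (w : I -> 'rV[R]_n) a :
  ext (\sum_(i <- r) w i) a = \sum_(i <- r) ext (w i) a.
Proof.
elim: r => [|i r IH]; first by rewrite !big_nil ext0l.
by rewrite !big_cons extDl IH.
Qed.

Lemma below_D1 S i j : i \in S -> below S j = ((i < j)%N + below (S :\ i) j)%N.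
Proof.
move=> iS; rewrite /below; case: (ltnP i j) => ij.
  rewrite (cardsD1 i) !inE iS ij; congr (_ + _)%N; apply: eq_card => k.
  by rewrite !inE andbA.
rewrite add0n; apply: eq_card => k; rewrite !inE.
by case: eqP => [->|//]; rewrite ltnNge ij andbF.
Qed.

(** Both sides are sums over ordered pairs of distinct indices; removing the smaller index first
    shifts the position of the larger one by one, whence the sign. *)
Lemma ext_anticomm u v a : ext u (ext v a) = - ext v (ext u a).
Proof.
pose s S i j : R := (-1) ^+ below S i * (-1) ^+ below (S :\ i) j.
have E x y S : ext x (ext y a) S =
    \sum_(i in S) \sum_(j in S | j != i) x 0 i * y 0 j * (s S i j * a (S :\ i :\ j)).
  rewrite extE; apply: eq_bigr => i iS; rewrite extE !mulr_sumr.
  apply: eq_big => [j|j jS]; first by rewrite !inE andbC.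
  by rewrite /s; ring.
apply/ffunP => S; rewrite [RHS]ffunE !E (exchange_big_dep (mem S)) /=; last by move=> i j _ /andP[].
rewrite -sumrN; apply: eq_bigr => i iS; rewrite -sumrN.
apply: eq_big => [j|j /andP[jS /andP[_ ij]]]; first by rewrite iS eq_sym.
have -> : s S j i = - s S i j.
  rewrite /s (below_D1 i jS) (below_D1 j iS) !exprD.
  have /orP[ji|ji] : (i < j)%N || (j < i)%N by move: ij; rewrite -val_eqE neq_ltn.
    by rewrite ji ltnNge (ltnW ji) /=; ring.
  by rewrite ji ltnNge (ltnW ji) /=; ring.
have -> : S :\ j :\ i = S :\ i :\ j by apply/setP => k; rewrite !inE andbCA.
by ring.
Qed.

Lemma ext_ext0 v a : ext v (ext v a) = 0.
Proof.
have /eqP := ext_anticomm v v a; rewrite -addr_eq0 -mulr2n => /eqP H.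
apply/ffunP => S; rewrite [RHS]ffunE; have /ffunP/(_ S) := H.
rewrite mulr2n !ffunE => /eqP; rewrite -mulr2n -mulr_natl mulf_eq0 pnatr_eq0 /=.
by move=> /eqP.
Qed.

Lemma ext_delta_basis i T : i \notin T ->
  ext (delta_mx 0 i) (ebasis T) = (-1) ^+ below T i *: ebasis (i |: T).
Proof.
move=> iT; apply/ffunP => S; rewrite extE !ffunE.
have d k : (delta_mx 0 i : 'rV[R]_n) 0 k = (k == i)%:R by rewrite mxE.
case: (boolP (i \in S)) => iS; last first.
  rewrite big1 => [|k kS].
    by case: eqP => [E|_]; rewrite ?[_ *: _]mulr0 //; move: iS; rewrite E setU11.
  by rewrite d; case: eqP => [E|_]; rewrite ?mul0r //; move: iS; rewrite -E kS.
rewrite (bigD1 i) //= big1 ?addr0 => [|k /andP[_ /negPf ki]]; last by rewrite d ki mul0r.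
rewrite d eqxx mul1r !ffunE.
have -> : (S :\ i == T) = (S == i |: T).
  apply/eqP/eqP => [<-|->]; first by rewrite setD1K.
  by rewrite setU1K.
case: eqP => [E|_]; last by rewrite mulr0 [_ *: _]mulr0.
rewrite [_ *: _]mulr1 mulr1 (below_D1 i iS) ltnn add0n E setU1K //.
Qed.

Lemma form1E : form1 R n = ebasis set0.
Proof. by apply/ffunP => S; rewrite !ffunE cards_eq0. Qed.

End Exterior.

(** * Pull-back of forms along linear maps *)

Section Pull.
Import mathcomp.boot.finset.
Variables (R : realType).

Definition wprod (m n : nat) (J : 'M[R]_(m, n)) (s : seq 'I_m) : form R n :=
  \big[@wedge R n/form1 R n]_(i <- s) one_form (row i J).

Lemma wprod_cons m n (J : 'M[R]_(m, n)) i s :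
  wprod J (i :: s) = ext (row i J) (wprod J s).
Proof. by rewrite /wprod big_cons. Qed.

Lemma pullE m n (J : 'M[R]_(m, n)) (a : form R m) :
  pull J a = \sum_(T : {set 'I_m}) a T *: wprod J (enum T).
Proof. by []. Qed.

Lemma pullD m n (J : 'M[R]_(m, n)) a b : pull J (a + b) = pull J a + pull J b.
Proof.
by rewrite !pullE -big_split; apply: eq_bigr => T _; rewrite ffunE scalerDl.
Qed.

Lemma pullZ m n (J : 'M[R]_(m, n)) c a : pull J (c *: a) = c *: pull J a.
Proof.
by rewrite !pullE scaler_sumr; apply: eq_bigr => T _; rewrite ffunE scalerA.
Qed.

Lemma pull0 m n (J : 'M[R]_(m, n)) : pull J 0 = 0.
Proof. by rewrite -[0 in LHS](scale0r (0 : form R m)) pullZ scale0r. Qed.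

Lemma pull_sum m n (J : 'M[R]_(m, n)) (I : Type) (r : seq I) (F : I -> form R m) :
  pull J (\sum_(i <- r) F i) = \sum_(i <- r) pull J (F i).
Proof.
elim: r => [|i r IH]; first by rewrite !big_nil pull0.
by rewrite !big_cons pullD IH.
Qed.

Lemma ext_wprod_mem m n (J : 'M[R]_(m, n)) i s : i \in s -> ext (row i J) (wprod J s) = 0.
Proof.
elim: s => // k s IH; rewrite inE wprod_cons.
have [->|ik] /= := eqVneq i k; first by rewrite ext_ext0.
by move=> /IH E; rewrite ext_anticomm E ext0 oppr0.
Qed.

Lemma ext_wprod_cat m n (J : 'M[R]_(m, n)) i s1 s2 :
  ext (row i J) (wprod J (s1 ++ s2)) = (-1) ^+ size s1 *: wprod J (s1 ++ i :: s2).
Proof.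
elim: s1 => [|k s IH]; first by rewrite /= scale1r wprod_cons.
rewrite cat_cons !wprod_cons ext_anticomm IH extZ exprS mulN1r scaleNr //.
Qed.

(** [enum] lists a set in increasing order, so a new element enters after the elements below it.
    This links the signs of [extE] with positions in a product. *)
Lemma enum_split m (T : {set 'I_m}) (i : 'I_m) : i \notin T ->
  exists s1 s2, [/\ enum T = s1 ++ s2, enum (i |: T) = s1 ++ i :: s2 &
    size s1 = below T i].
Proof.
move=> iT.
have im : (i < size (enum 'I_m))%N by rewrite size_enum_ord.
have E : enum 'I_m = take i (enum 'I_m) ++ i :: drop i.+1 (enum 'I_m).
  by rewrite -{1}(cat_take_drop i (enum 'I_m)) (drop_nth i im) nth_ord_enum.
have lt k : k \in take i (enum 'I_m) = (k < i)%N.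
  have -> : (k \in take i (enum 'I_m)) = (index k (enum 'I_m) < i)%N.
    by rewrite in_take ?mem_enum.
  by rewrite index_enum_ord.
have gt k : k \in drop i.+1 (enum 'I_m) -> (i < k)%N.
  move=> kd; have := enum_uniq 'I_m; rewrite E cat_uniq /= => /and3P[_ + /andP[id _]].
  rewrite negb_or => /andP[_ /hasPn/(_ k kd)]; rewrite lt -leqNgt leq_eqVlt => /orP[/eqP/val_inj ik|//].
  by case/negP: id; rewrite [X in X \in _]ik.
exists [seq k <- take i (enum 'I_m) | k \in T], [seq k <- drop i.+1 (enum 'I_m) | k \in T].
have eE (A : {set 'I_m}) : enum A = [seq k <- enum 'I_m | k \in A].
  by rewrite {1}/enum_mem -enumT.
split.
- by rewrite eE {1}E filter_cat /= (negPf iT).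
- rewrite eE {1}E filter_cat /= setU11; congr (_ ++ _ :: _); apply: eq_in_filter => k.
    by rewrite lt !inE => ki; rewrite -val_eqE /= ltn_eqF.
  by move=> /gt ki; rewrite !inE -val_eqE /= gtn_eqF.
- rewrite /below cardE; apply/perm_size/uniq_perm; rewrite ?enum_uniq //.
    by rewrite filter_uniq // take_uniq // enum_uniq.
  by move=> k; rewrite mem_filter mem_enum inE lt.
Qed.

(** By linearity it is enough to treat e^i times a basis monomial: a repeated index gives zero on
    both sides, and otherwise the sign is the one for sliding the factor to its position. *)
Lemma pull_ext m n (J : 'M[R]_(m, n)) u (a : form R m) :
  pull J (ext u a) = ext (u *m J) (pull J a).
Proof.
have uJ : u *m J = \sum_i u 0 i *: row i J.
  apply/rowP => j; rewrite mxE summxE; apply: eq_bigr => i _.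
  by rewrite !mxE.
have basis i T : \sum_(S : {set 'I_m} | i \in S) (((-1) ^+ below S i * ebasis R T (S :\ i)) : R) *: wprod J (enum S) =
    ext (row i J) (wprod J (enum T)).
  case: (boolP (i \in T)) => iT.
    rewrite ext_wprod_mem ?mem_enum // big1 // => S iS; rewrite ffunE.
    case: eqP => [E|_]; last by rewrite mulr0 scale0r.
    by move: iT; rewrite -E !inE eqxx.
  rewrite (bigD1 (i |: T)) ?setU11 //= big1 ?addr0 => [|S /andP[iS ST]].
    have [s1 [s2 [-> -> sz]]] := enum_split iT.
    rewrite ext_wprod_cat ffunE setU1K // eqxx mulr1 (below_D1 i (setU11 _ _)) ltnn add0n.
    by rewrite setU1K // sz.
  rewrite ffunE; case: eqP => [E|_]; last by rewrite mulr0 scale0r.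
  by move: ST; rewrite -E setD1K // eqxx.
rewrite uJ ext_suml [pull J a]pullE.
under [RHS]eq_bigr => i _.
  rewrite ext_sum; under eq_bigr => T _ do rewrite extZ extZl -basis.
  over.
rewrite pullE.
transitivity (\sum_(S : {set 'I_m}) \sum_(i in S)
    (u 0 i * ((-1) ^+ below S i * a (S :\ i)) : R) *: wprod J (enum S)).
  by apply: eq_bigr => S _; rewrite -scaler_suml; congr (_ *: _); exact: extE.
rewrite (exchange_big_dep xpredT) //=; apply: eq_bigr => i _.
under [RHS]eq_bigr => T _ do rewrite !scaler_sumr.
rewrite (exchange_big_dep xpredT) //=.
rewrite [LHS]big_mkcond [RHS]big_mkcond /=; apply: eq_bigr => S _.
case: (boolP (i \in S)) => iS; last by rewrite big_pred0.
rewrite (bigD1 (S :\ i)) //= big1 ?addr0 => [|T TS].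
  rewrite ffunE eqxx mulr1 !scalerA; congr (_ *: _); ring.
by rewrite ffunE eq_sym (negPf TS) mulr0 scale0r !scaler0.
Qed.

Lemma pull_form1 m n (J : 'M[R]_(m, n)) : pull J (form1 R m) = form1 R n.
Proof.
rewrite pullE (bigD1 set0) //= big1 ?addr0 => [|T T0].
  by rewrite ffunE cards0 eqxx scale1r enum_set0 /wprod big_nil.
by rewrite ffunE cards_eq0 (negPf T0) scale0r.
Qed.

Lemma pull_wprod m n p (J : 'M[R]_(m, n)) (K : 'M[R]_(n, p)) s :
  pull K (wprod J s) = wprod (J *m K) s.
Proof.
elim: s => [|i s IH]; first by rewrite /wprod !big_nil pull_form1.
by rewrite !wprod_cons pull_ext IH row_mul.
Qed.

Lemma pull_pull m n p (J : 'M[R]_(m, n)) (K : 'M[R]_(n, p)) a :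
  pull K (pull J a) = pull (J *m K) a.
Proof.
rewrite [pull J a]pullE pull_sum [RHS]pullE; apply: eq_bigr => T _.
by rewrite pullZ pull_wprod.
Qed.

Lemma wprod_delta m n (J : 'M[R]_(m, n)) (f : 'I_m -> 'I_n) (T : {set 'I_m}) :
  {mono f : i j / (i < j)%N} -> (forall i, row i J = delta_mx 0 (f i)) ->
  wprod J (enum T) = ebasis R (f @: T).
Proof.
move=> mf Jf.
have fI : injective f.
  move=> i j fij; apply/eqP; case: (ltngtP i j) => [ij|ij|/val_inj/eqP//].
    by have := ltnn (f i); rewrite {2}fij mf ij.
  by have := ltnn (f j); rewrite -{2}fij mf ij.
have srt : sorted (fun i j : 'I_m => (i < j)%N) (enum T).
  rewrite {1}/enum_mem -enumT; apply: sorted_filter; first by move=> ? ? ?; exact: ltn_trans.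
  by have := iota_ltn_sorted 0 m; rewrite -val_enum_ord sorted_map.
rewrite -{2}(set_enum T); elim: (enum T) srt => [_|i s IH /= srt].
  by rewrite set_nil imset0 /wprod big_nil form1E.
have is_ k : k \in s -> (i < k)%N.
  by move: srt; rewrite path_sortedE => [/andP[/allP/(_ k)]|? ? ?]; [|exact: ltn_trans].
have ins : i \notin s by apply/negP => /is_; rewrite ltnn.
rewrite wprod_cons IH ?(path_sorted srt) // Jf ext_delta_basis; last first.
  by rewrite mem_imset // inE.
rewrite set_cons imsetU1 /below; set A := finset _.
suff -> : A = set0 by rewrite cards0 scale1r.
apply/setP => k; rewrite !inE; apply/negP => /andP[/imsetP[l]].
by rewrite inE => /is_ il ->; rewrite mf ltnNge (ltnW il).
Qed.

(** An increasing relabelling of coordinates keeps basis monomials sorted, so coefficients are moved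
    without signs. It serves both for the identity and for the bundle projection. *)
Lemma pull_delta m n (J : 'M[R]_(m, n)) (f : 'I_m -> 'I_n) a :
  {mono f : i j / (i < j)%N} -> (forall i, row i J = delta_mx 0 (f i)) ->
  (forall T : {set 'I_m}, pull J a (f @: T) = a T) /\
  (forall S : {set 'I_n}, (exists2 k, k \in S & forall i, f i != k) -> pull J a S = 0).
Proof.
move=> mf Jf.
have E S : pull J a S = \sum_T a T * (S == f @: T)%:R.
  rewrite pullE sum_ffunE; apply: eq_bigr => T _.
  by rewrite (wprod_delta T mf Jf) !ffunE.
have fI : injective f.
  move=> i j fij; apply/eqP; case: (ltngtP i j) => [ij|ij|/val_inj/eqP//].
    by have := ltnn (f i); rewrite {2}fij mf ij.
  by have := ltnn (f j); rewrite -{2}fij mf ij.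
split=> [T|S [k kS fk]].
  rewrite E (bigD1 T) //= eqxx mulr1 big1 ?addr0 // => S ST.
  by rewrite (inj_eq (imset_inj fI)) eq_sym (negPf ST) mulr0.
rewrite E big1 // => T _; case: eqP => [S_|_]; last by rewrite mulr0.
by move: kS; rewrite S_ => /imsetP[i _ ki]; have := fk i; rewrite ki eqxx.
Qed.

Lemma pull1 n (a : form R n) : pull 1%:M a = a.
Proof.
have Jf i : row i (1%:M : 'M[R]_n) = delta_mx 0 (id i) by rewrite row1.
have [H _] := pull_delta a (f := id) (fun _ _ => erefl) Jf.
by apply/ffunP => T; rewrite -{1}(imset_id T) H.
Qed.

Lemma flat_comp_eq0 n (E : 'M[R]_n) a : E \in unitmx -> flat_comp E a = 0 -> a = 0.
Proof.
move=> uE a0; rewrite -[a]pull1 -(mulVmx uE) -pull_pull.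
by rewrite -/(flat_comp E a) a0 pull0.
Qed.

Lemma has_degree_ext n k v (a : form R n) : has_degree k a -> has_degree k.+1 (ext v a).
Proof.
move=> da S Sk; rewrite extE big1 // => i iS; rewrite da ?mulr0 //.
by move: Sk; rewrite (cardsD1 i) iS add1n eqSS.
Qed.

Lemma has_degree_wprod m n (J : 'M[R]_(m, n)) s : has_degree (size s) (wprod J s).
Proof.
elim: s => [|i s IH]; last by rewrite wprod_cons; exact: has_degree_ext.
by move=> S S0; rewrite /wprod big_nil ffunE (negPf S0).
Qed.

Lemma has_degree_pull m n k (J : 'M[R]_(m, n)) a : has_degree k a -> has_degree k (pull J a).
Proof.
move=> da S Sk; rewrite pullE sum_ffunE big1 // => T _; rewrite ffunE.
have [Tk|/da ->] := eqVneq #|T| k; last by rewrite scale0r.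
by rewrite (has_degree_wprod J (s := enum T)) -?cardE ?Tk // [_ *: _]mulr0.
Qed.

Lemma has_degree_one_form n (v : 'rV[R]_n) : has_degree 1 (one_form v).
Proof.
move=> S S1; rewrite ffunE big1 // => i /eqP Si.
by move: S1; rewrite Si cards1.
Qed.

Lemma has_degree_contract n k v (a : form R n) : has_degree k.+1 a -> has_degree k (contract v a).
Proof.
move=> da S Sk; rewrite ffunE big1 // => i iS; rewrite da ?mulr0 //.
by rewrite cardsU1 iS add1n eqSS.
Qed.

(** The contraction kills the coefficients on sets containing [i]; the coefficient of the product on
    a set enlarged by [i] is then, up to sign, [v 0 i] times the remaining one. *)
Lemma contract_ext_eq0 n (i : 'I_n) (v : 'rV[R]_n) (a : form R n) : v 0 i != 0 ->
  contract (delta_mx 0 i) a = 0 -> ext v a = 0 -> a = 0.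
Proof.
move=> vi ca ea.
have aS (S : {set 'I_n}) : i \in S -> a S = 0.
  move=> iS; have /ffunP/(_ (S :\ i)) := ca; rewrite !ffunE.
  rewrite (bigD1 i) /= ?inE ?eqxx // big1 ?addr0 => [|k /andP[_ ki]]; last first.
    by rewrite mxE (negPf ki) !mul0r.
  rewrite mxE !eqxx mul1r setD1K // => /eqP.
  by rewrite mulf_eq0 signr_eq0 /= => /eqP.
apply/ffunP => S; rewrite [RHS]ffunE.
case: (boolP (i \in S)) => iS; first exact: aS.
have /ffunP/(_ (i |: S)) := ea; rewrite extE [RHS]ffunE.
rewrite (bigD1 i) ?setU11 //= big1 ?addr0 => [|k /andP[_ ki]]; last first.
  by rewrite aS ?mulr0 // !inE eqxx eq_sym ki.
rewrite setU1K // => /eqP.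
by rewrite !mulf_eq0 (negPf vi) signr_eq0 /= => /eqP.
Qed.

End Pull.

(** * Clifford modules *)

Section Clifford.
Import mathcomp.boot.finset.
Variables (R : realType) (gam : 'I_11 -> 'M[R]_32).
Hypothesis gamP : clifford_module gam.
Implicit Types (a b : 'I_11) (S T : {set 'I_11}).

Local Notation mon := (clifford_monomial gam).

Lemma gam_comm a b : gam a *m gam b = - (gam b *m gam a) + (2 * eta_mx R 11 a b)%:M.
Proof.
have [H _] := gamP.
by rewrite -(H a b) [gam a *m _ + _]addrC addrA addNr add0r.
Qed.

Lemma gam_sq a : gam a *m gam a = (eta R a)%:M.
Proof.
have [/(_ a a) H _] := gamP; move: H; rewrite -mulr2n -scaler_nat.
rewrite /eta_mx !mxE eqxx mulr1n => /(congr1 ( *:%R (2^-1 : R))).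
by rewrite scalerA mulVf ?pnatr_eq0 // scale1r scale_scalar_mx mulrA mulVf ?pnatr_eq0 // mul1r.
Qed.

Lemma gam_anti a b : a != b -> gam a *m gam b = - (gam b *m gam a).
Proof. by move=> ab; rewrite gam_comm /eta_mx !mxE (negPf ab) mulr0n mulr0 raddf0 addr0. Qed.

Definition gprod (s : seq 'I_11) : 'M[R]_32 := \big[mulmx/1%:M]_(i <- s) gam i.

Lemma gam_gprod a s : gam a *m gprod s = (-1) ^+ count (predC1 a) s *: (gprod s *m gam a).
Proof.
elim: s => [|b s IH]; first by rewrite /gprod big_nil mulmx1 mul1mx scale1r.
rewrite /gprod big_cons -/(gprod s) /= exprD.
have [->|ba] := eqVneq b a.
  by rewrite /= expr0 mul1r -mulmxA [in LHS]IH -scalemxAr.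
rewrite mulmxA gam_anti 1?eq_sym // expr1 mulN1r scaleNr mulNmx -!mulmxA IH.
by rewrite -scalemxAr.
Qed.

Lemma unit_gam a : gam a \in unitmx.
Proof.
have : gam a *m (eta R a *: gam a) = 1%:M.
  by rewrite -scalemxAr gam_sq scale_scalar_mx eta_sq.
by case/mulmx1_unit.
Qed.

Lemma unit_mon S : mon S \in unitmx.
Proof.
rewrite /clifford_monomial; elim: (enum S) => [|i s IH].
  by rewrite big_nil unitmx1.
by rewrite big_cons unitmx_mul unit_gam.
Qed.

(** The parity of the number of factors of the monomial of S that anticommute with [gam a]. *)
Definition par a S : bool := odd #|S :\ a|.

Lemma gam_mon a S : gam a *m mon S = (-1) ^+ par a S *: (mon S *m gam a).
Proof.
rewrite -[mon S]/(gprod (enum S)) gam_gprod -signr_odd; congr ((-1) ^+ _ *: _).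
rewrite /par; congr (odd _); rewrite -size_filter cardE; apply/perm_size/uniq_perm.
- by rewrite filter_uniq // enum_uniq.
- exact: enum_uniq.
- by move=> k; rewrite mem_filter !mem_enum !inE.
Qed.

(* Conjugation by each [gam a] multiplies a monomial by a sign; sorting the
   terms by their signs separates monomials up to complementation. *)
Lemma mon_sign_free (c : {set 'I_11} -> R) : \sum_S c S *: mon S = 0 ->
  forall (l : seq 'I_11) T,
    \sum_(S | all (fun a => par a S == par a T) l) c S *: mon S = 0.
Proof.
move=> c0; elim=> [|a l IH] T; first by rewrite -[RHS]c0; apply: eq_bigl.
set P := fun S => all (fun a => par a S == par a T) l.
have X0 := IH T; rewrite -/P in X0.
have X1 : \sum_(S | P S) ((-1) ^+ par a S * c S) *: mon S = 0.
  have := congr1 (fun M => gam a *m M *m (eta R a *: gam a)) X0.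
  rewrite mulmx0 mul0mx mulmx_sumr mulmx_suml => E; rewrite -[RHS]E.
  apply: eq_bigr => S _; rewrite -[gam a *m (c S *: _)]scalemxAr gam_mon.
  rewrite -scalemxAr -!scalemxAl -mulmxA gam_sq mul_mx_scalar !scalerA; congr (_ *: _).
  have alg (e p q : R) : e * p * q * e = e * e * (q * p) by ring.
  by rewrite alg eta_sq mul1r.
have : \sum_(S | P S) c S *: mon S +
    (-1) ^+ par a T *: \sum_(S | P S) ((-1) ^+ par a S * c S) *: mon S = 0.
  by rewrite X0 X1 scaler0 addr0.
rewrite scaler_sumr -big_split /= (bigID (fun S => par a S == par a T)) /=.
rewrite [X in _ + X]big1 ?addr0; last first.
  move=> S /andP[_]; rewrite scalerA mulrA -signr_addb -scalerDl.
  by case: (par a S); case: (par a T) => //= _; rewrite expr1 mulN1r subrr scale0r.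
rewrite (eq_bigr (fun S => 2 *: (c S *: mon S))); last first.
  move=> S /andP[_ /eqP ->]; rewrite scalerA mulrA -signr_addb addbb mul1r.
  by rewrite -scalerDl scalerA -mulr2n mulr_natl.
rewrite -scaler_sumr => /eqP; rewrite scaler_eq0 pnatr_eq0 /= => /eqP E.
rewrite -[RHS]E; apply: eq_bigl => S /=; by rewrite andbC.
Qed.

(** The parity of the cardinal of S and [par a S] together tell whether [a] is in S. So equal signs
    force either S = T or T the complement of S, and in the second case the cardinals would add up
    to 11. *)
Lemma par_inj S T : (#|S| <= 5)%N -> (#|T| <= 5)%N ->
  (forall a, par a S = par a T) -> S = T.
Proof.
move=> S5 T5 pST.
have cD (A : {set 'I_11}) a : odd #|A| = (a \in A) (+) par a A.
  by rewrite /par (cardsD1 a) oddD; case: (a \in A).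
have [op|op] := eqVneq (odd #|S|) (odd #|T|).
  by apply/setP => a; move: op; rewrite !(cD _ a) pST => /addIb.
have : T = ~: S.
  apply/setP => a; rewrite inE; move: op; rewrite !(cD _ a) pST.
  by case: (a \in S); case: (a \in T); case: (par a T).
move=> TS; have := cardsC S; rewrite -TS card_ord => E.
by have := leq_add S5 T5; rewrite E.
Qed.

(** The restriction to at most five factors is essential: complementary monomials are proportional,
    since the volume element acts as a sign. *)
Lemma mon_free (c : {set 'I_11} -> R) :
  (forall S, (5 < #|S|)%N -> c S = 0) -> \sum_S c S *: mon S = 0 ->
  forall S, c S = 0.
Proof.
move=> c5 c0 T; have [T5|/c5//] := leqP #|T| 5.
(* With the signs of all eleven conjugations fixed, [T] is the only small set that is left in the
   sum. *)
have := mon_sign_free c0 (enum 'I_11) T.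
rewrite (bigD1 T) /=; last by apply/allP => a _.
rewrite big1 ?addr0 => [|S /andP[/allP pS ST]]; last first.
  have [S5|/c5 ->] := leqP #|S| 5; last by rewrite scale0r.
  case/eqP: ST; apply: par_inj => // a; apply/eqP/pS; exact: mem_enum.
move/(congr1 (mulmx (invmx (mon T)))); rewrite -scalemxAr mulVmx ?unit_mon // mulmx0.
move=> /matrixP/(_ 0 0); rewrite !mxE eqxx mulr1; exact.
Qed.

Lemma cliff_free (E : 'M[R]_11) (x y z : R) (a5 a3 a2 : form R 11) :
  E \in unitmx -> x != 0 -> y != 0 -> z != 0 ->
  has_degree 5 a5 -> has_degree 3 a3 -> has_degree 2 a2 ->
  x *: cliff gam E a5 + y *: cliff gam E a3 + z *: cliff gam E a2 = 0 ->
  [/\ a5 = 0, a3 = 0 & a2 = 0].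
Proof.
move=> uE x0 y0 z0 d5 d3 d2 H.
have f5 : has_degree 5 (flat_comp E a5) := has_degree_pull (invmx E) d5.
have f3 : has_degree 3 (flat_comp E a3) := has_degree_pull (invmx E) d3.
have f2 : has_degree 2 (flat_comp E a2) := has_degree_pull (invmx E) d2.
pose c S := x * flat_comp E a5 S + y * flat_comp E a3 S + z * flat_comp E a2 S.
have c0 : forall S, c S = 0.
  apply: mon_free => [S S5|].
    rewrite /c f5 ?f3 ?f2 ?mulr0 ?addr0 //; apply: contraTneq S5 => -> //.
  rewrite -[RHS]H /cliff !scaler_sumr -!big_split; apply: eq_bigr => S _.
  by rewrite /= !scalerA -!scalerDl.
have k0 (k : R) (u : form R 11) : k != 0 -> (forall S, k * u S = 0) -> u = 0.
  move=> k0 ku; apply/ffunP => S; rewrite [RHS]ffunE; apply/eqP.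
  by have /eqP := ku S; rewrite mulf_eq0 (negPf k0).
split; apply: (flat_comp_eq0 uE).
- apply: (k0 x) => // S; have [S5|S5] := eqVneq #|S| 5; last by rewrite f5 // mulr0.
  by have := c0 S; rewrite /c f3 ?f2 ?S5 // !mulr0 !addr0.
- apply: (k0 y) => // S; have [S3|S3] := eqVneq #|S| 3; last by rewrite f3 // mulr0.
  by have := c0 S; rewrite /c f5 ?f2 ?S3 // !mulr0 addr0 add0r.
- apply: (k0 z) => // S; have [S2|S2] := eqVneq #|S| 2; last by rewrite f2 // mulr0.
  by have := c0 S; rewrite /c f5 ?f3 ?S2 // !mulr0 !add0r.
Qed.

(* The spin representation of so(1,10): [W] acts on vectors by [w]. *)
Lemma spin_commutator (w : 'I_11 -> 'I_11 -> R) c :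
  (forall a b, eta R a * w a b = - (eta R b * w b a)) ->
  let W := 4^-1 *: \sum_a \sum_b (eta R a * w a b) *: (gam a *m gam b) in
  W *m gam c - gam c *m W = - \sum_a w c a *: gam a.
Proof.
move=> wT W; pose u a b := eta R a * w a b.
have e a b : (2 * eta_mx R 11 a b)%:M = (2 * eta R a * (a == b)%:R)%:M :> 'M[R]_32.
  by congr (_%:M); rewrite /eta_mx !mxE -mulrA; case: eqP => _; rewrite ?mulr1 ?mulr0.
have comm a b : gam a *m gam b *m gam c - gam c *m (gam a *m gam b) =
    (2 * eta R c) *: ((b == c)%:R *: gam a - (a == c)%:R *: gam b).
  have -> : gam a *m gam b *m gam c =
      - (gam a *m gam c *m gam b) + (2 * eta R c * (b == c)%:R) *: gam a.
    rewrite -mulmxA [gam b *m _]gam_comm e mulmxDr mulmxN mulmxA mul_mx_scalar.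
    by case: eqP => [->//|_]; rewrite !mulr0.
  have -> : gam c *m (gam a *m gam b) =
      - (gam a *m gam c *m gam b) + (2 * eta R c * (a == c)%:R) *: gam b.
    by rewrite mulmxA [gam c *m _]gam_comm e mulmxDl mulNmx mul_scalar_mx eq_sym.
  by rewrite opprD addrACA subrr add0r -!scalerA -!scalerBr.
have -> : W *m gam c - gam c *m W = 4^-1 *: \sum_a \sum_b u a b *:
    ((2 * eta R c) *: ((b == c)%:R *: gam a - (a == c)%:R *: gam b)).
  rewrite /W -scalemxAl -scalemxAr -scalerBr; congr (_ *: _).
  rewrite mulmx_suml mulmx_sumr -sumrB; apply: eq_bigr => a _.
  rewrite mulmx_suml mulmx_sumr -sumrB; apply: eq_bigr => b _.
  by rewrite -scalemxAl -scalemxAr -scalerBr comm.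
have split_sum : \sum_a \sum_b u a b *:
    ((2 * eta R c) *: ((b == c)%:R *: gam a - (a == c)%:R *: gam b)) =
    \sum_a (2 * eta R c * u a c) *: gam a - \sum_b (2 * eta R c * u c b) *: gam b.
  under eq_bigr => a _ do under eq_bigr => b _ do rewrite !scalerBr.
  under eq_bigr => a _ do rewrite sumrB.
  rewrite sumrB; congr (_ - _).
    apply: eq_bigr => a _; rewrite (bigD1 c) //= eqxx scale1r scalerA mulrC big1 ?addr0 // => b /negPf ->.
    by rewrite scale0r !scaler0.
  rewrite exchange_big; apply: eq_bigr => b _.
  rewrite (bigD1 c) //= eqxx scale1r scalerA mulrC big1 ?addr0 // => a /negPf ->.
  by rewrite scale0r !scaler0.
rewrite split_sum -sumrB scaler_sumr -sumrN; apply: eq_bigr => a _.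
rewrite -scalerBl scalerA -[RHS]scaleNr; congr (_ *: _).
have -> : u a c = - u c a by exact: wT.
rewrite /u; have := eta_sq R c; set ec := eta R c; set wc := w c a => ee.
have -> : 4^-1 * (2 * ec * - (ec * wc) - 2 * ec * (ec * wc)) = - ((ec * ec) * wc).
  by field.
by rewrite ee mul1r.
Qed.

Lemma gam_free (c : 'I_11 -> R) : \sum_a c a *: gam a = 0 -> forall a, c a = 0.
Proof.
move=> c0.
pose d (S : {set 'I_11}) : R := \sum_a c a * (S == [set a])%:R.
have mon1 a : mon [set a] = gam a.
  by rewrite /clifford_monomial enum_set1 big_cons big_nil mulmx1.
have d0 : forall S, d S = 0.
  apply: mon_free => [S S5|].
    rewrite /d big1 // => a _; case: eqP => [E|_]; last by rewrite mulr0.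
    by move: S5; rewrite E cards1.
  rewrite -[RHS]c0 /d; under eq_bigr do rewrite scaler_suml.
  rewrite exchange_big; apply: eq_bigr => a _.
  rewrite (bigD1 [set a]) //= eqxx mulr1 mon1 big1 ?addr0 // => S /negPf ->.
  by rewrite mulr0 scale0r.
move=> a; have := d0 [set a]; rewrite /d (bigD1 a) //= eqxx mulr1 big1 ?addr0 // => b ba.
by rewrite (inj_eq set1_inj) eq_sym (negPf ba) mulr0.
Qed.

End Clifford.

(** * Manifolds and smooth fields *)

Section Topology.

Lemma open_cap_preim (T T' : topologicalType) (U : set T) (V : set T') (f : T -> T') :
  open U -> open V -> (forall x, U x -> {for x, continuous f}) ->
  open (U `&` f @^-1` V).
Proof.
move=> oU oV cf; rewrite openE => x [Ux Vfx]; apply: nbhs_and.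
  exact: open_nbhs_nbhs (conj oU Ux).
exact: cf Ux _ (open_nbhs_nbhs (conj oV Vfx)).
Qed.

(** Local constancy makes both the truth set of P in A and its complement in A open. *)
Lemma connected_locally (T : topologicalType) (A P : set T) :
  open A -> connected A ->
  (forall x, A x -> nbhs x [set y | A y -> (P y <-> P x)]) ->
  forall x y, A x -> A y -> P x -> P y.
Proof.
move=> oA cA loc x y Ax Ay Px.
suff : A `&` P = A by move/seteqP => [_ /(_ y Ay)[]].
apply: cA; first by exists x.
- exists (A `&` P); last by rewrite setIA setIid.
  rewrite openE => z [Az Pz]; have := nbhs_and (open_nbhs_nbhs (conj oA Az)) (loc z Az).
  apply: filterS => w [Aw /(_ Aw)[_ /(_ Pz)]].
  by [].
- exists (~` (A `&` ~` P)).
    rewrite closedC openE => z [Az nPz].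
    have := nbhs_and (open_nbhs_nbhs (conj oA Az)) (loc z Az).
    by apply: filterS => w [Aw /(_ Aw)[wz _]]; split=> // /wz.
  apply/seteqP; split=> z [Az]; first by move=> Pz; split=> // -[].
  by move=> nz; split=> //; apply: contrapT => nPz; apply: nz.
Qed.

End Topology.

Section Manifold.
Variables (R : realType) (X : topologicalType) (n : nat) (N : atlas R X n).
Hypothesis mN : manifold N.
Implicit Types i j : idx N.

Lemma open_dom i : open (dom i).
Proof. by have [_ [/(_ i)[]]] := mN. Qed.

Lemma open_coords i : open (coords i).
Proof. by have [_ [/(_ i)[]]] := mN. Qed.

Lemma open_carrier : open (carrier N).
Proof. by have [[]] := mN. Qed.

Lemma chartK i p : dom i p -> param i (chart i p) = p.
Proof. by have [_ [_ + _ _ _]] := mN; apply. Qed.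

Lemma coords_chart i p : dom i p -> coords i (chart i p).
Proof. by exists p. Qed.

Lemma dom_param i x : coords i x -> dom i (param i x).
Proof. by move=> [p ip <-]; rewrite chartK. Qed.

Lemma paramK i x : coords i x -> chart i (param i x) = x.
Proof. by move=> [p ip <-]; rewrite chartK. Qed.

Lemma dom_carrier i p : dom i p -> carrier N p.
Proof. by have [[_ _ _ H] _] := mN; move=> ip; apply/H; exists i. Qed.

Lemma carrier_dom p : carrier N p -> exists i, dom i p.
Proof. by have [[_ _ _ H] _] := mN; move/H. Qed.

Lemma continuous_chart i p : dom i p -> {for p, continuous (chart i)}.
Proof. by have [_ [_ _ + _ _]] := mN; apply. Qed.

Lemma continuous_param i x : coords i x -> {for x, continuous (param i)}.
Proof. by have [_ [_ _ _ + _]] := mN; apply. Qed.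

Lemma smooth_trans i j : smooth_mx_on (overlap i j) (trans i j).
Proof. by have [_ []] := mN. Qed.

Lemma overlapE i j : overlap i j = coords i `&` param i @^-1` (dom j).
Proof.
apply/seteqP; split=> x.
  by move=> [p [ip jp] <-]; split; [exists p|rewrite /preimage /= chartK].
by move=> [[p ip <-]]; rewrite /preimage /= chartK // => jp; exists p.
Qed.

Lemma open_overlap i j : open (overlap i j).
Proof.
rewrite overlapE; apply: open_cap_preim; [exact: open_coords|exact: open_dom|].
exact: continuous_param.
Qed.

Lemma overlap_coords i j x : overlap i j x -> coords i x.
Proof. by rewrite overlapE => -[]. Qed.

Lemma trans_coords i j x : overlap i j x -> coords j (trans i j x).
Proof. by rewrite overlapE => -[_ jp]; exact: coords_chart. Qed.

Lemma overlap_chart i j p : dom i p -> dom j p -> overlap i j (chart i p).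
Proof. by move=> ip jp; exists p. Qed.

Lemma trans_chart i j p : dom i p -> trans i j (chart i p) = chart j p.
Proof. by move=> ip; rewrite /trans chartK. Qed.

Lemma nbhs_chart i p (W : set 'rV[R]_n) : dom i p -> nbhs (chart i p) W ->
  nbhs p (dom i `&` chart i @^-1` W).
Proof.
move=> ip nW; apply: nbhs_and; first exact: open_nbhs_nbhs (conj (open_dom i) ip).
exact: continuous_chart ip _ nW.
Qed.

Lemma coords_ball i x : coords i x -> exists2 r : R, 0 < r & ball x r `<=` coords i.
Proof.
move=> ix; have [r /= r0 rU] := (nbhs_ballP _ _).1 (open_nbhs_nbhs (conj (@open_coords i) ix)).
by exists r.
Qed.

End Manifold.

Section SmoothForms.
Import mathcomp.boot.finset.
Variables (R : realType) (n : nat) (U : set 'rV[R]_n).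
Hypothesis oU : open U.

Lemma smooth_ext p (v : 'rV[R]_n -> 'rV[R]_p) (a : 'rV[R]_n -> form R p) :
  smooth_mx_on U v -> (forall S, smooth_on U (fun x => a x S)) ->
  forall S, smooth_on U (fun x => ext (v x) (a x) S).
Proof.
move=> sv sa S.
apply: (@smooth_eq _ _ U (fun x => \sum_(i in S) v x 0 i * ((-1) ^+ below S i * a x (S :\ i)))) => //.
  by move=> x _; rewrite extE.
apply: smooth_sum => // i _; apply: smoothM => //.
by apply: smoothM => //; exact: smooth_cst.
Qed.

Lemma smooth_wprod m p (J : 'rV[R]_n -> 'M[R]_(m, p)) s : smooth_mx_on U J ->
  forall S, smooth_on U (fun x => wprod (J x) s S).
Proof.
move=> sJ; elim: s => [|i s IH] S.
  apply: smooth_eq (@smooth_cst _ _ U (form1 R p S)) => // x _.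
  by rewrite /wprod big_nil.
apply: (@smooth_eq _ _ U (fun x => ext (row i (J x)) (wprod (J x) s) S)) => //.
  by move=> x _; rewrite wprod_cons.
apply: smooth_ext => // a b; apply: smooth_eq (sJ i b) => // x _.
by rewrite mxE.
Qed.

Lemma smooth_pull m p (J : 'rV[R]_n -> 'M[R]_(m, p)) (a : 'rV[R]_n -> form R m) :
  smooth_mx_on U J -> (forall S, smooth_on U (fun x => a x S)) ->
  forall S, smooth_on U (fun x => pull (J x) (a x) S).
Proof.
move=> sJ sa S.
apply: (@smooth_eq _ _ U (fun x => \sum_(T : {set 'I_m}) a x T * wprod (J x) (enum T) S)) => //.
  by move=> x _; rewrite pullE sum_ffunE; apply: eq_bigr => T _; rewrite ffunE.
by apply: smooth_sum => // T _; apply: smoothM => //; exact: smooth_wprod.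
Qed.

Lemma smooth_contract (v : 'rV[R]_n) (a : 'rV[R]_n -> form R n) :
  (forall S, smooth_on U (fun x => a x S)) ->
  forall S, smooth_on U (fun x => contract v (a x) S).
Proof.
move=> sa S.
apply: (@smooth_eq _ _ U (fun x => \sum_(i < n | i \notin S)
     v 0 i * (-1) ^+ #|[set j in S | (j < i)%N]%SET| * a x (i |: S)%SET)) => //.
  by move=> x _; rewrite ffunE.
by apply: smooth_sum => // i _; apply: smoothM => //; exact: smooth_cst.
Qed.

Lemma smooth_mx_lin q r (I : Type) (s : seq I) (P : pred I)
    (c : I -> 'rV[R]_n -> R) (A : I -> 'M[R]_(q, r)) :
  (forall i, P i -> smooth_on U (c i)) ->
  smooth_mx_on U (fun x => \sum_(i <- s | P i) c i x *: A i).
Proof.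
move=> sc a b.
apply: (@smooth_eq _ _ U (fun x => \sum_(i <- s | P i) c i x * A i a b)) => //.
  by move=> x _; rewrite summxE; apply: eq_bigr => i _; rewrite mxE.
by apply: smooth_sum => // i Pi; apply: smoothM => //; [exact: sc|exact: smooth_cst].
Qed.

Lemma smooth_mxD q r (A B : 'rV[R]_n -> 'M[R]_(q, r)) :
  smooth_mx_on U A -> smooth_mx_on U B -> smooth_mx_on U (fun x => A x + B x).
Proof.
move=> sA sB a b; apply: smooth_eq (smoothD oU (sA a b) (sB a b)) => // x _.
by rewrite mxE.
Qed.

Lemma smooth_mxZ q r (k : R) (A : 'rV[R]_n -> 'M[R]_(q, r)) :
  smooth_mx_on U A -> smooth_mx_on U (fun x => k *: A x).
Proof.
move=> sA a b; apply: smooth_eq (smoothM oU (@smooth_cst _ _ U k) (sA a b)) => // x _.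
by rewrite mxE.
Qed.

End SmoothForms.

Lemma smooth_cliff (R : realType) (gam : 'I_11 -> 'M[R]_32) (U : set 'rV[R]_11)
    (E : 'rV[R]_11 -> 'M[R]_11) (a : 'rV[R]_11 -> form R 11) : open U ->
  smooth_mx_on U E -> (forall x, U x -> E x \in unitmx) ->
  (forall S, smooth_on U (fun x => a x S)) ->
  smooth_mx_on U (fun x => cliff gam (E x) (a x)).
Proof.
move=> oU sE uE sa; apply: smooth_mx_lin => // S _.
by apply: smooth_pull => //; exact: smooth_invmx.
Qed.

(** * Local uniqueness for linear first order systems *)

Section LocalUniqueness.
Variables (R : realType) (n k : nat) (U : set 'rV[R]_n).
Hypothesis oU : open U.

(** Compactness of a smaller ball bounds the coefficients and the solution; shrinking the radius
    further meets the smallness condition of [local_uniqueness]. *)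
Lemma linear_system_zero (B : 'I_n -> 'rV[R]_n -> 'M[R]_k) (u : 'rV[R]_n -> 'cV[R]_k) x :
  (forall l, smooth_mx_on U (B l)) -> smooth_mx_on U u ->
  (forall l y, U y -> pmx l u y = B l y *m u y) ->
  U x -> u x = 0 ->
  exists2 r : R, 0 < r & forall y, ball x r y -> U y /\ u y = 0.
Proof.
move=> sB su du Ux ux.
have [r1 /= r10 r1U] := (nbhs_ballP _ _).1 (open_nbhs_nbhs (conj oU Ux)).
have r20 : 0 < r1 / 2 by rewrite divr_gt0.
have r21 : r1 / 2 < r1 by rewrite ltr_pdivrMr // ltr_pMr // ltr1n.
have cB t z : ball x r1 z -> {for z, continuous (fun z => B t.1.1 z t.1.2 t.2)}.
  by move=> /r1U Uz; exact: smooth_cont (sB t.1.1 t.1.2 t.2) Uz.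
have cu t z : ball x r1 z -> {for z, continuous (fun z => u z t 0)}.
  by move=> /r1U Uz; exact: smooth_cont (su t 0) Uz.
have bB (t : 'I_n * 'I_k * 'I_k) := compact_bound r20 r21 (cB t).
have bu (t : 'I_k) := compact_bound r20 r21 (cu t).
pose C := \sum_t s2val (cid2 (bB t)).
pose M := \sum_t s2val (cid2 (bu t)).
have C0 : 0 <= C by apply: sumr_ge0 => t _; case: cid2.
have M0 : 0 <= M by apply: sumr_ge0 => t _; case: cid2.
have BC l a b z : ball x (r1 / 2) z -> `|B l z a b| <= C.
  move=> xz; rewrite /C (bigD1 (l, a, b)) //= ler_wpDr //.
    by apply: sumr_ge0 => t _; case: cid2.
  by case: cid2 => m /= _; apply.
have uM a z : ball x (r1 / 2) z -> `|u z a 0| <= M.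
  move=> xz; rewrite /M (bigD1 a) //= ler_wpDr //.
    by apply: sumr_ge0 => t _; case: cid2.
  by case: cid2 => m /= _; apply.
pose r := Num.min (r1 / 2) (2^-1 / (C * k%:R * n%:R + 1)).
have den0 : 0 < C * k%:R * n%:R + 1 by rewrite ltr_wpDl // !mulr_ge0.
have r0 : 0 < r by rewrite lt_min r20 !divr_gt0.
have small : C * k%:R * r * n%:R <= 2^-1.
  have alg (p q s t : R) : p * q * s * t = s * (p * q * t) by ring.
  rewrite alg.
  apply: (@le_trans _ _ (2^-1 / (C * k%:R * n%:R + 1) * (C * k%:R * n%:R + 1))).
    by apply: ler_pM; rewrite ?mulr_ge0 ?(ltW r0) // ?ge_min ?lexx ?orbT // lerDl.
  by rewrite divfK // lt0r_neq0.
have sub z : ball x r z -> ball x (r1 / 2) z by apply: le_ball; rewrite ge_min lexx.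
have rU z : ball x r z -> U z.
  by move=> /sub zr; apply: r1U; apply: le_ball zr; exact: ltW.
exists r => // y xy; split; first exact: rU.
apply/matrixP => a b; rewrite (ord1 b) mxE.
apply: (@local_uniqueness _ _ _ (fun a z => u z a 0) x r C M r0 C0 M0 small) => //.
  move=> z xz c; split; first exact: uM (sub z xz).
  move=> l; split; first exact: smooth_derivable (su c 0) (rU z xz).
  have -> : partial l (fun z => u z c 0) z = (B l z *m u z) c 0.
    by rewrite -du ?pmxE //; exact: rU.
  rewrite mxE; apply: (le_trans (ler_norm_sum _ _ _)).
  rewrite mulr_sumr; apply: ler_sum => d _; rewrite normrM.
  by apply: ler_wpM2r => //; exact: BC (sub z xz).
by move=> c; rewrite ux mxE.
Qed.

End LocalUniqueness.

(** * Killing spinors *)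

Section Killing.
Variables (R : realType) (gam : 'I_11 -> 'M[R]_32).
Variables (Y : topologicalType) (M : atlas R Y 11).
Variables (g : idx M -> 'rV[R]_11 -> 'M[R]_11).
Variables (F : idx M -> 'rV[R]_11 -> form R 11).
Variable (sp : spin_data R (idx M) Y).
Hypothesis bg : sugra_background gam g F sp.
Implicit Types (j k : idx M) (y v : 'rV[R]_11).

Let mM : manifold M. Proof. by have [] := bg. Qed.
Let oc j : open (coords j). Proof. exact: open_coords. Qed.
Let sE j : smooth_mx_on (coords j) (coframe sp j).
Proof. by have [_ _ [[]]] := bg. Qed.

Lemma background_smooth_metric j : smooth_mx_on (coords j) (g j).
Proof. by have [_ [_ +] _ _ _] := bg => + _; apply. Qed.

Lemma background_metric_unit j y : coords j y -> g j y \in unitmx.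
Proof.
by have [_ [+ _ _] _ _ _] := bg => + jy; move=> /(_ j y jy)/lorentzian_unit.
Qed.

Lemma background_metric_sym j y : coords j y -> (g j y)^T = g j y.
Proof.
by have [_ [+ _ _] _ _ _] := bg => + jy; move=> /(_ j y jy)/lorentzian_sym.
Qed.

Lemma background_coframe_unit j y : coords j y -> coframe sp j y \in unitmx.
Proof. by have [_ _ [[_ + _] _] _ _] := bg => + jy; move=> /(_ j y jy)[]. Qed.

Lemma background_coframe_metric j y : coords j y ->
  g j y = (coframe sp j y)^T *m eta_mx R 11 *m coframe sp j y.
Proof. by have [_ _ [[_ + _] _] _ _] := bg => + jy; move=> /(_ j y jy)[]. Qed.

Lemma smooth_flat_one_form j v :
  smooth_mx_on (coords j) (fun y => v *m g j y).
Proof.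
apply: smooth_mxM => //; first exact: smooth_mx_cst.
exact: background_smooth_metric.
Qed.

Lemma smooth_Omega j v : smooth_mx_on (coords j) (fun y => Omega gam g F sp j y v).
Proof.
have [_ _ _ [_ sF _] _] := bg.
apply: smooth_mxD => //.
  apply: smooth_mxZ => //; apply: smooth_cliff => //; first exact: background_coframe_unit.
  by apply: smooth_ext => //; [exact: smooth_flat_one_form|exact: sF].
apply: (@smooth_mx_eq _ _ _ _ _ (fun y => (- 6^-1) *: cliff gam (coframe sp j y)
    (contract v (F j y)))) => //.
  by move=> y _; rewrite scaleNr.
apply: smooth_mxZ => //; apply: smooth_cliff => //; first exact: background_coframe_unit.
by apply: smooth_contract => //; exact: sF.
Qed.

Lemma smooth_spin_coef j a b mu : smooth_on (coords j) (fun y => spin_coef g sp j y a b mu).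
Proof.
have sV : smooth_mx_on (coords j) (fun z => invmx (coframe sp j z)).
  by apply: smooth_invmx => //; exact: background_coframe_unit.
apply: smooth_sum => // r _; apply: smoothM => //; first exact: sE.
apply: smoothD => //; first by apply: smooth_partial; exact: sV.
apply: smooth_sum => // s _; apply: smoothM => //.
apply: smooth_christoffel => //; [exact: background_smooth_metric|exact: background_metric_unit].
Qed.

Definition spin_form j l y : 'M[R]_32 :=
  4^-1 *: (\sum_(a < 11) \sum_(b < 11)
     (eta R a * spin_coef g sp j y a b l) *: (gam a *m gam b)).

(** The Killing equation solved for the partial derivatives: each of them is this matrix applied to
    the spinor. *)
Definition killing_mx j l y : 'M[R]_32 :=
  Omega gam g F sp j y (delta_mx 0 l) - spin_form j l y.

Lemma smooth_spin_form j l : smooth_mx_on (coords j) (spin_form j l).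
Proof.
apply: smooth_mxZ => //.
apply: (@smooth_mx_eq _ _ _ _ _ (fun y => \sum_(p : 'I_11 * 'I_11)
  (eta R p.1 * spin_coef g sp j y p.1 p.2 l) *: (gam p.1 *m gam p.2))) => //.
  by move=> y _; rewrite pair_bigA.
apply: smooth_mx_lin => // p _; apply: smoothM => //; first exact: smooth_cst.
exact: smooth_spin_coef.
Qed.

Lemma smooth_killing_mx j l : smooth_mx_on (coords j) (killing_mx j l).
Proof.
apply: smooth_mxD => //; first exact: smooth_Omega.
apply: (@smooth_mx_eq _ _ _ _ _ (fun y => (-1) *: spin_form j l y)) => //.
  by move=> y _; rewrite scaleN1r.
by apply: smooth_mxZ => //; exact: smooth_spin_form.
Qed.

Lemma spin_nabla_delta j (eps : 'rV[R]_11 -> 'cV[R]_32) y l :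
  spin_nabla gam g sp j eps y (delta_mx 0 l) = pmx l eps y + spin_form j l y *m eps y.
Proof.
rewrite /spin_nabla; congr (_ + _).
  by apply/matrixP => a b; rewrite !mxE pmxE (ord1 b).
congr (_ *m _); congr (_ *: _); apply: eq_bigr => a _; apply: eq_bigr => b _.
rewrite (bigD1 l) //= big1 ?addr0; last first.
  by move=> m ml; rewrite mxE eqxx (negbTE ml) !mul0r scale0r.
by rewrite mxE !eqxx mul1r.
Qed.

(** Matrices with p columns treat alike a single spinor, a family of 32 of them, and their linear
    combinations. *)
Definition parallel_section p (eps : idx M -> 'rV[R]_11 -> 'M[R]_(32, p)) : Prop :=
  [/\ forall j, smooth_mx_on (coords j) (eps j),
      forall j k m, (dom j `&` dom k) m ->
        eps k (chart k m) = strans sp j k m *m eps j (chart j m) &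
      forall j l y, coords j y -> pmx l (eps j) y = killing_mx j l y *m eps j y].

Lemma killing_parallel eps : killing_spinor gam g F sp eps -> parallel_section eps.
Proof.
move=> epsK; split; [exact: epsK.1.1|exact: epsK.1.2|] => j l y jy.
have := epsK.2 j y jy (delta_mx 0 l).
rewrite /supercov spin_nabla_delta /killing_mx.
set W := Omega _ _ _ _ _ _ _; set S := spin_form _ _ _; move: W S => W S /eqP.
by rewrite mulmxBl subr_eq add0r => /eqP <-; rewrite addrK.
Qed.

Lemma parallel_sectionM p q (psi : idx M -> 'rV[R]_11 -> 'M[R]_(32, p)) (C : 'M[R]_(p, q)) :
  parallel_section psi -> parallel_section (fun j y => psi j y *m C).
Proof.
move=> [spsi tpsi dpsi]; have sC j := @smooth_mx_cst R 11 p q (coords j) C.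
split=> [j|j k m jkm|j l y jy].
- by apply: smooth_mxM => //; exact: open_coords.
- by rewrite (tpsi j) // mulmxA.
- by rewrite (pmxM _ jy (spsi j) (sC j)) pmx_cst mulmx0 addr0 dpsi // mulmxA.
Qed.

Lemma parallel_section_cols p (b : 'I_p -> idx M -> 'rV[R]_11 -> 'cV[R]_32) :
  (forall a, parallel_section (b a)) ->
  parallel_section (fun j y => \matrix_(c < 32, a < p) b a j y c 0).
Proof.
move=> bP; split=> [j|j k m jkm|j l y jy].
- move=> c a; have [sb _ _] := bP a.
  by apply: smooth_eq (sb j c 0); [exact: open_coords|move=> z _; rewrite mxE].
- apply/matrixP => c a; have [_ tb _] := bP a; rewrite mxE (tb j) // !mxE.
  by apply: eq_bigr => d _; rewrite mxE.
- apply/matrixP => c a; have [_ _ db] := bP a; rewrite pmxE.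
  have /matrixP/(_ c 0) := db j l y jy; rewrite pmxE !mxE.
  move=> H; transitivity (partial l (fun z => b a j z c 0) y).
    by congr (partial _ _ _); apply/funext => z; rewrite mxE.
  by rewrite H; apply: eq_bigr => d _; congr (_ * _); rewrite mxE.
Qed.

Section ZeroSet.
Variable eps : idx M -> 'rV[R]_11 -> 'cV[R]_32.
Hypothesis epsP : parallel_section eps.

Let killing_smooth j : smooth_mx_on (coords j) (eps j).
Proof. by have [] := epsP. Qed.

Let killing_trans j k m : (dom j `&` dom k) m ->
  eps k (chart k m) = strans sp j k m *m eps j (chart j m).
Proof. by have [_ + _] := epsP; apply. Qed.

Let killing_pde j l y : coords j y -> pmx l (eps j) y = killing_mx j l y *m eps j y.
Proof. by have [_ _] := epsP; apply. Qed.

Definition zero_at m := forall j, dom j m -> eps j (chart j m) = 0.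

Lemma zero_at_chart j m : dom j m -> zero_at m <-> eps j (chart j m) = 0.
Proof.
move=> jm; split; first exact.
by move=> e0 k km; rewrite (@killing_trans j k m) // e0 mulmx0.
Qed.

(** A zero propagates by uniqueness for the linear system, a nonzero component persists by
    continuity. *)
Lemma zero_at_locally m : carrier M m ->
  nbhs m [set m' | carrier M m' /\ (zero_at m' <-> zero_at m)].
Proof.
move=> /(carrier_dom mM)[j jm]; have jy := coords_chart jm.
case: (pselect (zero_at m)) => [Zm|nZ].
  have e0 := (zero_at_chart jm).1 Zm.
  have [r r0 H] := @linear_system_zero _ _ _ _ (oc (j:=j)) _ _ _ (@smooth_killing_mx j)
    (@killing_smooth j) (fun l y jy => killing_pde l jy) jy e0.
  have := nbhs_chart mM jm (nbhsx_ballx (chart j m) r r0).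
  apply: filterS => m' [jm' /H[_ e0']]; split; first exact: dom_carrier jm'.
  by split=> // _; apply/(zero_at_chart jm').
have [a ea] : exists a, eps j (chart j m) a 0 != 0.
  apply: contrapT => /forallNP H; apply: nZ; apply/(zero_at_chart jm).
  apply/matrixP => a b; rewrite (ord1 b) mxE; apply/eqP/negPn/negP.
  exact: H.
have ca := smooth_cont (@killing_smooth j a 0) jy.
have nb : nbhs (chart j m) [set y | eps j y a 0 != 0].
  apply: (ca [set c | c != 0]); apply: open_nbhs_nbhs; split=> //; exact: open_neq.
have := nbhs_chart mM jm nb.
apply: filterS => m' [jm' /eqP ne]; split; first exact: dom_carrier jm'.
by split=> // /(zero_at_chart jm') e0; case: ne; rewrite e0 mxE.
Qed.

End ZeroSet.

(** * Flatness from a frame of spinors parallel for the spin connection *)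

Section Flatness.
Variables (j : idx M) (psi : 'rV[R]_11 -> 'M[R]_32).
Hypothesis gamP : clifford_module gam.
Hypothesis spsi : smooth_mx_on (coords j) psi.
Hypothesis upsi : forall y, coords j y -> psi y \in unitmx.
Hypothesis dpsi : forall l y, coords j y -> pmx l psi y = - (spin_form j l y *m psi y).

Let V z : 'M[R]_11 := invmx (coframe sp j z).
Let sV : smooth_mx_on (coords j) V.
Proof. by apply: smooth_invmx => //; exact: background_coframe_unit. Qed.

(** The covariant derivatives of the frame vectors, which are the columns of [V]; multiplying by the
    coframe gives the connection coefficients. *)
Let dV l y : 'M[R]_11 := pmx l V y + gamma (g j) l y *m V y.

Let spin_mx l y : 'M[R]_11 := \matrix_(a, b) spin_coef g sp j y a b l.

Let spin_mxE l y : spin_mx l y = coframe sp j y *m dV l y.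
Proof.
apply/matrixP => a b; rewrite mxE [RHS]mxE; apply: eq_bigr => r _.
rewrite [in RHS]mxE pmxE; congr (_ * (_ + _)).
by rewrite [RHS]mxE; apply: eq_bigr => s _; rewrite mxE.
Qed.

Let eta_frame y : coords j y -> (V y)^T *m g j y *m V y = eta_mx R 11.
Proof.
move=> jy; have uE := background_coframe_unit jy.
by rewrite background_coframe_metric // !mulmxA -trmx_mul mulmxV // trmx1 mul1mx -mulmxA mulmxV // mulmx1.
Qed.

(** Differentiate the constant matrix V^T g V = eta and use metric compatibility. *)
Lemma spin_coef_antisym l y a b : coords j y ->
  eta R a * spin_coef g sp j y a b l = - (eta R b * spin_coef g sp j y b a l).
Proof.
move=> jy; have uE := background_coframe_unit jy.
have eE c d : eta R c * spin_coef g sp j y c d l = ((V y)^T *m g j y *m dV l y) c d.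
  have -> : (V y)^T *m g j y *m dV l y = eta_mx R 11 *m spin_mx l y.
    by rewrite spin_mxE -(eta_frame jy) -!mulmxA [V y *m _]mulmxA mulVmx // mul1mx.
  by rewrite mul_diag_mx !mxE.
have sg := @background_smooth_metric j.
have H : pmx l (fun z => (V z)^T *m g j z *m V z) y = 0.
  by rewrite (pmx_eq_on _ _ jy eta_frame) // pmx_cst.
have sVT : smooth_mx_on (coords j) (fun z => (V z)^T) by exact: smooth_tr.
have sVg : smooth_mx_on (coords j) (fun z => (V z)^T *m g j z) by exact: smooth_mxM.
move: H; rewrite (pmxM _ jy sVg sV) (pmxM _ jy sVT sg) pmx_tr.
have ug := @background_metric_unit j; have gT := @background_metric_sym j.
rewrite (@metric_compat _ _ _ (g j) (oc (j:=j)) ug gT y l jy).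
move=> H; apply/eqP; rewrite -addr_eq0 !eE; apply/eqP.
have -> : ((V y)^T *m g j y *m dV l y) b a = ((dV l y)^T *m g j y *m V y) a b.
  have -> : (dV l y)^T *m g j y *m V y = ((V y)^T *m g j y *m dV l y)^T.
    by rewrite !trmx_mul trmxK gT // mulmxA.
  by rewrite [RHS]mxE.
move/matrixP/(_ a b): H; rewrite [RHS]mxE => <-.
have -> : (dV l y)^T = (pmx l V y)^T + (V y)^T *m (gamma (g j) l y)^T.
  by rewrite -trmx_mul; apply/matrixP => c d; rewrite !mxE.
rewrite /dV; transitivity (((V y)^T *m g j y *m (pmx l V y + gamma (g j) l y *m V y)
  + ((pmx l V y)^T + (V y)^T *m (gamma (g j) l y)^T) *m g j y *m V y) a b); first by rewrite [RHS]mxE.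
congr (fun_of_matrix _ _ _).
rewrite !mulmxDl !mulmxDr !mulmxA !mulmxDl addrC -!addrA.
by congr (_ + (_ + _)); rewrite addrC.
Qed.

(* The entries of [psi^-1 gam_c psi] are the components, in the frame dual to
   the coframe, of parallel vector fields. *)
Lemma killing_flat y : coords j y -> forall r s m (k : 'I_11), riemann (g j) y r s m k = 0.
Proof.
move=> jy.
have [Th ThE] : exists Th : 'I_11 -> 'rV[R]_11 -> 'M[R]_32,
  forall c, Th c = fun z => invmx (psi z) *m gam c *m psi z by eexists.
(* Each column of [T t] collects, over c, one fixed entry of the eleven matrices [Th c]; [V]
   converts it from frame components to coordinate components. *)
pose T (t : 'I_32) z : 'M[R]_(11, 32) := \matrix_(c, q) Th c z t q.
have siV : smooth_mx_on (coords j) (fun z => invmx (psi z)) by exact: smooth_invmx.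
have sgc c : smooth_mx_on (coords j) (fun z => invmx (psi z) *m gam c).
  by apply: smooth_mxM => //; exact: smooth_mx_cst.
have sTh c : smooth_mx_on (coords j) (Th c) by rewrite ThE; exact: smooth_mxM.
have sT t : smooth_mx_on (coords j) (T t).
  by move=> c q; apply: smooth_eq (sTh c t q) => // z _; rewrite [RHS]mxE.
have dTh c l z : coords j z ->
    pmx l (Th c) z = - \sum_a spin_coef g sp j z c a l *: Th a z.
  move=> jz; rewrite ThE (pmxM _ jz (sgc c) spsi).
  rewrite (pmxM _ jz siV (@smooth_mx_cst _ _ _ _ _ (gam c))) pmx_cst mulmx0 addr0.
  rewrite (pmx_invmx _ _ jz upsi spsi) // dpsi // mulmxN !mulNmx opprK mulmxN.
  set W := spin_form j l z; rewrite !mulmxA mulmxK ?upsi //.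
  (* The commutator with the spin connection acts on the index c only, by the connection
     coefficients, and these are what parallelism of the vector fields requires. *)
  have := @spin_commutator _ _ gamP (fun a b => spin_coef g sp j z a b l) c
    (fun a b => spin_coef_antisym l a b jz).
  rewrite -[4^-1 *: _]/W => C.
  transitivity (invmx (psi z) *m (W *m gam c - gam c *m W) *m psi z).
    by rewrite mulmxBr mulmxBl !mulmxA.
  rewrite C mulmxN mulNmx mulmx_sumr mulmx_suml; congr (- _).
  by apply: eq_bigr => a _; rewrite ThE -scalemxAr -scalemxAl.
have dT t l z : coords j z -> pmx l (T t) z = - (spin_mx l z *m T t z).
  move=> jz; apply/matrixP => c q; rewrite pmxE.
  transitivity (pmx l (Th c) z t q).
    by rewrite pmxE; congr (partial _ _ _); apply/funext => x; rewrite mxE.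
  rewrite dTh // !mxE summxE; congr (- _); apply: eq_bigr => a _.
  by rewrite !mxE.
apply: (@flat_of_parallel _ _ _ (g j) (oc (j:=j)) (@background_smooth_metric j) (@background_metric_unit j) 'I_32 32
  (fun t z => V z *m T t z)) => //.
- by move=> t; exact: smooth_mxM.
- move=> t l z jz; have uE := background_coframe_unit jz.
  rewrite (pmxM _ jz sV (sT t)) dT // spin_mxE mulmxN !mulmxA mulVmx // mul1mx.
  by rewrite /dV mulmxDl opprD addrA subrr add0r.
move=> w wQ; have uE := background_coframe_unit jy.
suff v0 : w *m V y = 0 by rewrite -[w](mulmxK uE) -mulmxA; rewrite -[w in LHS]mulmx1 -(mulVmx uE) !mulmxA v0 !mul0mx.
(* A covector that annihilates all the fields gives a vanishing combination of the [Th c]; undoing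
   the conjugation, the [gam c] would be dependent. *)
have Z : \sum_c (w *m V y) 0 c *: gam c = 0.
  suff Z' : \sum_c (w *m V y) 0 c *: Th c y = 0.
    have Z2 : invmx (psi y) *m (\sum_c (w *m V y) 0 c *: gam c) *m psi y =
        \sum_c (w *m V y) 0 c *: Th c y; last first.
      by rewrite -[LHS](mulKVmx (upsi jy)) -[invmx _ *m _](mulmxK (upsi jy)) Z2 Z' mul0mx mulmx0.
    by rewrite mulmx_sumr mulmx_suml; apply: eq_bigr => c _; rewrite ThE -scalemxAr -scalemxAl.
  apply/matrixP => t q; move: (wQ t); rewrite mulmxA => /matrixP/(_ 0 q).
  rewrite [LHS]mxE [RHS]mxE => H; rewrite [RHS]mxE -[RHS]H summxE.
  apply: eq_bigr => c _; rewrite [LHS]mxE.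
  by congr (_ * _); rewrite [RHS]mxE.
by apply/rowP => c; rewrite (gam_free gamP Z) mxE.
Qed.

End Flatness.

End Killing.

(** * Lifting from the base to the total space *)

Section Bundle.
Variables (R : realType) (X : topologicalType) (N : atlas R X 10) (K : kk_space N).
Hypotheses (mN : manifold N) (mM : manifold (tot K)) (pK : principal_bundle K).

Lemma base_row (x : 'rV[R]_10) (t : 'rV[R]_1) : base_coord (row_mx x t) = x.
Proof. exact: row_mxKl. Qed.

Lemma bundle_under (j : idx (tot K)) m : dom j m -> dom (under K j) (proj K m).
Proof. by have [[_ _ H] _] := pK; move=> /H[]. Qed.

Lemma bundle_base (j : idx (tot K)) m : dom j m ->
  base_coord (chart j m) = chart (under K j) (proj K m).
Proof. by have [[_ _ H] _] := pK; move=> /H[]. Qed.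

Lemma coords_base (j : idx (tot K)) y : coords j y -> coords (under K j) (base_coord y).
Proof.
by move=> [m jm <-]; rewrite bundle_base //; apply: coords_chart; exact: bundle_under.
Qed.

(** Freezing the fibre coordinate lifts a ball of the base into the ball of the same radius
    upstairs, since the norm is the sup norm. *)
Lemma ball_row_mx (y : 'rV[R]_11) (x : 'rV[R]_10) r : 0 < r ->
  ball (base_coord y) r x -> ball y r (row_mx x (rsubmx (y : 'rV[R]_(10+1))) : 'rV[R]_11).
Proof.
move=> r0 [_ bx]; split=> // a b.
case: (@splitP 10 1 b) => k bk.
  have -> : b = @lshift 10 1 k by apply: val_inj.
  rewrite (@row_mxEl _ _ 10 1).
  by have := bx a k; rewrite /base_coord mxE.
have -> : b = @rshift 10 1 k by apply: val_inj.
rewrite (@row_mxEr _ _ 10 1) mxE.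
exact: ballxx.
Qed.

Lemma proj_open m (W : set (tot_type K)) : carrier (tot K) m -> nbhs m W ->
  nbhs (proj K m) (proj K @` (carrier (tot K) `&` W)).
Proof.
move=> /(carrier_dom mM)[j jm] nW; have jy := coords_chart jm.
have nP : nbhs (chart j m) (coords j `&` param j @^-1` W).
  apply: nbhs_and; first by apply: open_nbhs_nbhs; split=> //; exact: open_coords.
  by apply: (continuous_param mM jy); rewrite chartK.
have [r /= r0 rW] := (nbhs_ballP _ _).1 nP.
have im := bundle_under jm.
have := nbhs_chart mN im (nbhsx_ballx (chart (under K j) (proj K m)) r r0).
apply: filterS => q [iq bq].
pose y' : 'rV[R]_11 := row_mx (chart (under K j) q) (rsubmx (chart j m : 'rV[R]_(10+1))).
have [jy' Wy'] : (coords j `&` param j @^-1` W) y'.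
  by apply: rW; apply: ball_row_mx => //; rewrite bundle_base.
have jm' := dom_param mM jy'.
exists (param j y'); first by split=> //; exact: dom_carrier jm'.
rewrite -(chartK mN (bundle_under jm')) -bundle_base // paramK // base_row.
exact: chartK.
Qed.

(** The fibres are images of the real line under a continuous action, so Z is constant on them. It
    then descends to a locally constant predicate on the base, because the projection is open. *)
Lemma bundle_locally_constant (Z : set (tot_type K)) : connected (carrier N) ->
  (forall m, carrier (tot K) m ->
     nbhs m [set m' | carrier (tot K) m' /\ (Z m' <-> Z m)]) ->
  forall m m', carrier (tot K) m -> carrier (tot K) m' -> Z m -> Z m'.
Proof.
move=> cN locZ; have [[pN sN _] [[actM cact act0 actD] [fib _ _]]] := pK.
have fibZ m m' : carrier (tot K) m -> carrier (tot K) m' ->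
    proj K m = proj K m' -> Z m -> Z m'.
  move=> Mm Mm' /(fib m m' Mm Mm')[s <-] Zm.
  have P0 : Z (act K 0 m) by rewrite act0.
  apply: (@connected_locally R setT (fun s => Z (act K s m)) openT _ _ 0 s I I P0).
    exact/connected_intervalP.
  move=> t _; have cm : {for t, continuous (fun t : R => act K t m)}.
    move=> V nV; have ct : {for (t, m), continuous (fun z : R * tot_type K => act K z.1 z.2)}.
      exact: cact.
    have := ct V nV; case=> -[A B] /= [nA nB] AB.
    apply: filterS nA => u Au; apply: (AB (u, m)); split=> //=.
    exact: nbhs_singleton nB.
  have : nbhs t ((fun u : R => act K u m) @^-1` _) := cm _ (locZ _ (actM t m Mm)).
  by apply: filterS => u [_ ?] _.
(* The descended predicate asks for Z on the whole fibre, which is the same as Z at one point of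
   it. *)
have QZ m : carrier (tot K) m ->
    (forall m', carrier (tot K) m' -> proj K m' = proj K m -> Z m') <-> Z m.
  move=> Mm; split; first exact.
  by move=> Zm m' Mm' e; exact: (fibZ m m' Mm Mm' (esym e)).
move=> m m' Mm Mm' Zm; apply/(QZ m' Mm').
apply: (@connected_locally X (carrier N)
  (fun p => forall m', carrier (tot K) m' -> proj K m' = p -> Z m')
  (open_carrier mN) cN _ (proj K m) (proj K m')) => //; [|exact: pN|exact: pN|].
  move=> p Np; have [n Mn np] := sN p Np.
  have := proj_open Mn (locZ n Mn); rewrite np.
  apply: filterS => q [n' [Mn' [_ Zn']] <-] _; rewrite -np.
  by rewrite (QZ n' Mn') (QZ n Mn).
exact/(QZ m Mm).
Qed.

End Bundle.

(** * Kaluza-Klein fields *)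

Section Split11.
Import mathcomp.boot.finset.
Local Open Scope set_scope.
Variable R : realType.

Definition up (i : 'I_10) : 'I_11 := lshift 1 i.

Lemma up_mono : {mono up : i j / (i < j)%N}.
Proof. by []. Qed.

Lemma up_inj : injective up.
Proof. exact: lshift_inj. Qed.

Lemma up_max i : up i != ord_max.
Proof. by rewrite -val_eqE /= neq_ltn ltn_ord. Qed.

Lemma upP (k : 'I_11) : k = ord_max \/ exists i, k = up i.
Proof.
case: (@splitP 10 1 k) => i ki; last by left; apply: val_inj; rewrite /= ki (ord1 i).
by right; exists i; apply: val_inj.
Qed.

Lemma sum_up (V : nmodType) (f : 'I_11 -> V) : \sum_k f k = \sum_i f (up i) + f ord_max.
Proof.
by rewrite big_ord_recr; congr (_ + _); apply: eq_bigr => i _; congr f; apply: val_inj.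
Qed.

Lemma pi_mx_up a b : pi_mx R a (up b) = (a == b)%:R.
Proof. by rewrite /pi_mx /up (@row_mxEl _ _ 10 1) mxE. Qed.

Lemma pi_mx_max a : pi_mx R a ord_max = 0.
Proof.
have -> : ord_max = @rshift 10 1 ord0 :> 'I_11 by apply: val_inj.
by rewrite /pi_mx (@row_mxEr _ _ 10 1) mxE.
Qed.

Lemma row_pi_mx a : row a (pi_mx R) = delta_mx 0 (up a).
Proof.
apply/rowP => k; rewrite mxE [RHS]mxE eqxx /=.
have [->|[i ->]] := upP k; first by rewrite pi_mx_max eq_sym (negbTE (up_max a)).
by rewrite pi_mx_up (inj_eq up_inj) eq_sym.
Qed.

Lemma pull_pi_up (a : form R 10) (T : {set 'I_10}) : pull (pi_mx R) a (up @: T) = a T.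
Proof. by have [-> _] := pull_delta a up_mono row_pi_mx. Qed.

Lemma pull_pi_max (a : form R 10) (S : {set 'I_11}) : ord_max \in S -> pull (pi_mx R) a S = 0.
Proof.
have [_ H] := pull_delta a up_mono row_pi_mx => mS; apply: H.
by exists ord_max => // i; exact: up_max.
Qed.

Lemma one_form_set1 n (v : 'rV[R]_n) k : one_form v [set k] = v 0 k.
Proof.
rewrite ffunE (bigD1 k) //= big1 ?addr0 // => i /andP[/eqP/set1_inj -> /eqP].
by [].
Qed.

Lemma row_of_formK n (a : form R n) : has_degree 1 a -> one_form (row_of_form a) = a.
Proof.
move=> da; apply/ffunP => S; have [/eqP/cards1P[k ->]|S1] := eqVneq #|S| 1%N.
  by rewrite one_form_set1 mxE.
by rewrite da // (has_degree_one_form _ S1).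
Qed.

Lemma extd_pair n (a : 'rV[R]_n -> form R n) x (i k : 'I_n) : (i < k)%N ->
  extd a x [set i; k] = partial i (fun y => a y [set k]) x - partial k (fun y => a y [set i]) x.
Proof.
move=> ik; have nik : i != k by rewrite -val_eqE /= neq_ltn ik.
rewrite ffunE (bigD1 i) ?inE ?eqxx //= (bigD1 k) ?inE ?eqxx ?orbT 1?eq_sym //=.
rewrite big1 ?addr0; last first.
  by move=> j; rewrite !inE => /andP[/andP[/orP[->|->]]]; rewrite ?andbF.
have -> : [set i; k] :\ i = [set k].
  by apply/setP => j; rewrite !inE; have [->|] := eqVneq j i; rewrite ?(negbTE nik).
have -> : [set i; k] :\ k = [set i].
  apply/setP => j; rewrite !inE; have [->|] := eqVneq j k; rewrite ?orbF //=.
  by rewrite eq_sym (negbTE nik).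
have -> : [set j in [set i; k] | (j < i)%N] = set0.
  apply/setP => j; rewrite !inE; apply/negP => /andP[/orP[]/eqP->]; first by rewrite ltnn.
  by move=> ki; have := ltn_trans ik ki; rewrite ltnn.
have -> : [set j in [set i; k] | (j < k)%N] = [set i].
  apply/setP => j; rewrite !inE; have [->|ji] := eqVneq j i; first by rewrite ik.
  by have [->|] := eqVneq j k; rewrite ?ltnn.
by rewrite cards0 cards1 expr0 mul1r expr1 mulN1r.
Qed.

Lemma extd_degree n k (a : 'rV[R]_n -> form R n) x :
  (forall z, has_degree k (a z)) -> has_degree k.+1 (extd a x).
Proof.
move=> da S Sk; rewrite ffunE big1 // => i iS.
have -> : (fun y => a y (S :\ i)) = fun=> 0.
  apply/funext => y; apply: da; move: Sk; rewrite (cardsD1 i) iS add1n eqSS.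
  by [].
by rewrite partial_cst mulr0.
Qed.

End Split11.

(** * Functions that do not depend on the fibre coordinate *)

Section BaseCoord.
Variable R : realType.

Lemma base_coordE (y : 'rV[R]_11) i : base_coord y 0 i = y 0 (up i).
Proof. by rewrite mxE. Qed.

Lemma base_line (y v : 'rV[R]_11) (h : R) :
  base_coord (h *: v + y) = h *: base_coord v + base_coord y.
Proof. by apply/rowP => i; rewrite !mxE. Qed.

Lemma base_delta_up i : base_coord (delta_mx 0 (up i) : 'rV[R]_11) = delta_mx 0 i.
Proof. by apply/rowP => k; rewrite !mxE (inj_eq up_inj). Qed.

Lemma base_delta_max : base_coord (delta_mx 0 ord_max : 'rV[R]_11) = 0.
Proof. by apply/rowP => k; rewrite !mxE (negbTE (up_max k)) andbF. Qed.

Lemma derive_along m n (f : 'rV[R]_m -> R) (g : 'rV[R]_n -> R) x u z v :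
  (forall h : R, f (h *: u + x) = g (h *: v + z)) -> 'D_u f x = 'D_v g z.
Proof.
move=> fg; have fg0 : f x = g z by have := fg 0; rewrite !scale0r !add0r.
have E : (fun h : R => h^-1 *: (f (h *: u + x) - f x)) =
    (fun h => h^-1 *: (g (h *: v + z) - g z)).
  by apply/funext => h; rewrite fg fg0.
by rewrite /derive /= -[fun h => _]/(fun h : R => h^-1 *: (f (h *: u + x) - f x)) E.
Qed.

Transparent partial.

Lemma partial_base_up (q : 'rV[R]_10 -> R) y i :
  partial (up i) (fun z => q (base_coord z)) y = partial i q (base_coord y).
Proof. by apply: derive_along => h; rewrite base_line base_delta_up. Qed.

Lemma partial_base_max (q : 'rV[R]_10 -> R) y :
  partial ord_max (fun z => q (base_coord z)) y = 0.
Proof.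
rewrite -(derive_cst (q (base_coord y)) y (delta_mx 0 ord_max)).
by apply: derive_along => h; rewrite base_line base_delta_max scaler0 add0r.
Qed.

Opaque partial.

Lemma smooth_base (U : set 'rV[R]_11) (V : set 'rV[R]_10) q : open U -> open V ->
  (forall y, U y -> V (base_coord y)) -> smooth_on V q ->
  smooth_on U (fun y => q (base_coord y)).
Proof.
move=> oU oV UV sq; apply: (smooth_comp oU oV) => // a.
apply: smooth_eq (smooth_proj (up a) oU) => // z _.
by rewrite base_coordE.
Qed.

End BaseCoord.

Section Vacuum.
Variables (R : realType) (gam : 'I_11 -> 'M[R]_32).

Lemma contract0 n (v : 'rV[R]_n) : contract v (0 : form R n) = 0.
Proof. by apply/ffunP => S; rewrite !ffunE big1 // => a _; rewrite ffunE mulr0. Qed.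

Lemma cliff0 (E : 'M[R]_11) : cliff gam E 0 = 0.
Proof. by rewrite /cliff big1 // => S _; rewrite /flat_comp pull0 ffunE scale0r. Qed.

Lemma Omega_vacuum (Y : topologicalType) (M : atlas R Y 11)
    (g : idx M -> 'rV[R]_11 -> 'M[R]_11) (F : idx M -> 'rV[R]_11 -> form R 11)
    (sp : spin_data R (idx M) Y) (j : idx M) y v :
  F j y = 0 -> Omega gam g F sp j y v = 0.
Proof.
move=> F0; rewrite /Omega F0 -[wedge _ 0]/(ext _ 0) ext0 contract0 cliff0.
by rewrite !scaler0 subr0.
Qed.

Lemma extd_cst_on n (U : set 'rV[R]_n) (a : 'rV[R]_n -> form R n) a0 x :
  open U -> U x -> (forall z, U z -> a z = a0) -> extd a x = 0.
Proof.
move=> oU Ux aU; apply/ffunP => S; rewrite !ffunE big1 // => i _.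
have aS z : U z -> a z (S :\ i)%SET = a0 (S :\ i)%SET by move=> Uz; rewrite aU.
by rewrite (partial_eq_on i oU Ux aS) partial_cst mulr0.
Qed.

End Vacuum.

Section SmoothExp.
Variables (R : realType) (n : nat).
Implicit Types (f : 'rV[R]_n -> R) (U : set 'rV[R]_n).

Transparent partial.

Lemma partial_expR f x i : derivable f x (delta_mx 0 i) ->
  derivable (fun z => expR (f z)) x (delta_mx 0 i) /\
  partial i (fun z => expR (f z)) x = expR (f x) * partial i f x.
Proof.
move=> df; pose phi (h : R) := f (h *: delta_mx 0 i + x).
have phi0 : 0 *: delta_mx 0 i + x = x by rewrite scale0r add0r.
have dphi : is_derive (0 : R) 1 phi (partial i f x).
  by have := @is_derive_line _ _ f x (delta_mx 0 i) 0; rewrite phi0 => /(_ df).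
have [dE E] := is_derive1_comp (is_derive_expR (phi 0)) dphi.
split; first exact/derivable1P.
by rewrite /partial derive_line -[LHS]/('D_1 (expR \o phi) 0) E /phi phi0.
Qed.

Opaque partial.

Lemma smooth_expR U f : open U -> smooth_on U f -> smooth_on U (fun x => expR (f x)).
Proof.
move=> oU /smooth_Cle sf; apply/smooth_Cle; elim=> [|k IH].
  have /Cle0 cf := sf 0%N; apply/Cle0 => x Ux.
  by apply: continuous_comp; [exact: cf|exact: continuous_expR].
have /CleS[cf df] := sf k.+1; apply/CleS; split=> [x Ux|i].
  by apply: continuous_comp; [exact: cf|exact: continuous_expR].
split=> [x Ux|]; first exact: (partial_expR ((df i).1 x Ux)).1.
apply: Cle_eq (CleM oU IH (df i).2) => // z Uz.
by rewrite (partial_expR ((df i).1 z Uz)).2.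
Qed.

End SmoothExp.

(** * Components of the Kaluza-Klein metric and flux *)

Section KKFields.
Import mathcomp.boot.finset.
Local Open Scope set_scope.
Variables (R : realType) (X : topologicalType) (N : atlas R X 10).
Variables (D : iia_fields R X (idx N)) (K : kk_space N).
Implicit Types (j : idx (tot K)) (y : 'rV[R]_11).

Definition kk_potential j y : 'rV[R]_11 := row_of_form (kk_omega D j y).

Lemma kk_potential_max j y : kk_potential j y 0 ord_max = 1.
Proof.
rewrite mxE ffunE one_form_set1 mxE !eqxx /= pull_pi_max ?inE // addr0.
by [].
Qed.

Lemma kk_potential_up j y i :
  kk_potential j y 0 (up i) = A_form D (under K j) (base_coord y) [set i].
Proof.
rewrite mxE ffunE one_form_set1 mxE (negbTE (up_max i)) /= add0r.
by rewrite -[[set up i]]imset_set1 pull_pi_up.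
Qed.

Lemma kk_omegaE j y : has_degree 1 (A_form D (under K j) (base_coord y)) ->
  kk_omega D j y = one_form (kk_potential j y).
Proof.
move=> dA; rewrite row_of_formK // => S S1.
by rewrite ffunE (has_degree_one_form _ S1) (has_degree_pull _ dA S1) addr0.
Qed.

Let phi j y := expR (dilaton D (param (under K j) (base_coord y))).

Lemma kk_metricE j y a b : kk_metric D j y a b =
  ((pi_mx R)^T *m h_metric D (under K j) (base_coord y) *m pi_mx R) a b +
  phi j y * (kk_potential j y 0 a * kk_potential j y 0 b).
Proof.
rewrite /kk_metric mxE [X in _ + X]mxE; congr (_ + _ * _).
by rewrite mxE big_ord1 mxE.
Qed.

Let pi_col (h : 'M[R]_10) a b :
  ((pi_mx R)^T *m h *m pi_mx R) a b = \sum_k (\sum_i pi_mx R i a * h i k) * pi_mx R k b.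
Proof.
by rewrite mxE; apply: eq_bigr => k _; congr (_ * _); rewrite mxE; apply: eq_bigr => i _; rewrite mxE.
Qed.

Let pi_up (h : 'M[R]_10) a b : ((pi_mx R)^T *m h *m pi_mx R) (up a) (up b) = h a b.
Proof.
rewrite pi_col (bigD1 b) //= [X in _ + X]big1 ?addr0; last first.
  by move=> k kb; rewrite pi_mx_up (negbTE kb) mulr0.
rewrite pi_mx_up eqxx mulr1 (bigD1 a) //= [X in _ + X]big1 ?addr0; last first.
  by move=> k kb; rewrite pi_mx_up (negbTE kb) mul0r.
by rewrite pi_mx_up eqxx mul1r.
Qed.

Let pi_maxr (h : 'M[R]_10) a : ((pi_mx R)^T *m h *m pi_mx R) a ord_max = 0.
Proof. by rewrite pi_col big1 // => k _; rewrite pi_mx_max mulr0. Qed.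

Let pi_maxl (h : 'M[R]_10) a : ((pi_mx R)^T *m h *m pi_mx R) ord_max a = 0.
Proof.
rewrite pi_col big1 // => k _; rewrite big1 ?mul0r // => i _.
by rewrite pi_mx_max mul0r.
Qed.

Lemma kk_metric_up j y a b : kk_metric D j y (up a) (up b) =
  h_metric D (under K j) (base_coord y) a b +
  phi j y * (A_form D (under K j) (base_coord y) [set a] * A_form D (under K j) (base_coord y) [set b]).
Proof. by rewrite kk_metricE pi_up !kk_potential_up. Qed.

Lemma kk_metric_maxl j y a : kk_metric D j y ord_max a = phi j y * kk_potential j y 0 a.
Proof. by rewrite kk_metricE pi_maxl add0r kk_potential_max mul1r. Qed.

Lemma kk_metric_maxr j y a : kk_metric D j y a ord_max = phi j y * kk_potential j y 0 a.
Proof. by rewrite kk_metricE pi_maxr add0r kk_potential_max mulr1. Qed.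

(** The coefficients on sets containing the fibre index come only from the product with the
    connection form, whose fibre component is 1, and they give H; once H is zero the others are
    those of G. *)
Lemma kk_flux_eq0 j y : has_degree 1 (A_form D (under K j) (base_coord y)) ->
  kk_flux D j y = 0 ->
  H_form D (under K j) (base_coord y) = 0 /\ G_form D (under K j) (base_coord y) = 0.
Proof.
move=> dA; rewrite /kk_flux kk_omegaE //.
set H := H_form _ _ _; set G := G_form _ _ _; rewrite -[wedge _ _]/(ext _ _) => F0.
have H0 : H = 0.
  apply/ffunP => T; rewrite [RHS]ffunE.
  have mT : ord_max \notin up @: T.
    by apply/imsetP => -[i _ e]; have := up_max i; rewrite -e eqxx.
  have /ffunP/(_ (ord_max |: up @: T)) := F0.
  rewrite ffunE [RHS]ffunE (pull_pi_max G) ?setU11 // addr0 extE.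
  rewrite (bigD1 ord_max) ?setU11 //= big1 ?addr0; last first.
    move=> i /andP[_ im]; rewrite (pull_pi_max H) ?mulr0 //.
    by rewrite !inE eqxx eq_sym im.
  rewrite kk_potential_max mul1r setU1K // pull_pi_up => /eqP.
  by rewrite mulf_eq0 signr_eq0 /= => /eqP.
split=> //; apply/ffunP => T; rewrite [RHS]ffunE.
move: F0; rewrite H0 pull0 ext0 add0r => /ffunP/(_ (up @: T)).
by rewrite pull_pi_up [RHS]ffunE.
Qed.

End KKFields.

(** * Fields of a maximally supersymmetric solution *)

Section MaximallySupersymmetric.
Import mathcomp.boot.finset.
Variables (R : realType) (gam : 'I_11 -> 'M[R]_32).
Hypothesis gamP : clifford_module gam.
Variables (X : topologicalType) (N : atlas R X 10).
Variables (D : iia_fields R X (idx N)) (K : kk_space N).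
Hypothesis msol : maximally_supersymmetric_solution gam D K.
Local Notation M := (tot K).
Local Notation g := (kk_metric D (K := K)).
Local Notation F := (kk_flux D (K := K)).
Local Notation xi := (delta_mx 0 ord_max : 'rV[R]_11).
Implicit Types (j : idx M) (i : idx N).

Let bgN : iia_background D. Proof. by have [[]] := msol. Qed.
Let pK : principal_bundle K. Proof. by have [[]] := msol. Qed.
Let bg : sugra_background gam g F (spin K).
Proof. by have [[_ _ []]] := msol. Qed.
Let mN : manifold N. Proof. by have [[]] := bgN. Qed.
Let cN : connected (carrier N). Proof. by have [[]] := bgN. Qed.
Let mM : manifold M. Proof. by have [] := bg. Qed.
Let oM j : open (coords j). Proof. exact: open_coords. Qed.
Let oN i : open (coords i). Proof. exact: open_coords. Qed.

Lemma maxsusy_frame : exists psi : idx M -> 'rV[R]_11 -> 'M[R]_32,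
  [/\ parallel_section gam g F (spin K) psi,
      forall j y, coords j y -> psi j y \in unitmx &
      forall j y, coords j y ->
        (Omega gam g F (spin K) j y xi + 4^-1 *: cliff gam (coframe (spin K) j y)
           (extd (fun z => flat_one_form g j z xi) y)) *m psi j y = 0].
Proof.
have [_ [b [bK bU]]] := msol.
have bP a : parallel_section gam g F (spin K) (b a) := killing_parallel (bK a).1.
pose psi j y : 'M[R]_32 := \matrix_(c < 32, a < 32) b a j y c 0.
have psiP : parallel_section gam g F (spin K) psi := parallel_section_cols bg bP.
have psiM (c : 'rV[R]_32) j y : psi j y *m c^T = \sum_a c 0 a *: b a j y.
  apply/colP => d; rewrite mxE summxE; apply: eq_bigr => a _.
  by rewrite !mxE mulrC.
exists psi; split=> //.
(* A combination of the 32 spinors that vanishes at one point vanishes everywhere, so its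
   coefficients are zero. *)
- move=> j y jy; rewrite -unitmx_tr -row_free_unit; apply: inj_row_free => c c0.
  have P := parallel_sectionM bg c^T psiP.
  have c0' : psi j y *m c^T = 0 by rewrite -[LHS]trmxK trmx_mul trmxK c0 trmx0.
  have jm := dom_param mM jy.
  have Z0 : zero_at (fun j y => psi j y *m c^T) (param j y).
    by apply/(zero_at_chart P jm); rewrite paramK.
  have Z m : carrier M m -> zero_at (fun j y => psi j y *m c^T) m.
    move=> Mm; apply: (bundle_locally_constant mN mM pK cN (zero_at_locally bg P) _ Mm Z0).
    exact: dom_carrier jm.
  have Zc k z : coords k z -> psi k z *m c^T = 0.
    move=> kz; have km := dom_param mM kz.
    by have := Z _ (dom_carrier mM km) k km; rewrite paramK.
  (* The dimension is stated as uniqueness of coordinates, so the first spinor is expanded twice,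
     with and without the vanishing combination. *)
  have [c1 [_ U]] := bU _ (bK ord0).
  have e1 : forall k z, coords k z -> b ord0 k z = \sum_a (delta_mx 0 ord0 : 'rV[R]_32) 0 a *: b a k z.
    move=> k z _; rewrite (bigD1 ord0) //= big1 ?addr0; last first.
      by move=> a a0; rewrite mxE (negbTE a0) andbF scale0r.
    by rewrite mxE !eqxx scale1r.
  have e2 : forall k z, coords k z -> b ord0 k z =
      \sum_a (delta_mx 0 ord0 + c : 'rV[R]_32) 0 a *: b a k z.
    move=> k z kz; rewrite {1}e1 // -psiM -[RHS]psiM linearD /= mulmxDr Zc //.
    by rewrite addr0.
  by apply: (addrI (delta_mx 0 ord0)); rewrite addr0 -(U _ e2) -(U _ e1).
move=> j y jy; apply/matrixP => d a.
have [K1 L1] := bK a; have := L1 j y jy; have := K1.2 j y jy xi.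
rewrite /spin_lie /supercov /xi_field.
set P := spin_nabla _ _ _ _ _ _ _; set W := Omega _ _ _ _ _ _ _; set C := cliff _ _ _.
move: P W C => P W C /eqP; rewrite subr_eq add0r => /eqP -> H.
have : (W + 4^-1 *: C) *m b a j y = 0 by rewrite mulmxDl.
move/matrixP/(_ d 0); rewrite mxE [RHS]mxE => H'.
rewrite mxE [RHS]mxE -[RHS]H'; apply: eq_bigr => q _; congr (_ * _).
by rewrite mxE.
Qed.

Lemma maxsusy_degree1 j y : coords j y -> has_degree 1 (A_form D (under K j) (base_coord y)).
Proof.
by have [_ [_ _ [+ _ _] _]] := bgN => + jy; apply; exact: (coords_base pK jy).
Qed.

Lemma maxsusy_forms j y : coords j y ->
  F j y = 0 /\ extd (fun z => flat_one_form g j z xi) y = 0.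
Proof.
move=> jy; have [psi [_ upsi /(_ j y jy) H]] := maxsusy_frame.
have H0 : Omega gam g F (spin K) j y xi + 4^-1 *: cliff gam (coframe (spin K) j y)
           (extd (fun z => flat_one_form g j z xi) y) = 0.
  by rewrite -[LHS](mulmxK (upsi j y jy)) H mul0mx.
have uE := background_coframe_unit bg jy.
have [_ _ _ [/(_ j y jy) dF _ _] _] := bg.
have n12 : (12^-1 : R) != 0 by rewrite invr_eq0 pnatr_eq0.
have n6 : (- 6^-1 : R) != 0 by rewrite oppr_eq0 invr_eq0 pnatr_eq0.
have n4 : (4^-1 : R) != 0 by rewrite invr_eq0 pnatr_eq0.
have d5 : has_degree 5 (wedge (flat_one_form g j y xi) (F j y)) by exact: has_degree_ext.
have d3 : has_degree 3 (contract xi (F j y)) by exact: has_degree_contract.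
have d2 : has_degree 2 (extd (fun z => flat_one_form g j z xi) y).
  by apply: extd_degree => z; exact: has_degree_one_form.
have := @cliff_free _ _ gamP _ _ _ _ _ _ _ uE n12 n6 n4 d5 d3 d2.
case; first by rewrite -H0 /Omega scaleNr.
move=> F5 F3 F2; split=> //.
(* The component of the dual form of xi along xi is the squared norm of xi, an exponential and hence
   nonzero. *)
apply: (@contract_ext_eq0 _ _ ord_max (xi *m g j y)) => //.
by rewrite -rowE mxE kk_metric_maxl kk_potential_max mulr1 gt_eqF ?expR_gt0.
Qed.

(** Each point of the base lies under a chart of the total space, and the pull-back along the change
    of chart sends zero to zero. *)
Lemma maxsusy_vanishing (a : idx N -> 'rV[R]_10 -> form R 10) k : form_field k a ->
  (forall j y, coords j y -> a (under K j) (base_coord y) = 0) -> vanishing a.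
Proof.
move=> [_ _ ta] a0 i x ix; have ip := dom_param mN ix.
have [[_ sN _] _] := pK; have [m Mm mp] := sN _ (dom_carrier mN ip).
have [j jm] := carrier_dom mM Mm; have um := bundle_under pK jm.
rewrite -(paramK mN ix) (ta i (under K j)); last by apply: overlap_chart => //; rewrite -mp.
rewrite trans_chart // -mp -(bundle_base pK jm) a0 ?pull0 //.
exact: coords_chart.
Qed.

Lemma maxsusy_H : vanishing (H_form D).
Proof.
have [_ [fH _ _ _]] := bgN; apply: (maxsusy_vanishing fH) => j y jy.
by have [] := kk_flux_eq0 (maxsusy_degree1 jy) (maxsusy_forms jy).1.
Qed.

Lemma maxsusy_G : vanishing (G_form D).
Proof.
have [_ [_ _ _ fG]] := bgN; apply: (maxsusy_vanishing fG) => j y jy.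
by have [] := kk_flux_eq0 (maxsusy_degree1 jy) (maxsusy_forms jy).1.
Qed.

Let q i x := expR (dilaton D (param i x)).
Let A i (a : 'I_10) x : R := A_form D i x [set a]%SET.

Lemma maxsusy_xi j y : (xi *m g j y) 0 ord_max = q (under K j) (base_coord y) /\
  forall a, (xi *m g j y) 0 (up a) = q (under K j) (base_coord y) * A (under K j) a (base_coord y).
Proof.
rewrite -rowE; split=> [|a]; rewrite mxE kk_metric_maxl ?kk_potential_max ?mulr1 //.
by rewrite kk_potential_up.
Qed.

Lemma maxsusy_smooth_dilaton i : smooth_on (coords i) (fun x => dilaton D (param i x)).
Proof. by have [[_ _ _ +] _] := bgN; apply. Qed.

Lemma maxsusy_smooth_q i : smooth_on (coords i) (q i).
Proof. by apply: smooth_expR => //; exact: maxsusy_smooth_dilaton. Qed.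

Lemma maxsusy_smooth_A i a : smooth_on (coords i) (A i a).
Proof. by have [_ [_ _ [_ + _] _]] := bgN; apply. Qed.

(** The coefficient of dx^a and d theta in the exterior derivative of xi^b reduces to the derivative
    of the squared norm of xi, as nothing depends on theta. *)
Lemma maxsusy_dq j y a : coords j y -> partial a (q (under K j)) (base_coord y) = 0.
Proof.
move=> jy; have [_ /ffunP/(_ [set up a; ord_max]%SET)] := maxsusy_forms jy.
rewrite extd_pair ?[RHS]ffunE; last by rewrite /= ltn_ord.
have -> : (fun y => flat_one_form g j y xi [set ord_max]%SET) =
    fun y => q (under K j) (base_coord y).
  by apply/funext => z; rewrite one_form_set1 (maxsusy_xi j z).1.
have -> : (fun y => flat_one_form g j y xi [set up a]%SET) =
    fun y => q (under K j) (base_coord y) * A (under K j) a (base_coord y).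
  by apply/funext => z; rewrite one_form_set1 (maxsusy_xi j z).2.
rewrite partial_base_up (partial_base_max (fun x => q (under K j) x * A (under K j) a x)).
by rewrite subr0.
Qed.

(** The purely horizontal coefficients of the same exterior derivative: once the exponential of the
    dilaton is constant, they are its product with dA. *)
Lemma maxsusy_dA j y a b : coords j y ->
  partial a (A (under K j) b) (base_coord y) = partial b (A (under K j) a) (base_coord y).
Proof.
wlog ab : a b / (a < b)%N => [W jy|jy].
  case: (ltngtP a b) => [?|?|/val_inj ->] //; first exact: W.
  by apply/esym; exact: W.
have bj := coords_base pK jy; set u := under K j in bj *.
have [_ /ffunP/(_ [set up a; up b]%SET)] := maxsusy_forms jy.
rewrite extd_pair // [RHS]ffunE.
have E c : (fun y => flat_one_form g j y xi [set up c]%SET) =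
    fun y => (fun x => q u x * A u c x) (base_coord y).
  by apply/funext => z; rewrite one_form_set1 (maxsusy_xi j z).2.
rewrite !E (partial_base_up (fun x => q u x * A u b x)) (partial_base_up (fun x => q u x * A u a x)).
have dq c := @smooth_derivable _ _ _ _ _ c (@maxsusy_smooth_q u) bj.
have dA c d := @smooth_derivable _ _ _ _ _ c (@maxsusy_smooth_A u d) bj.
rewrite !(partialM (dq _) (dA _ _)) !maxsusy_dq // !mulr0 !addr0.
rewrite -mulrBr => /eqP; rewrite mulf_eq0 gt_eqF ?expR_gt0 //= subr_eq0.
by move/eqP.
Qed.

(** The derivative is known only at points below a chart of the total space; a small ball around
    each base point lifts to such a chart, which gives local constancy, and the base is
    connected. *)
Lemma maxsusy_dilaton : constant_dilaton D.
Proof.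
case: (pselect (exists p, carrier N p)) => [[p0 Np0]|nN]; last first.
  by exists 0 => p Np; case: nN; exists p.
exists (dilaton D p0) => p Np.
apply: (@connected_locally X (carrier N) (fun p => dilaton D p = dilaton D p0)
  (open_carrier mN) cN _ p0 p) => // {Np}p Np.
have [[_ sN _] _] := pK; have [m Mm mp] := sN _ Np.
have [j jm] := carrier_dom mM Mm; have um := bundle_under pK jm.
rewrite mp in um; set u := under K j in um.
have [r r0 rU] := coords_ball mM (coords_chart jm).
have bU x : ball (chart u p) r x -> exists2 y, coords j y & base_coord y = x.
  move=> bx; exists (row_mx x (rsubmx (chart j m : 'rV[R]_(10+1))) : 'rV[R]_11); last exact: base_row.
  by apply: rU; apply: ball_row_mx => //; rewrite (bundle_base pK jm) mp.
have := nbhs_chart mN um (nbhsx_ballx (chart u p) r r0).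
apply: filterS => p' [up' bp'] _.
suff -> : dilaton D p' = dilaton D p by [].
apply: expR_inj; rewrite -(chartK mN um) -(chartK mN up').
apply: (@partial0_cst _ _ (q u) (chart u p) r r0) => // x bx l.
have [y jy <-] := bU x bx; split; last exact: maxsusy_dq.
apply: smooth_derivable (@maxsusy_smooth_q u) _.
exact: (coords_base pK jy).
Qed.

End MaximallySupersymmetric.

(** * Flatness of the base *)

Section OneForms.
Import mathcomp.boot.finset.
Local Open Scope set_scope.
Variables (R : realType).

Lemma one_form_ext n (v : 'rV[R]_n) : one_form v = ext v (form1 R n).
Proof.
apply/ffunP => S; have [/eqP/cards1P[k ->]|S1] := eqVneq #|S| 1%N.
  rewrite one_form_set1 extE big_set1 setDv ffunE cards0 eqxx mulr1.
  have -> : below [set k] k = 0%N; last by rewrite expr0 mulr1.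
  apply/eqP; rewrite cards_eq0; apply/eqP/setP => j; rewrite !inE.
  by apply/negP => /andP[/eqP ->]; rewrite ltnn.
rewrite (has_degree_one_form _ S1) (has_degree_ext v _ S1) // => T T0.
by rewrite ffunE (negbTE T0).
Qed.

Lemma pull_one_form m n (J : 'M[R]_(m, n)) v : pull J (one_form v) = one_form (v *m J).
Proof. by rewrite !one_form_ext pull_ext pull_form1. Qed.

Lemma extd_scalar n (lam : 'rV[R]_n -> R) y :
  extd (fun z => lam z *: form1 R n) y = one_form (\row_k partial k lam y).
Proof.
apply/ffunP => S; have [/eqP/cards1P[k ->]|S1] := eqVneq #|S| 1%N.
  rewrite one_form_set1 mxE ffunE big_set1.
  have -> : [set j in [set k] | (j < k)%N] = set0.
    apply/setP => j; rewrite !inE.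
    by apply/negP => /andP[/eqP ->]; rewrite ltnn.
  rewrite cards0 expr0 mul1r; congr (partial _ _ _); apply/funext => z.
  by rewrite !ffunE setDv cards0 eqxx [_ *: _]mulr1.
rewrite (has_degree_one_form _ S1) (extd_degree (k:=0)) // => z T T0.
by rewrite !ffunE (negbTE T0) [_ *: _]mulr0.
Qed.

End OneForms.

(** * Flatness and closedness under a change of base chart *)

Section Potential.
Variables (R : realType) (X : topologicalType) (n : nat) (N : atlas R X n).
Hypothesis mN : manifold N.

Lemma continuous_trans i j x : overlap i j x -> {for x, continuous (@trans _ _ _ N i j)}.
Proof.
move=> ijx; apply: continuous_rowP => a.
exact: smooth_cont (@smooth_trans _ _ _ _ mN i j 0 a) ijx.
Qed.

Lemma open_trans_preim i j (V : set 'rV[R]_n) : open V ->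
  open (overlap i j `&` @trans _ _ _ N i j @^-1` V).
Proof.
move=> oV; apply: open_cap_preim oV _; first exact: open_overlap.
by move=> x; exact: continuous_trans.
Qed.

(** Passes through a closed coframe: one exists for the flat metric in the chart [u], and its
    pull-back is a closed coframe in the chart [i]. *)
Lemma flat_change (h : idx N -> 'rV[R]_n -> 'M[R]_n) i u x (r : R) :
  lorentzian_metric h -> overlap i u x -> 0 < r ->
  ball (trans i u x) r `<=` coords u ->
  (forall z, ball (trans i u x) r z -> forall a b c d, riemann (h u) z a b c d = 0) ->
  forall a b c d, riemann (h i) x a b c d = 0.
Proof.
move=> [lh sh th] ox r0 rU flat.
have oB : open (ball (trans i u x) r) by exact: ball_open.
have [r' r'0 [r'r [E cE]]] := @flat_closed_coframe _ _ _ (h u) _ oB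
  (ballxx _ r0) (smooth_mx_sub rU (sh u)) (fun z bz => lh u z (rU z bz)) flat.
set V := ball _ r' in r'r cE; have oV : open V by exact: ball_open.
set U := overlap i u `&` trans i u @^-1` V.
have oU : open U by exact: open_trans_preim.
have Ux : U x by split=> //; exact: ballxx.
have Uc z : U z -> coords i z by move=> [/(overlap_coords mN)].
have ug z : U z -> h i z \in unitmx by move=> /Uc/(lh i)/lorentzian_unit.
have sT : smooth_mx_on U (trans i u).
  by apply: smooth_mx_sub (@smooth_trans _ _ _ _ mN i u) => z [].
have cE' : closed_coframe U (h i) (fun z => E (trans i u z) *m jacobian (trans i u) z).
  apply: (closed_coframe_pull oU oV _ sT ug _ cE); first by move=> z [].
  by move=> z [oz _]; exact: th.
have sg : smooth_mx_on U (h i) by apply: smooth_mx_sub (sh i) => z /Uc.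
exact: (closed_coframe_flat oU sg ug cE' Ux).
Qed.

(** On overlaps the two potentials differ by an exact form d lam, and the one in the chart [u] is df
    by Poincare; the new gauge function is lam plus f composed with the change of chart. *)
Lemma gauge_change (a : idx N -> 'rV[R]_n -> form R n) i u x (r : R) :
  gauge_potential a -> overlap i u x -> 0 < r ->
  ball (trans i u x) r `<=` coords u ->
  (forall z, ball (trans i u x) r z -> forall b c,
     partial b (fun y => a u y [set c]%SET) z = partial c (fun y => a u y [set b]%SET) z) ->
  exists W : set 'rV[R]_n, exists lam : 'rV[R]_n -> R,
    [/\ open W, W x, W `<=` coords i, smooth_on W lam &
        forall y, W y -> a i y = extd (fun z => lam z *: form1 R n) y].
Proof.
move=> [da sa ga] ox r0 rU dA.
have [f sf df] := @poincare _ _ (trans i u x) r r0 (fun c y => a u y [set c]%SET)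
  (fun m => smooth_sub rU (sa u _)) (fun b c z bz => dA z bz b c).
have [W [lam [oW Wx WU sl al]]] := ga i u x ox.
set V := ball _ r in rU dA sf df; have oV : open V by exact: ball_open.
pose W' := W `&` (overlap i u `&` trans i u @^-1` V).
have oW' : open W' by apply: openI => //; exact: open_trans_preim.
have sT : smooth_mx_on W' (trans i u).
  by apply: smooth_mx_sub (@smooth_trans _ _ _ _ mN i u) => z [_ []].
have sfT : smooth_on W' (fun z => f (trans i u z)).
  by apply: (smooth_comp oW' oV) => // z [_ []].
have sl' : smooth_on W' lam by apply: smooth_sub sl => z [].
exists W', (fun z => lam z + f (trans i u z)); split=> //.
- by split=> //; split=> //; exact: ballxx.
- by move=> z [_ [/(overlap_coords mN)]].
- exact: smoothD.
move=> y W'y; have [Wy [oy Vy]] := W'y.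
have := al y Wy => /eqP; rewrite subr_eq !extd_scalar => /eqP ->.
rewrite -[a u (trans i u y)]row_of_formK; last by apply: da; exact: trans_coords.
rewrite pull_one_form; apply/ffunP => S; rewrite ffunE.
have [/eqP/cards1P[k ->]|S1] := eqVneq #|S| 1%N; last first.
  by rewrite !(has_degree_one_form _ S1) addr0.
rewrite !one_form_set1 !mxE.
have dT c : derivable (fun z => trans i u z 0 c) y (delta_mx 0 k).
  exact: smooth_derivable (sT 0 c) W'y.
have [d1 d2] := partial_comp oV Vy (sf 1%N) dT.
rewrite (partialD (smooth_derivable (sl') W'y) d1) d2; congr (_ + _).
by apply: eq_bigr => c _; rewrite !mxE df.
Qed.

End Potential.

(** * Curvature of the Kaluza-Klein metric for constant dilaton and closed potential *)

Section Reduction.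
Variables (R : realType) (X : topologicalType) (N : atlas R X 10).
Variables (D : iia_fields R X (idx N)) (K : kk_space N) (j : idx (tot K)) (c : R).
Local Notation u := (under K j).
Local Notation g := (kk_metric D j).
Let h := h_metric D u.
Let A a x : R := A_form D u x [set a]%SET.
Hypothesis oj : open (coords j).
Hypothesis ou : open (coords u).
Hypothesis uj : forall y, coords j y -> coords u (base_coord y).
Hypothesis sh : smooth_mx_on (coords u) h.
Hypothesis lh : forall x, coords u x -> lorentzian_form (h x).
Hypothesis sg : smooth_mx_on (coords j) g.
Hypothesis lg : forall y, coords j y -> lorentzian_form (g y).
Hypothesis sA : forall a, smooth_on (coords u) (A a).
Hypothesis cc : forall x, coords u x -> expR (dilaton D (param u x)) = c.
Hypothesis dA : forall y, coords j y -> forall a b,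
  partial a (A b) (base_coord y) = partial b (A a) (base_coord y).

Let dgE (q : 'rV[R]_10 -> R) y m a b : coords j y ->
  (forall z, coords j z -> g z a b = q (base_coord z)) ->
  dg g y m a b = partial m (fun z => q (base_coord z)) y.
Proof. by move=> jy gq; rewrite /dg (partial_eq_on m oj jy gq). Qed.

Let dg_mm y m : coords j y -> dg g y m ord_max ord_max = 0.
Proof.
move=> jy; rewrite (dgE (q:=fun=> c) _ jy) ?partial_cst // => z jz.
by rewrite kk_metric_maxl kk_potential_max mulr1 cc //; exact: uj.
Qed.

Let guu z a b : coords j z ->
  g z (up a) (up b) = h (base_coord z) a b + c * (A a (base_coord z) * A b (base_coord z)).
Proof. by move=> jz; rewrite kk_metric_up cc //; exact: uj. Qed.

Let gum z a : coords j z -> g z (up a) ord_max = c * A a (base_coord z).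
Proof. by move=> jz; rewrite kk_metric_maxr kk_potential_up cc //; exact: uj. Qed.

Let gmu z a : coords j z -> g z ord_max (up a) = c * A a (base_coord z).
Proof. by move=> jz; rewrite kk_metric_maxl kk_potential_up cc //; exact: uj. Qed.

Let dA_ y m a : coords j y -> derivable (A a) (base_coord y) (delta_mx 0 m).
Proof. by move=> jy; exact: smooth_derivable (sA a) (uj jy). Qed.

Let dcA y m a : coords j y ->
  partial m (fun x => c * A a x) (base_coord y) = c * partial m (A a) (base_coord y).
Proof.
move=> jy; rewrite (partialM _ (@dA_ y m a jy)); first by rewrite partial_cst mulr0 addr0.
exact: derivable_cst.
Qed.

Let dg_uum y m a : coords j y ->
  dg g y (up m) (up a) ord_max = c * partial m (A a) (base_coord y).
Proof.
move=> jy; rewrite (dgE (q:=fun x => c * A a x) _ jy); last by move=> z; exact: gum.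
by rewrite (partial_base_up (fun x => c * A a x)) dcA.
Qed.

Let dg_umu y m a : coords j y ->
  dg g y (up m) ord_max (up a) = c * partial m (A a) (base_coord y).
Proof.
move=> jy; rewrite (dgE (q:=fun x => c * A a x) _ jy); last by move=> z; exact: gmu.
by rewrite (partial_base_up (fun x => c * A a x)) dcA.
Qed.

Let dg_m y a b : coords j y -> dg g y ord_max a b = 0.
Proof.
move=> jy; have [->|[a' ->]] := upP a; have [->|[b' ->]] := upP b.
- exact: dg_mm.
- rewrite (dgE (q:=fun x => c * A b' x) _ jy); last by move=> z; exact: gmu.
  exact: (partial_base_max (fun x => c * A b' x)).
- rewrite (dgE (q:=fun x => c * A a' x) _ jy); last by move=> z; exact: gum.
  exact: (partial_base_max (fun x => c * A a' x)).
- rewrite (dgE (q:=fun x => h x a' b' + c * (A a' x * A b' x)) _ jy); last by move=> z; exact: guu.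
  exact: (partial_base_max (fun x => h x a' b' + c * (A a' x * A b' x))).
Qed.

Let dg_uuu y m a b : coords j y -> dg g y (up m) (up a) (up b) =
  dg h (base_coord y) m a b + c * (A a (base_coord y) * partial m (A b) (base_coord y)
     + A b (base_coord y) * partial m (A a) (base_coord y)).
Proof.
move=> jy.
rewrite (dgE (q:=fun x => h x a b + c * (A a x * A b x)) _ jy); last by move=> z; exact: guu.
rewrite (partial_base_up (fun x => h x a b + c * (A a x * A b x))).
have dAA : derivable (fun x => A a x * A b x) (base_coord y) (delta_mx 0 m).
  by apply: derivableM; exact: dA_.
have dcst : derivable (fun=> c) (base_coord y) (delta_mx 0 m) by exact: derivable_cst.
rewrite (partialD (smooth_derivable (sh a b) (uj jy)) (derivableM dcst dAA)).
rewrite (partialM dcst dAA) partial_cst mulr0 addr0.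
by rewrite (partialM (@dA_ y m a jy) (@dA_ y m b jy)).
Qed.

Let ug y : coords j y -> g y \in unitmx. Proof. by move=> /lg/lorentzian_unit. Qed.
Let uh x : coords u x -> h x \in unitmx. Proof. by move=> /lh/lorentzian_unit. Qed.

(** The whole column of symbols is guessed and checked with lowered index. For closed A and constant
    dilaton the metric is locally a product in the shifted fibre coordinate, which explains the
    guess. *)
Lemma kk_christoffel y r m l : coords j y ->
  christoffel g (up r) (up m) (up l) y = christoffel h r m l (base_coord y).
Proof.
move=> jy; have ub := uj jy.
pose G r := christoffel h r m l (base_coord y).
(* The candidate in the fibre direction is the covariant derivative of A for h. *)
pose Xm := partial m (A l) (base_coord y) - \sum_r A r (base_coord y) * G r.
pose Z (k : 'I_11) : R := if (@fintype.split 10 1 k) is inl r then G r else Xm.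
have Xu k : Z (up k) = G k.
  by rewrite /Z /up (_ : @fintype.split 10 1 (lshift 1 k) = inl k) // -[lshift 1 k]/(unsplit (inl k)) unsplitK.
have XM : Z ord_max = Xm.
  rewrite /Z (_ : ord_max = @rshift 10 1 ord0 :> 'I_11); last by apply: val_inj.
  by rewrite (_ : @fintype.split 10 1 (rshift 10 ord0) = inr ord0) // -[rshift 10 ord0]/(@unsplit 10 1 (inr ord0)) unsplitK.
have low := christoffel_lower uh _ m l ub.
rewrite (christoffel_unique ug (m := up m) (l := up l) (X := Z) jy) // => s.
rewrite sum_up XM; under eq_bigr do rewrite Xu.
rewrite /Xm /lower_christoffel; have [->|[s' ->]] := upP s.
  rewrite dg_m // !dg_umu // kk_metric_maxl kk_potential_max cc //.
  under eq_bigr do rewrite gmu // -mulrA.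
  rewrite -mulr_sumr (dA jy l m).
  set S := \sum_i _; set T := partial _ _ _.
  have alg (p q t : R) : p * q + p * 1 * (t - q) = 2^-1 * (p * t + p * t - 0) by field.
  exact: alg.
rewrite !dg_uuu // gum // (dA jy l s') (dA jy s' m) (dA jy l m).
under eq_bigr do rewrite guu // mulrDl -!mulrA.
rewrite big_split /= -!mulr_sumr -/(G _).
rewrite (low s') /lower_christoffel.
set S := \sum_i _; set T := partial m (A l) _; set V := partial m (A s') _.
set V' := partial s' (A l) _.
set d1 := dg h _ _ _ _; set d2 := dg h _ _ _ _; set d3 := dg h _ _ _ _.
have alg (p q t al am as' v v' e1 e2 e3 : R) :
    2^-1 * (e1 + e2 - e3) + p * (as' * q) + p * as' * (t - q) =
    2^-1 * (e1 + p * (as' * t + al * v) + (e2 + p * (as' * t + am * v')) -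
      (e3 + p * (am * v' + al * v))) by field.
exact: alg.
Qed.

(** In other words xi is parallel: it is a Killing vector whose dual form is closed. *)
Lemma kk_christoffel_max y r m : coords j y -> christoffel g r m ord_max y = 0.
Proof.
move=> jy; rewrite (christoffel_unique ug (m := m) (l := ord_max) (X := fun=> 0) jy) // => s.
rewrite big1 => [|k _]; last by rewrite mulr0.
rewrite /lower_christoffel; have [->|[s' ->]] := upP s; have [->|[m' ->]] := upP m.
- by rewrite !dg_mm // addr0 subrr mulr0.
- by rewrite !dg_m // dg_mm // addr0 subrr mulr0.
- by rewrite !dg_m // dg_mm // addr0 subrr mulr0.
- by rewrite !dg_uum // dg_m // addr0 (dA jy s' m') subrr mulr0.
Qed.

(** In the quadratic terms, the summand with the fibre index contains a symbol with lower index
    theta, which is zero. *)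
Lemma kk_riemann y r s m k : coords j y ->
  riemann g y (up r) (up s) (up m) (up k) = riemann h (base_coord y) r s m k.
Proof.
move=> jy.
have E a b d e : partial (up e) (christoffel g (up a) (up b) (up d)) y =
    partial e (christoffel h a b d) (base_coord y).
  rewrite -(partial_base_up (christoffel h a b d)).
  by apply: partial_eq_on oj jy _ => z jz; exact: kk_christoffel.
apply: (f_equal2 +%R); first exact: (f_equal2 (fun p q => p - q) (E _ _ _ _) (E _ _ _ _)).
apply: etrans (sum_up _) _; apply: etrans (addr0 _).
have C r' m' l' := kk_christoffel r' m' l' jy.
apply: (f_equal2 +%R).
  apply: eq_bigr => l _.
  exact: (f_equal2 (fun p q => p - q) (f_equal2 *%R (C _ _ _) (C _ _ _))
    (f_equal2 *%R (C _ _ _) (C _ _ _))).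
have alg (p q p' q' : R) : p = 0 -> p' = 0 -> p * q - p' * q' = 0.
  by move=> -> ->; rewrite !mul0r subr0.
exact: alg (kk_christoffel_max _ _ jy) (kk_christoffel_max _ _ jy).
Qed.

End Reduction.

Section MaximallySupersymmetricFlat.
Variables (R : realType) (gam : 'I_11 -> 'M[R]_32).
Hypothesis gamP : clifford_module gam.
Variables (X : topologicalType) (N : atlas R X 10).
Variables (D : iia_fields R X (idx N)) (K : kk_space N).
Hypothesis msol : maximally_supersymmetric_solution gam D K.
Local Notation M := (tot K).
Local Notation g := (kk_metric D (K := K)).
Local Notation F := (kk_flux D (K := K)).
Implicit Types (j : idx M) (i : idx N).

Let bgN : iia_background D. Proof. by have [[]] := msol. Qed.
Let pK : principal_bundle K. Proof. by have [[]] := msol. Qed.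
Let bg : sugra_background gam g F (spin K).
Proof. by have [[_ _ []]] := msol. Qed.
Let mN : manifold N. Proof. by have [[]] := bgN. Qed.
Let mM : manifold M. Proof. by have [] := bg. Qed.
Let oM j : open (coords j). Proof. exact: open_coords. Qed.
Let oN i : open (coords i). Proof. exact: open_coords. Qed.
Let lh : lorentzian_metric (h_metric D). Proof. by have [[]] := bgN. Qed.

Lemma maxsusy_kk_flat j y : coords j y ->
  forall (a b c d : 'I_11), riemann (g j) y a b c d = 0.
Proof.
have [psi [[spsi _ dpsi] upsi _]] := maxsusy_frame msol.
apply: (killing_flat bg gamP (spsi j) (upsi j)) => l z jz.
rewrite dpsi // /killing_mx Omega_vacuum ?sub0r ?mulNmx //.
by have [] := maxsusy_forms gamP msol jz.
Qed.

Lemma maxsusy_base_flat j y : coords j y ->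
  forall a b c d, riemann (h_metric D (under K j)) (base_coord y) a b c d = 0.
Proof.
move=> jy a b c d; have [k kc] := maxsusy_dilaton gamP msol.
have [lhD sh _] := lh; have [_ [lg sg _] _ _ _] := bg.
have cc x : coords (under K j) x -> expR (dilaton D (param (under K j) x)) = expR k.
  by move=> ux; rewrite kc //; exact: dom_carrier (dom_param mN ux).
have uj z : coords j z -> coords (under K j) (base_coord z) by exact: coords_base.
have sA e := @maxsusy_smooth_A _ _ _ _ _ _ msol (under K j) e.
have H := @kk_riemann _ _ _ D K j (expR k) (@oM j) uj (sh _) (lhD _) (lg j) sA cc
  (fun z jz a b => maxsusy_dA gamP msol a b jz) y a b c d jy.
by rewrite -H; exact: maxsusy_kk_flat.
Qed.

(** Supplies the chart and the ball needed for [flat_change] and [gauge_change]: every point of the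
    ball is the projection of a point in one chart of the total space. *)
Lemma maxsusy_local i x : coords i x -> exists u, overlap i u x /\
  exists2 r : R, 0 < r & forall z, ball (trans i u x) r z ->
    exists j y, [/\ coords j y, under K j = u & base_coord y = z].
Proof.
move=> ix; have ip := dom_param mN ix.
have [[_ sN _] _] := pK; have [m Mm mp] := sN _ (dom_carrier mN ip).
have [j jm] := carrier_dom mM Mm; have um := bundle_under pK jm.
rewrite mp in um.
exists (under K j); split; first by rewrite -(paramK mN ix); exact: overlap_chart.
have [r r0 rU] := coords_ball mM (coords_chart jm).
exists r => // z bz.
exists j, (row_mx z (rsubmx (chart j m : 'rV[R]_(10+1))) : 'rV[R]_11); split=> //.
  by apply: rU; apply: ball_row_mx => //; rewrite (bundle_base pK jm) mp.
exact: base_row.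
Qed.

Lemma maxsusy_flat : flat_metric (h_metric D).
Proof.
move=> i x ix; have [u [ox [r r0 H]]] := maxsusy_local ix.
apply: (flat_change mN lh ox r0) => z /H[j [y [jy <- <-]]]; first exact: (coords_base pK jy).
exact: maxsusy_base_flat.
Qed.

Lemma maxsusy_gauge : pure_gauge (A_form D).
Proof.
move=> i x ix; have [u [ox [r r0 H]]] := maxsusy_local ix.
have [_ [_ _ gA _]] := bgN.
apply: (gauge_change mN gA ox r0) => z /H[j [y [jy <- <-]]]; first exact: (coords_base pK jy).
by move=> b c; exact: (maxsusy_dA gamP msol).
Qed.

End MaximallySupersymmetricFlat.

(** * The flat solution *)

Section RowSpace.
Variables (R : realType) (n : nat).

Lemma second_countable_row : @second_countable 'rV[R]_n.
Proof.
pose f (q : 'rV[rat]_n * nat) : set 'rV[R]_n := ball (map_mx (ratr : rat -> R) q.1 : 'rV[R]_n) q.2.+1%:R^-1.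
exists (range f); first by apply: sub_countable (card_image_le _ _) (countableP _).
split; first by move=> _ [q _ <-]; exact: ball_open.
move=> x V /nbhs_ballP[e /= e0 eV].
(* The radius is below e/2, so that the ball around the rational centre, which is itself within that
   radius of [x], stays in the ball of radius e. *)
have [N] := @ltr_add_invr R 0 (e / 2) (divr_gt0 e0 (ltr0Sn _ 1)); rewrite add0r => Ne.
pose d : R := N.+1%:R^-1.
have d0 : 0 < d by rewrite invr_gt0.
have approx i : exists r : rat, `|x 0 i - ratr r| < d.
  have /rat_in_itvoo[r] : x 0 i - d < x 0 i + d by rewrite ltrD2l gtrN.
  rewrite in_itv /= => /andP[r1 r2]; exists r.
  by rewrite ltr_distl; move: r1 r2; rewrite ltrBlDr ltrBlDl; lra.
have [q qx] := choice approx.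
have bq : ball (map_mx (ratr : rat -> R) (\row_i q i) : 'rV[R]_n) d x.
  by split=> // a b; rewrite (ord1 a) !mxE; have := qx b; rewrite distrC.
exists (f (\row_i q i, N)); first by split=> //; exists (\row_i q i, N).
move=> z bz; apply: eV; rewrite [e]splitr; apply: (ball_triangle (y := map_mx (ratr : rat -> R) (\row_i q i))).
  by apply: (le_ball (ltW Ne)); exact: ball_sym.
exact: (le_ball (ltW Ne)).
Qed.

Lemma star_connected (A : set 'rV[R]_n) a : A a ->
  (forall z (t : R), A z -> 0 <= t <= 1 -> A (t *: (z - a) + a)) -> connected A.
Proof.
move=> Aa star.
pose S z : set 'rV[R]_n := (fun t : R => t *: (z - a) + a) @` `[0, 1].
have -> : A = \bigcup_(z in A) S z.
  apply/seteqP; split=> [z Az|z [w Aw [t]]].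
    by exists z => //; exists 1; rewrite ?scale1r ?subrK //= in_itv /= ler01 lexx.
  by rewrite /= in_itv /= => t01 <-; exact: star.
apply: bigcup_connected.
  by exists a => z _; exists 0; rewrite ?scale0r ?add0r //= in_itv /= ler01 lexx.
move=> z _; apply: connected_continuous_connected; first exact: segment_connected.
apply: continuous_subspaceT => t.
exact: (@cvgD _ _ _ _ (nbhs_filter t) _ _ _ _ (@cvgZr_tmp _ _ _ _ _ _ _ _ (@cvg_id _ _)) (cvg_cst _)).
Qed.

End RowSpace.

(** * Restriction of the fields to an open subset *)

Section Submanifold.
Variables (R : realType) (X : topologicalType) (n : nat) (N : atlas R X n) (U : set X).
Hypothesis mN : manifold N.
Hypothesis oU : open U.
Local Notation N' := (open_submanifold N U).
Implicit Types i j : idx N'.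

Lemma sub_coordsE i : coords i = @coords _ _ _ N i `&` (@param _ _ _ N i) @^-1` U.
Proof.
apply/seteqP; split=> x.
  by move=> [p [ip Up] <-]; split; [exists p|rewrite /preimage /= chartK].
by move=> [[p ip <-]]; rewrite /preimage /= chartK // => Up; exists p.
Qed.

Lemma sub_coords i x : coords i x -> @coords _ _ _ N i x.
Proof. by rewrite sub_coordsE => -[]. Qed.

Lemma sub_overlap i j x : overlap i j x -> @overlap _ _ _ N i j x.
Proof. by move=> [p [[ip _] [jp _]] <-]; exists p. Qed.

Lemma manifold_open_submanifold : manifold N'.
Proof.
have [[hX cX oN _] _] := mN; split; split=> //.
- exact: openI.
- move=> p; split=> [[/(carrier_dom mN)[i ip] Up]|[i [ip Up]]]; first by exists i.
  by split=> //; exact: dom_carrier ip.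
- move=> i; split; first by apply: openI => //; exact: open_dom.
  rewrite sub_coordsE; apply: open_cap_preim => //; first exact: open_coords.
  by move=> x; exact: continuous_param.
- by move=> i p [ip _]; exact: (@chartK _ _ _ N mN i p ip).
- by move=> i p [ip _]; exact: (@continuous_chart _ _ _ N mN i p ip).
- by move=> i x /sub_coords; exact: (@continuous_param _ _ _ N mN i x).
- move=> i j; apply: smooth_mx_sub (@smooth_trans _ _ _ _ mN i j) => x.
  exact: sub_overlap.
Qed.

Lemma sub_form_field k a : @form_field _ _ _ N k a -> @form_field _ _ _ N' k a.
Proof.
move=> [da sa ta]; split=> [i x /sub_coords|i S|i j x /sub_overlap].
- exact: da.
- by apply: smooth_sub (sa i S) => x /sub_coords.
- exact: ta.
Qed.

Lemma sub_closed_form a : @closed_form _ _ _ N a -> @closed_form _ _ _ N' a.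
Proof. by move=> ca i x /sub_coords; exact: ca. Qed.

Lemma sub_lorentzian_metric h : @lorentzian_metric _ _ _ N h -> @lorentzian_metric _ _ _ N' h.
Proof.
move=> [lh sh th]; split=> [i x /sub_coords|i|i j x /sub_overlap].
- exact: lh.
- by apply: smooth_mx_sub (sh i) => x /sub_coords.
- exact: th.
Qed.

Lemma sub_smooth_function f : @smooth_function _ _ _ N f -> @smooth_function _ _ _ N' f.
Proof. by move=> sf i; apply: smooth_sub (sf i) => x /sub_coords. Qed.

Lemma sub_gauge_potential a : @gauge_potential _ _ _ N a -> @gauge_potential _ _ _ N' a.
Proof.
move=> [da sa ga]; split=> [i x /sub_coords|i S|i j x ijx].
- exact: da.
- by apply: smooth_sub (sa i S) => x /sub_coords.
have [W [lam [oW Wx WU sl al]]] := ga i j x (sub_overlap ijx).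
exists (W `&` overlap i j), lam; split.
- by apply: openI => //; exact: (@open_overlap _ _ _ _ manifold_open_submanifold i j).
- by split.
- by move=> z [].
- by apply: smooth_sub sl => z [].
- by move=> z [Wz _]; exact: al.
Qed.

End Submanifold.

(** * Vacuum backgrounds with a closed orthonormal coframe *)

Section FlatVacuum.
Variables (R : realType) (gam : 'I_11 -> 'M[R]_32).
Variables (Y : topologicalType) (M : atlas R Y 11).
Variables (g : idx M -> 'rV[R]_11 -> 'M[R]_11).
Variables (F : idx M -> 'rV[R]_11 -> form R 11).
Variable (sp : spin_data R (idx M) Y).
Hypothesis mM : manifold M.
Hypothesis lg : lorentzian_metric g.
Hypothesis spM : spin_structure gam g sp.
Hypothesis F0 : forall j y, coords j y -> F j y = 0.
Hypothesis cE : forall j, closed_coframe (coords j) (g j) (coframe sp j).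
Implicit Types (j k : idx M).

Let oM j : open (coords j). Proof. exact: open_coords. Qed.
Let sg j : smooth_mx_on (coords j) (g j). Proof. by have [_ + _] := lg. Qed.
Let ug j y : coords j y -> g j y \in unitmx.
Proof. by have [+ _ _] := lg => + jy => /(_ j y jy)/lorentzian_unit. Qed.

Lemma vacuum_background : sugra_background gam g F sp.
Proof.
split=> //; last by move=> j y jy; exact: extd_cst_on (@oM j) jy (@F0 j).
split=> [j y jy|j S|j k y jky].
- by move=> S _; rewrite F0 // ffunE.
- apply: smooth_eq (@smooth_cst _ _ (coords j) 0) => // z jz.
  by rewrite F0 // ffunE.
- rewrite F0; last exact: overlap_coords jky.
  by rewrite F0 ?pull0 //; exact: trans_coords.
Qed.

Lemma form_inner0 (E : 'M[R]_11) a : form_inner E 0 a = 0.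
Proof.
by rewrite /form_inner big1 // => S _; rewrite /flat_comp pull0 ffunE mulr0 mul0r.
Qed.

Lemma hodge0 (E : 'M[R]_11) : hodge E 0 = 0.
Proof.
rewrite /hodge -[RHS](pull0 E); congr (pull _ _); apply/ffunP => S.
by rewrite /flat_comp pull0 !ffunE mulr0.
Qed.

Lemma vacuum_solution : sugra_solution gam g F sp.
Proof.
split; first exact: vacuum_background.
- move=> j y jy a b; rewrite /stress F0 // !contract0 !form_inner0 !mulr0 subr0.
  rewrite /ricci big1 // => r _.
  exact: (closed_coframe_flat (@oM j) (@sg j) (@ug j) (cE j) jy).
- move=> j y jy; rewrite F0 //.
  have -> : wedge (0 : form R 11) 0 = 0.
    by apply/ffunP => S; rewrite [LHS]ffunE [RHS]ffunE big1 // => T _; rewrite [X in _ * X]ffunE mulr0.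
  rewrite scaler0; apply: (extd_cst_on (a0 := 0) (@oM j) jy) => z jz.
  by rewrite F0 // hodge0.
Qed.

(** The frame dual to a closed coframe is parallel, so the two terms of the coefficient cancel. *)
Lemma vacuum_spin_coef j y a b mu : coords j y -> spin_coef g sp j y a b mu = 0.
Proof.
move=> jy; have P := closed_coframe_parallel (@oM j) (@ug j) (cE j) mu jy.
rewrite /spin_coef big1 // => r _; move/matrixP/(_ r b): P.
rewrite pmxE => ->; rewrite mxE [X in - X + _]mxE.
rewrite (_ : \sum_s christoffel (g j) r mu s y * _ = \sum_s gamma (g j) mu y r s * invmx (coframe sp j y) s b).
  by rewrite addNr mulr0.
by apply: eq_bigr => s _; congr (_ * _); rewrite mxE.
Qed.

Lemma vacuum_nabla_cst j y (s : 'cV[R]_32) v : coords j y ->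
  spin_nabla gam g sp j (fun=> s) y v = 0.
Proof.
move=> jy; rewrite /spin_nabla.
have -> : \sum_(a < 11) \sum_(b < 11) \sum_(mu < 11)
      (v 0 mu * eta R a * spin_coef g sp j y a b mu) *: (gam a *m gam b) = 0.
  rewrite big1 // => a _; rewrite big1 // => b _; rewrite big1 // => mu _.
  by rewrite vacuum_spin_coef // mulr0 scale0r.
rewrite scaler0 mul0mx addr0; apply/colP => a; rewrite !mxE.
exact: derive_cst.
Qed.

Lemma vacuum_killing_cst (s : 'cV[R]_32) :
  (forall j k m, (dom j `&` dom k) m -> strans sp j k m = 1%:M) ->
  killing_spinor gam g F sp (fun _ _ => s).
Proof.
move=> s1; split; first split.
- by move=> j; exact: smooth_mx_cst.
- by move=> j k m jkm; rewrite s1 // mul1mx.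
- move=> j y jy v; rewrite /supercov vacuum_nabla_cst //.
  by rewrite Omega_vacuum ?F0 // mul0mx subr0.
Qed.

Lemma vacuum_killing_locally eps j y l : killing_spinor gam g F sp eps ->
  coords j y -> pmx l (eps j) y = 0.
Proof.
move=> /killing_parallel[_ _ d] jy; rewrite d // /killing_mx Omega_vacuum ?F0 //.
suff -> : spin_form gam g sp j l y = 0 by rewrite subr0 mul0mx.
rewrite /spin_form big1 ?scaler0 // => a _; rewrite big1 // => b _.
by rewrite vacuum_spin_coef // mulr0 scale0r.
Qed.

End FlatVacuum.

Lemma pmx0_connected (R : realType) (n p q : nat) (C : set 'rV[R]_n)
    (u : 'rV[R]_n -> 'M[R]_(p, q)) :
  open C -> connected C -> smooth_mx_on C u ->
  (forall l y, C y -> pmx l u y = 0) -> forall x y, C x -> C y -> u y = u x.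
Proof.
move=> oC cC su du x y Cx Cy.
apply: (@connected_locally _ C (fun z => u z = u x) oC cC _ x y) => // z Cz.
have [r /= r0 rC] := (nbhs_ballP _ _).1 (open_nbhs_nbhs (conj oC Cz)).
have := nbhsx_ballx z r r0; apply: filterS => w bw _.
rewrite (@pmx0_cst _ _ _ _ u z r r0 (smooth_mx_sub rC su)) // => v i bv.
by apply: du; exact: rC.
Qed.

(** * The product of a flat ball with the real line *)

Section Model.
Variables (R : realType) (gam : 'I_11 -> 'M[R]_32).
Variables (X : topologicalType) (N : atlas R X 10) (D : iia_fields R X (idx N)).
Variables (i0 : idx N) (x0 : 'rV[R]_10) (r c0 : R) (P : 'rV[R]_10 -> 'M[R]_10).
Hypothesis bgD : iia_background D.
Hypothesis r0 : 0 < r.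
Hypothesis BU : ball x0 r `<=` coords i0.
Hypothesis cP : closed_coframe (ball x0 r) (h_metric D i0) P.
Hypothesis cD : forall p, carrier N p -> dilaton D p = c0.
Hypothesis vA : vanishing (A_form D).
Hypothesis vH : vanishing (H_form D).
Hypothesis vG : vanishing (G_form D).

Let mN : manifold N. Proof. by have [[]] := bgD. Qed.

Definition model_base : set X := dom i0 `&` chart i0 @^-1` (ball x0 r).
Local Notation N' := (open_submanifold N model_base).

Definition model_dom : set 'rV[R]_11 := [set y | ball x0 r (base_coord y)].

(** The fibre entry is the square root of the constant fibre component of the metric, the
    exponential of [c0]. *)
Definition model_coframe (y : 'rV[R]_11) : 'M[R]_11 :=
  block_mx (P (base_coord y)) 0 0 (expR (c0 / 2))%:M.

(** One global chart, with R acting by translation of the last coordinate. A single coframe makes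
    the spin transition functions trivial, so constant columns are sections. *)
Definition model_space : kk_space N' :=
  @KKSpace R X N' 'rV[R]_11
    (@Atlas R 'rV[R]_11 11 unit model_dom (fun=> model_dom) (fun=> id) (fun=> id))
    (fun y => param i0 (base_coord y)) (fun=> i0)
    (fun s y => y + s *: delta_mx 0 ord_max)
    (@SpinData R unit 'rV[R]_11 (fun=> model_coframe) (fun _ _ _ => 1%:M)).
Local Notation K := model_space.
Local Notation M := (tot K).
Local Notation g := (kk_metric (D : iia_fields R X (idx N')) (K := K)).
Local Notation F := (kk_flux (D : iia_fields R X (idx N')) (K := K)).

Lemma open_model_base : open model_base.
Proof.
apply: open_cap_preim; [exact: open_dom|exact: ball_open|].
by move=> p; exact: continuous_chart.
Qed.

Lemma model_base_param x : ball x0 r x -> model_base (param i0 x).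
Proof.
move=> bx; have cx := BU bx; split; first exact: dom_param.
by rewrite /preimage /= paramK.
Qed.

Lemma continuous_base_coord (y : 'rV[R]_11) : {for y, continuous (@base_coord R)}.
Proof.
apply: continuous_rowP => a.
have -> : (fun z : 'rV[R]_11 => base_coord z 0 a) = fun z => z 0 (up a).
  by apply/funext => z; rewrite base_coordE.
exact: coord_continuous.
Qed.

Lemma open_model_dom : open model_dom.
Proof.
have -> : model_dom = setT `&` @base_coord R @^-1` (ball x0 r) by rewrite setTI.
apply: open_cap_preim; [exact: openT|exact: ball_open|].
by move=> y _; exact: continuous_base_coord.
Qed.

Lemma ball_star n (x z : 'rV[R]_n) (e t : R) : 0 < e -> ball x e z -> 0 <= t <= 1 ->
  ball x e (t *: (z - x) + x).
Proof.
move=> e0 /(ball_rVP _ _ e0) bz /andP[t0 t1]; apply/(ball_rVP _ _ e0) => i.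
have -> : x 0 i - (t *: (z - x) + x) 0 i = t * (x 0 i - z 0 i).
  by rewrite !mxE; ring.
by rewrite normrM ger0_norm //; apply: le_lt_trans (bz i); rewrite ler_piMl.
Qed.

Lemma model_coords (j : idx M) : coords j = model_dom.
Proof. by rewrite /coords image_id. Qed.

Lemma model_trans (j k : idx M) : trans j k = id.
Proof. by []. Qed.

Lemma jacobian_id n (x : 'rV[R]_n) : jacobian (id : 'rV[R]_n -> 'rV[R]_n) x = 1%:M.
Proof. by apply/matrixP => a b; rewrite !mxE (partial_coord b a x).2. Qed.

Lemma model_manifold : manifold M.
Proof.
split; split.
- exact: norm_hausdorff.
- exact: second_countable_row.
- exact: open_model_dom.
- by move=> p; split=> [cp|[]//]; exists tt.
- by move=> i; rewrite model_coords; split; exact: open_model_dom.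
- by [].
- by move=> i p _; exact: cvg_id.
- by move=> i p _; exact: cvg_id.
- move=> i j a b; rewrite model_trans.
  have oO : open (overlap i j) by rewrite /overlap setIid image_id; exact: open_model_dom.
  by apply: smooth_eq (smooth_proj b oO) => // z _; rewrite (ord1 a).
Qed.

Lemma model_form_zero (a : idx N -> 'rV[R]_10 -> form R 10) y :
  vanishing a -> model_dom y -> a i0 (base_coord y) = 0.
Proof. by move=> va Cy; apply: va; exact: BU. Qed.

Lemma model_potential (j : idx M) y : model_dom y ->
  kk_potential (D : iia_fields R X (idx N')) j y = delta_mx 0 ord_max.
Proof.
move=> Cy; apply/rowP => k; have [->|[a ->]] := upP k.
  by rewrite kk_potential_max mxE !eqxx.
rewrite kk_potential_up model_form_zero // ffunE mxE.
by rewrite (negbTE (up_max a)).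
Qed.

Lemma model_dilaton y : model_dom y -> dilaton D (param i0 (base_coord y)) = c0.
Proof. by move=> Cy; apply: cD; apply: (dom_carrier mN (i:=i0)); apply: dom_param => //; exact: BU. Qed.

Lemma model_flux (j : idx M) y : coords j y -> F j y = 0.
Proof.
rewrite model_coords => Cy; rewrite /kk_flux /= !model_form_zero //.
rewrite kk_omegaE; last by move=> S _; rewrite /= model_form_zero // ffunE.
by rewrite -[wedge _ _]/(ext _ _) !pull0 ext0 addr0.
Qed.

Let E := model_coframe.
Let k := expR (c0 / 2).

Let rmax : ord_max = @rshift 10 1 ord0 :> 'I_11. Proof. exact: val_inj. Qed.

Lemma model_coframe_uu y a b : E y (up a) (up b) = P (base_coord y) a b.
Proof. by rewrite /E /model_coframe /up (@block_mxEul _ 10 1 10 1). Qed.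

Lemma model_coframe_um y a : E y (up a) ord_max = 0.
Proof. by rewrite /E /model_coframe rmax /up (@block_mxEur _ 10 1 10 1) mxE. Qed.

Lemma model_coframe_mu y a : E y ord_max (up a) = 0.
Proof. by rewrite /E /model_coframe rmax /up (@block_mxEdl _ 10 1 10 1) mxE. Qed.

Lemma model_coframe_mm y : E y ord_max ord_max = k.
Proof. by rewrite /E /model_coframe rmax (@block_mxEdr _ 10 1 10 1) mxE. Qed.

Lemma model_metric (j : idx M) y : model_dom y ->
  g j y = (E y)^T *m eta_mx R 11 *m E y.
Proof.
move=> Cy; have [_ _ hP _] := cP.
have W := model_potential j Cy.
have EE a b : ((E y)^T *m eta_mx R 11 *m E y) a b =
    \sum_s (E y s a * eta R s) * E y s b.
  by rewrite mxE; apply: eq_bigr => s _; rewrite mul_mx_diag !mxE.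
have kk : expR (dilaton D (param i0 (base_coord y))) = k * k.
  by rewrite model_dilaton // -expRD; congr expR; field.
have eM : eta R (ord_max : 'I_11) = 1 by [].
apply/matrixP => a b; rewrite EE sum_up eM.
have [->|[b' ->]] := upP b.
  rewrite kk_metric_maxr W mxE /= kk model_coframe_mm.
  under eq_bigr do rewrite model_coframe_um mulr0.
  rewrite big1_eq add0r mulr1; have [->|[a' ->]] := upP a.
    by rewrite model_coframe_mm !eqxx mulr1.
  by rewrite model_coframe_mu (negbTE (up_max _)) mulr0 mul0r.
rewrite model_coframe_mu mulr0 addr0; have [->|[a' ->]] := upP a.
  rewrite kk_metric_maxl W mxE (negbTE (up_max _)) andbF mulr0.
  by rewrite big1 // => s _; rewrite model_coframe_um !mul0r.
rewrite kk_metric_up /= !model_form_zero // !ffunE !mulr0 addr0 hP // mxE.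
apply: eq_bigr => s _; rewrite mul_mx_diag !model_coframe_uu !mxE.
by [].
Qed.

Lemma model_closed_coframe (j : idx M) : closed_coframe (coords j) (g j) (coframe (spin K) j).
Proof.
have [sP uP _ dP] := cP; rewrite model_coords.
have oC := open_model_dom; have oB : open (ball x0 r) by exact: ball_open.
split.
- move=> a b; have [->|[a' ->]] := upP a; have [->|[b' ->]] := upP b.
  + by apply: smooth_eq (@smooth_cst _ _ model_dom k) => // z _; rewrite model_coframe_mm.
  + by apply: smooth_eq (@smooth_cst _ _ model_dom 0) => // z _; rewrite model_coframe_mu.
  + by apply: smooth_eq (@smooth_cst _ _ model_dom 0) => // z _; rewrite model_coframe_um.
  + apply: (@smooth_eq _ _ _ (fun z => P (base_coord z) a' b')) => //.
      by move=> z _; rewrite model_coframe_uu.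
    exact: (smooth_base oC oB (fun y Cy => Cy) (sP a' b')).
- move=> y Cy; rewrite unitmxE /= /model_coframe (@det_ublock _ 10 1) det_scalar1.
  by rewrite unitrM -unitmxE uP //= unitfE gt_eqF ?expR_gt0.
- by move=> y Cy; exact: model_metric.
move=> y Cy m l a.
have uu a' b' : (fun z => E z (up a') (up b')) = fun z => P (base_coord z) a' b'.
  by apply/funext => z; rewrite model_coframe_uu.
have um a' : (fun z => E z (up a') ord_max) = fun=> 0.
  by apply/funext => z; rewrite model_coframe_um.
have mu a' : (fun z => E z ord_max (up a')) = fun=> 0.
  by apply/funext => z; rewrite model_coframe_mu.
have mm : (fun z => E z ord_max ord_max) = fun=> k.
  by apply/funext => z; rewrite model_coframe_mm.
rewrite -/E; have [->|[a' ->]] := upP a.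
  have E0 b e : partial b (fun z => E z ord_max e) y = 0.
    by have [->|[e' ->]] := upP e; rewrite ?mm ?mu partial_cst.
  exact: etrans (E0 _ _) (esym (E0 _ _)).
have [->|[m' ->]] := upP m; have [->|[l' ->]] := upP l => //.
- by rewrite um uu partial_cst (partial_base_max (fun x => P x a' l')).
- by rewrite um uu partial_cst (partial_base_max (fun x => P x a' m')).
- rewrite !uu (partial_base_up (fun x => P x a' l')) (partial_base_up (fun x => P x a' m')).
  exact: dP.
Qed.

Lemma model_lorentzian : lorentzian_metric g.
Proof.
have [sE uE gE _] := model_closed_coframe tt.
split.
- by move=> [] y jy; exists (E y); [exact: uE|exact: gE].
- move=> []; have oC : open (coords (tt : idx M)) by rewrite model_coords; exact: open_model_dom.
  apply: (smooth_mx_eq oC (A := fun y => (E y)^T *m eta_mx R 11 *m E y)).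
    by move=> y jy; rewrite gE.
  apply: smooth_mxM => //; apply: smooth_mxM => //; first exact: smooth_tr.
  exact: smooth_mx_cst.
- move=> [] [] y jky; rewrite model_trans jacobian_id trmx1 mul1mx mulmx1.
  by [].
Qed.

Lemma model_spin_structure : spin_structure gam g (spin K).
Proof.
have [sE uE gE _] := model_closed_coframe tt.
split; split.
- by move=> [].
- by move=> [] y jy; split; [exact: uE|exact: gE].
- by move=> j l; exact: smooth_mx_cst.
- by move=> j l m _; exists [::]; split=> //; rewrite big_nil.
- move=> [] [] m [jm _] a /=; rewrite mulmx1 mul1mx.
  have -> : coframe_change (spin K) (tt : idx M) (tt : idx M) m = 1%:M.
    rewrite /coframe_change model_trans jacobian_id mulmx1 mulmxV //.
    by apply: uE; rewrite model_coords.
  rewrite (bigD1 a) //= big1 ?addr0; first by rewrite mxE eqxx scale1r.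
  by move=> b ba; rewrite mxE eq_sym (negbTE ba) scale0r.
- by move=> j l n m _ /=; rewrite mulmx1.
Qed.

Lemma model_solution : sugra_solution gam g F (spin K).
Proof.
exact: vacuum_solution model_manifold model_lorentzian model_spin_structure
  model_flux model_closed_coframe.
Qed.

Lemma base_act (y : 'rV[R]_11) (s : R) :
  base_coord (y + s *: delta_mx 0 ord_max) = base_coord y.
Proof. by rewrite addrC base_line base_delta_max scaler0 add0r. Qed.

Lemma act_eq (y : 'rV[R]_11) (s : R) : y + s *: delta_mx 0 ord_max = y -> s = 0.
Proof.
move=> /rowP/(_ ord_max); rewrite !mxE !eqxx mulr1 => /eqP.
by rewrite -subr_eq0 addrAC subrr add0r => /eqP.
Qed.

Lemma model_bundle : principal_bundle K.
Proof.
split; [split|split; split].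
- move=> m Cm; have [im bm] := model_base_param Cm; split=> //.
  exact: (dom_carrier mN im).
- move=> p [_ [ip bp]]; exists (row_mx (chart i0 p) 0 : 'rV[R]_11).
    by rewrite /= /model_dom /= base_row.
  by rewrite /= base_row chartK.
- move=> j m Cm; have := model_base_param Cm; split; first by split=> //; case: H.
  by rewrite /= paramK //; exact: BU.
- by move=> s m Cm; rewrite /= /model_dom /= base_act.
- move=> [s m] _ /=.
  exact: (@cvgD _ _ _ _ (nbhs_filter (s, m)) _ _ _ _ cvg_snd
    (@cvgZ _ _ _ _ _ _ _ _ _ cvg_fst (cvg_cst _))).
- by move=> m _; rewrite /= scale0r addr0.
- by move=> s t m _; rewrite /= scalerDl [s *: _ + _]addrC addrA.
- move=> m m' Cm Cm' /=; split=> [e|[s <-]]; last by rewrite base_act.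
  have bb : base_coord m = base_coord m'.
    by rewrite -(paramK mN (BU Cm)) e paramK //; exact: BU.
  exists (m' 0 ord_max - m 0 ord_max); apply/rowP => a; rewrite !mxE.
  have [->|[a' ->]] := upP a; first by rewrite !eqxx mulr1 addrC subrK.
  rewrite (negbTE (up_max a')) andbF mulr0 addr0.
  by rewrite -!base_coordE bb.
(* Period zero: the action is free and the group is R. *)
- exists 0 => m s Cm /=; split=> [/act_eq ->|[q ->]]; first by exists 0; rewrite mulr0z.
  by rewrite mul0rz scale0r addr0.
- by move=> j m s Cm _; rewrite /= /fibre_coord !mxE !eqxx mulr1.
Qed.

Lemma model_background : iia_background (D : iia_fields R X (idx N')).
Proof.
have [[_ _ lh sD] [fH cH gA fG]] := bgD; have oU := open_model_base.
split; split.
- exact: manifold_open_submanifold.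
(* The restricted base is the image of a ball, which is star-shaped, hence connected. *)
- have -> : carrier N' = param i0 @` ball x0 r.
    apply/seteqP; split=> [p [_ [ip bp]]|_ [x bx <-]].
      by exists (chart i0 p); rewrite ?chartK.
    split; last exact: model_base_param.
    by apply: (dom_carrier mN (i:=i0)); apply: dom_param => //; exact: BU.
  apply: connected_continuous_connected.
    apply: (@star_connected _ _ _ x0); first exact: ballxx.
    by move=> z t; exact: ball_star.
  apply: continuous_in_subspaceT => x; rewrite inE => bx.
  by apply: (continuous_param mN); exact: BU.
- exact: sub_lorentzian_metric.
- exact: sub_smooth_function.
- exact: sub_form_field.
- exact: sub_closed_form.
- exact: sub_gauge_potential.
- exact: sub_form_field.
Qed.

Lemma model_xi_form (j : idx M) y : model_dom y ->
  flat_one_form g j y (delta_mx 0 ord_max) = one_form ((k * k) *: delta_mx 0 ord_max).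
Proof.
move=> Cy; congr one_form; rewrite -rowE; apply/rowP => a.
rewrite mxE kk_metric_maxl model_potential // [RHS]mxE.
by rewrite /= model_dilaton // -expRD; congr (expR _ * _); field.
Qed.

(** Constant spinors are invariant because xi^b has constant coefficients. Conversely the Killing
    equation says that the partial derivatives vanish, and the domain of the chart is connected. *)
Lemma model_killing_dim : iia_killing_dim gam (D : iia_fields R X (idx N')) K 32.
Proof.
have vk := vacuum_killing_cst gam model_manifold model_lorentzian model_flux model_closed_coframe.
exists (fun a _ _ => delta_mx a 0); split=> [a|eps [epsK _]].
  split; first exact: vk.
  move=> j y jy; rewrite /spin_lie.
  rewrite (vacuum_nabla_cst _ model_manifold model_lorentzian model_closed_coframe) // add0r.
  rewrite (extd_cst_on (U := model_dom) (a0 := one_form ((k * k) *: delta_mx 0 ord_max))).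
  - by rewrite cliff0 scaler0 mul0mx.
  - exact: open_model_dom.
  - by rewrite -(model_coords j).
  - by move=> z; exact: model_xi_form.
have [y0 by0] : exists y0 : 'rV[R]_11, base_coord y0 = x0.
  by exists (row_mx x0 0 : 'rV[R]_11); rewrite base_row.
have Cx : model_dom y0 by rewrite /model_dom /= by0; exact: ballxx.
have cM : connected model_dom.
  apply: (star_connected Cx) => z t bz t01; rewrite /model_dom /= base_line.
  have -> : base_coord (z - y0) = base_coord z - x0 by rewrite -by0; apply/rowP => a; rewrite !mxE.
  by rewrite by0; exact: ball_star.
have eC y : model_dom y -> eps tt y = eps tt y0.
  move=> Cy; apply: (pmx0_connected open_model_dom cM) => //.
    by rewrite -(model_coords tt); exact: epsK.1.1.
  move=> l z Cz; apply: (vacuum_killing_locally model_manifold model_lorentzian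
    model_flux model_closed_coframe l epsK).
  by rewrite model_coords.
have sumE (c : 'rV[R]_32) : \sum_(a < 32) c 0 a *: (delta_mx a 0 : 'cV[R]_32) = c^T.
  apply/colP => d; rewrite summxE (bigD1 d) //= big1 ?addr0.
    by rewrite !mxE !eqxx mulr1.
  by move=> a ad; rewrite !mxE eq_sym (negbTE ad) mulr0.
exists (eps tt y0)^T; split=> [[] y|c ec].
  by rewrite model_coords => /eC ->; rewrite sumE trmxK.
rewrite (ec tt); last by rewrite model_coords.
by rewrite sumE trmxK.
Qed.

Lemma model_maximal :
  maximally_supersymmetric_solution gam (D : iia_fields R X (idx N')) K.
Proof.
by split; [split; [exact: model_background|exact: model_bundle|exact: model_solution]|
  exact: model_killing_dim].
Qed.

End Model.

Theorem theorem2 (R : realType) (gam : 'I_11 -> 'M[R]_32)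
    (gamP : clifford_module gam) :
  (forall (X : topologicalType) (N : atlas R X 10)
      (D : iia_fields R X (idx N)) (K : kk_space N),
    maximally_supersymmetric_solution gam D K ->
    [/\ flat_metric (h_metric D), constant_dilaton D,
        vanishing (H_form D), vanishing (G_form D) & pure_gauge (A_form D)]) /\
  (forall (X : topologicalType) (N : atlas R X 10)
      (D : iia_fields R X (idx N)),
    iia_background D ->
    flat_metric (h_metric D) -> constant_dilaton D ->
    vanishing (A_form D) -> vanishing (H_form D) -> vanishing (G_form D) ->
    forall p : X, carrier N p ->
      exists U : set X,
        [/\ open U, U p, U `<=` carrier N &
            exists K : kk_space (open_submanifold N U),
              maximally_supersymmetric_solution gam
                (D : iia_fields R X (idx (open_submanifold N U))) K]).
Proof.
split=> [X N D K msol|X N D bgD flat [c0 cD] vA vH vG p Np].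
  split; [exact: maxsusy_flat msol|exact: maxsusy_dilaton msol|
    exact: maxsusy_H msol|exact: maxsusy_G msol|exact: maxsusy_gauge msol].
have [[mN _ [lh sh _] _] _] := bgD; have [i ip] := carrier_dom mN Np.
(* The neighbourhood of [p] is the part of its chart over this ball, where the orthonormal coframe
   is closed. *)
have [r r0 [rU [P cP]]] := flat_closed_coframe (open_coords mN (i:=i)) (coords_chart ip)
  (sh i) (lh i) (flat i).
exists (model_base i (chart i p) r); split.
- exact: open_model_base bgD.
- by split=> //; exact: ballxx.
- by move=> q [iq _]; exact: dom_carrier iq.
exists (model_space i (chart i p) r c0 P).
exact: model_maximal.
Qed.
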